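(* For each $n\ge1$ consider the random (scaled Weyl) polynomial in one complex variable $$H_n(z)=\sum_{j=0}^na_{nj}\frac{z^j\sqrt{n^j}}{\sqrt{j!}},$$ whose zeros are the zeros of the Weyl polynomial $\sum_{j=0}^na_{nj}\frac{z^j}{\sqrt{j!}}$ scaled by $1/\sqrt n$, where the $a_{nj}$ ($0\le j\le n$, $n=1,2,\dots$) are i.i.d. complex random variables whose distribution satisfies (A) and (B). Then almost surely the normalized zero measures $\frac{1}{2\pi}\Delta\bigl(\frac1n\log|H_n|\bigr)=\frac1n\sum_{k=1}^n\delta_{z_k^{(n)}}$, where $z_1^{(n)},\dots,z_n^{(n)}$ are the zeros of $H_n$ counted with multiplicity, converge weakly as positive measures, as $n\to\infty$, to normalized Lebesgue measure $\frac1\pi\mathbf{1}_{\{|z|\le1\}}dm_2(z)$ on the unit disk.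
   Context: Distribution conditions: a complex random variable has distribution $\phi(z)\,dm_2(z)$, where $\phi$ is a probability density with respect to Lebesgue measure $dm_2$ on $\mathbb{C}=\mathbb{R}^2$. For some $T>0$: (A) $|\phi(z)|\le T$ for all $z\in\mathbb{C}$; (B) $\left|\int_{|z|\ge R}\phi(z)\,dm_2(z)\right|\le T/R^2$ for all $R$ sufficiently large. Real random variables are also allowed: then $\phi(z)dm_2(z)$ is replaced by $\phi(x)dm_1(x)$, with $dm_1$ Lebesgue measure on $\mathbb{R}$, everywhere including in (A) and (B). ''Almost surely'' is with respect to the product probability space $\otimes_{n=1}^\infty(\mathbb{C}^{n+1},Prob_{n+1})$, where $Prob_N$ is the $N$-fold product of the distribution $\phi$. (Almost surely $a_{nn}\ne0$ for all $n$, so $H_n$ has exactly $n$ zeros.) *)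

(* Defs.v *)
From HB Require Import structures.
From mathcomp Require Import all_boot all_order all_algebra.
From mathcomp Require Import all_classical all_reals all_analysis.
From mathcomp Require Import measurable_realfun complex.

Set Implicit Arguments.
Unset Strict Implicit.
Unset Printing Implicit Defensive.

Import Order.TTheory GRing.Theory Num.Theory.
Import numFieldNormedType.Exports.

Local Open Scope classical_set_scope.
Local Open Scope ring_scope.

(* [R[i]] carries the algebra of the complex plane (polynomials and their
   roots), [R * R] its topology, its Borel sets and its measures; [toC] and
   [ofC] identify the two. *)
Notation plane R := (measurableTypeR R * measurableTypeR R)%type.

Section Plane.
Variable R : realType.

Definition toC (z : plane R) : R[i] := Complex z.1 z.2.

Definition ofC (z : R[i]) : plane R := (complex.Re z, complex.Im z).

(* The norm [`|z|] of the product [R * R] is the max norm, so the Euclidean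
   modulus is taken in [R[i]]. *)
Definition modulus (z : plane R) : R := Normc.normc (toC z).

Definition dm1 : {measure set (measurableTypeR R) -> \bar R} :=
  @lebesgue_measure R.

Definition dm2 : {measure set (plane R) -> \bar R} :=
  (@lebesgue_measure R \x @lebesgue_measure R)%E.

End Plane.

Section Distributions.
Variable R : realType.

Definition probability_density d (X : measurableType d)
    (m : {measure set X -> \bar R}) (phi : X -> R) : Prop :=
  [/\ measurable_fun setT phi,
      forall x, 0 <= phi x &
      (\int[m]_x (phi x)%:E = 1)%E].

(* [absv] is the modulus on the plane or the absolute value on the line. *)
Definition bounded_with_tail d (X : measurableType d)
    (m : {measure set X -> \bar R}) (absv : X -> R) (phi : X -> R) (T : R)
    : Prop :=
  (forall x, `|phi x| <= T) /\
  (\forall r \near +oo,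
     (`| \int[m]_(x in [set x | (r <= absv x)%R]) (phi x)%:E |
        <= (T / r ^+ 2)%:E)%E).

Definition complex_law (T : R) (law : set (plane R) -> \bar R) : Prop :=
  exists phi : plane R -> R,
    [/\ probability_density (dm2 R) phi,
        bounded_with_tail (dm2 R) (@modulus R) phi T &
        forall B : set (plane R), measurable B ->
          law B = (\int[dm2 R]_(z in B) (phi z)%:E)%E].

(* Real random variables: the law [phi(x) dm_1(x)] lives on the real axis of
   the plane. *)
Definition real_law (T : R) (law : set (plane R) -> \bar R) : Prop :=
  exists phi : measurableTypeR R -> R,
    [/\ probability_density (dm1 R) phi,
        bounded_with_tail (dm1 R) (fun x : R => `|x|) phi T &
        forall B : set (plane R), measurable B ->
          law B = (\int[dm1 R]_(x in [set x : R | B (x, 0%R)]) (phi x)%:E)%E].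

Definition mutually_independent d (Omega : measurableType d)
    (P : probability Omega R) d' (X : measurableType d') (I : choiceType)
    (J : set I) (xi : I -> {RV P >-> X}) : Prop :=
  forall (s : seq I) (B : I -> set X),
    uniq s -> (forall i, i \in s -> J i) ->
    (forall i, measurable (B i)) ->
    (P (\bigcap_(i in [set` s]) (xi i @^-1` B i))
       = \prod_(i <- s) P (xi i @^-1` B i))%E.

End Distributions.

Section Zeros.
Variable R : realType.

Definition scaled_weyl (n : nat) (c : nat -> R[i]) : {poly R[i]} :=
  \poly_(j < n.+1)
    (c j * (Num.sqrt (n%:R ^+ j : R) / Num.sqrt (j`!%:R : R))%:C%C).

(* For [p != 0], a list [z_1, ..., z_N] with
   [p = lead_coef p *: \prod_k ('X - z_k%:P)], that is the zeros of [p]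
   repeated according to multiplicity. *)
Definition zeros (p : {poly R[i]}) : seq R[i] :=
  sval (closed_field_poly_normal p).

Definition zero_measure (n : nat) (p : {poly R[i]}) :
    {measure set (plane R) -> \bar R} :=
  mscale (n%:R^-1)%:nng
    (msum (fun k => dirac (ofC (nth 0 (zeros p) k))) n).

End Zeros.

Section Disk.
Variable R : realType.

Definition unit_disk : set (plane R) := [set z | modulus z <= 1].

Lemma measurable_unit_disk : measurable unit_disk.
Proof.
have -> : unit_disk = setT `&` (fun z : plane R => z.1 ^+ 2 + z.2 ^+ 2) @^-1`
    `]-oo, 1].
  rewrite setTI; apply/seteqP; split => -[x y];
    rewrite /unit_disk /modulus /toC /Normc.normc /= in_itv /= => h.
    rewrite -(sqr_sqrtr (addr_ge0 (sqr_ge0 x) (sqr_ge0 y))).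
    by rewrite expr_le1 ?sqrtr_ge0.
  by rewrite -sqrtr1 ler_sqrt ?ler01.
have mf : measurable_fun setT (fun z : plane R => z.1 ^+ 2 + z.2 ^+ 2).
  by apply: measurable_funD; apply: measurable_funX.
by apply: mf => //; exact: measurable_itv.
Qed.

Lemma invr_pi_ge0 : 0 <= (@pi R)^-1.
Proof. by rewrite invr_ge0 pi_ge0. Qed.

Definition uniform_disk : {measure set (plane R) -> \bar R} :=
  mscale (NngNum invr_pi_ge0) (mrestr (dm2 R) measurable_unit_disk).

End Disk.

Section Calculus.
Variable R : realType.

Definition dx (f : R * R -> R) (z : R * R) : R := 'D_((1, 0) : R * R) f z.

Definition dy (f : R * R -> R) (z : R * R) : R := 'D_((0, 1) : R * R) f z.

Fixpoint class_C (k : nat) (f : R * R -> R) : Prop :=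
  if k is k'.+1 then
    [/\ forall z, derivable f z ((1, 0) : R * R),
        forall z, derivable f z ((0, 1) : R * R),
        class_C k' (dx f) & class_C k' (dy f)]
  else continuous f.

Definition test_function (f : R * R -> R) : Prop :=
  (forall k, class_C k f) /\ compact (closure [set z | f z != 0]).

Definition laplacian (f : R * R -> R) (z : R * R) : R :=
  dx (dx f) z + dy (dy f) z.

(* [(2 pi)^-1 Delta u = nu] in the sense of distributions. *)
Definition normalized_laplacian_is (u : R * R -> R)
    (nu : {measure set (plane R) -> \bar R}) : Prop :=
  (forall K : set (R * R), compact K ->
     (dm2 R).-integrable (K : set (plane R)) (fun z => (u z)%:E)) /\
  (forall f : R * R -> R, test_function f ->
     (((2 * pi)^-1)%:E * \int[dm2 R]_z (u z * laplacian f z)%:E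
        = \int[nu]_z (f z)%:E)%E).

Definition weak_cvg (nu_ : nat -> {measure set (plane R) -> \bar R})
    (nu : {measure set (plane R) -> \bar R}) : Prop :=
  forall f : R * R -> R, continuous f -> bounded_fun f ->
    (fun n => (\int[nu_ n]_z (f z)%:E)%E) @ \oo
      --> (\int[nu]_z (f z)%:E)%E.

End Calculus.

(* Main.v *)
Require Import Defs.
From HB Require Import structures.
From mathcomp Require Import all_boot all_order all_algebra.
From mathcomp Require Import all_classical all_reals all_analysis.
From mathcomp Require Import measurable_realfun complex ring lra zify.

(** The zero measure of [H_n] is the normalized Laplacian of [n^-1 log |H_n|],
    and the uniform measure on the disk is that of the radial potential
    [phi(z) = (min(|z|^2, 1) + log max(|z|^2, 1)) / 2].  So it is enough to show
    that almost surely [n^-1 log |H_n| -> phi] in [L^1] of a square containing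
    the disk in its interior: testing against [C^2] functions then gives
    convergence of the zero measures, and since the limit has its full mass
    inside the square no zero mass escapes, so the convergence is weak.

    The deterministic coefficients [sqrt (n^j / j!) |z|^j] all lie below
    [exp (n phi(z))], and the largest one is within a factor [e sqrt n] of it.
    The upper bound on [log |H_n|] follows from the tail hypothesis (B) and
    Borel-Cantelli.  For the lower bound, conditioning on all coefficients but the
    one with the largest factor, boundedness (A) of the density gives
    [P(|H_n(z)| <= exp (n (phi(z) - tau))) = O(n exp (- n tau))] uniformly in
    [z]; by Tonelli the expected area of these exceptional sets is summable in
    [n], which bounds the integral of the negative part. *)

Set Implicit Arguments.
Unset Strict Implicit.
Unset Printing Implicit Defensive.

Import Order.TTheory GRing.Theory Num.Theory.
Import numFieldNormedType.Exports.
Local Open Scope classical_set_scope.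
Local Open Scope ring_scope.

(** * Integration on the plane *)

Section PlaneIntegration.
Variable R : realType.
Local Notation mu := (@lebesgue_measure R).
Local Notation m2 := (dm2 R).

(** A lower bound for [log |H_n|] cannot hold at every point, since the logarithm is [-oo] at the
    zeros; failure can only be rare. The negative part of the error is therefore cut into levels
    [(k + 1) e]: its size at [z] is at most a multiple of [e] plus [e] times the number of levels
    reached, and the level-[k] set has expected area [O(n exp (- n (k + 1) e))]. The sum over [k]
    controls the integral, the sum over [n] gives almost sure convergence, and [e = 1 / (m + 1)]
    keeps the null sets countable in number. The dominant index depends on [z], so the conditioning
    is done at a fixed [z], before integrating over the square. Laplacians are handled on
    rectangles, one coordinate line at a time: Fubini reduces Green's identity to the fundamental
    theorem of calculus. This also covers the limit potential, whose first derivatives are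
    continuous across the unit circle while its second derivatives jump. Two derivatives suffice for
    testing, so continuous functions are approximated with a piecewise polynomial partition of
    unity. *)

Lemma open_measurable_plane (O : set (R * R)) :
  open O -> measurable (O : set (plane R)).
Proof.
move=> oO.
(* An open set of the product topology is a union of rational boxes, hence a countable union of
   elements of the product sigma-algebra. *)
pose box (q : (rat * rat) * (rat * rat)) : set (plane R) :=
  `]ratr q.1.1, ratr q.1.2[ `*` `]ratr q.2.1, ratr q.2.2[.
have -> : O = \bigcup_(q in [set q | box q `<=` O]) box q.
  apply/seteqP; split; last by move=> z [q /= qO] /qO.
  move=> [x y] Oxy.
  have /nbhs_ballP[e /= e0 eO] : nbhs ((x, y) : R * R) O by exact: open_nbhs_nbhs.
  have rx := @rat_in_itvoo R (x - e) x; have rx' := @rat_in_itvoo R x (x + e).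
  have ry := @rat_in_itvoo R (y - e) y; have ry' := @rat_in_itvoo R y (y + e).
  case: rx => [|q1]; first by rewrite ltrBlDr ltrDl.
  case: rx' => [|q2]; first by rewrite ltrDl.
  case: ry => [|q3]; first by rewrite ltrBlDr ltrDl.
  case: ry' => [|q4]; first by rewrite ltrDl.
  rewrite !in_itv /= => /andP[a1 a2] /andP[a3 a4] /andP[a5 a6] /andP[a7 a8].
  exists ((q1, q2), (q3, q4)).
    move=> [u v] [/=]; rewrite !in_itv /= => /andP[u1 u2] /andP[v1 v2].
    by apply: eO; split; rewrite /ball /= ltr_norml; apply/andP; split; lra.
  by split; rewrite /= in_itv /=; apply/andP; split.
rewrite bigcup_mkcond.
apply: countable_bigcupT_measurable; first exact: countableP.
by move=> q; case: ifP => // _; apply: measurableX; exact: measurable_itv.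
Qed.

Lemma continuous_measurable_plane (f : R * R -> R) :
  continuous f -> measurable_fun setT (f : plane R -> R).
Proof.
move=> cf; apply: (measurability _ (RGenOpens.measurableE R)).
move=> _ [_ [a [b ->] <-]]; rewrite setTI; apply: open_measurable_plane.
by move/continuousP : cf; apply; exact: interval_open.
Qed.

Lemma compact_measurable_plane (K : set (R * R)) :
  compact K -> measurable (K : set (plane R)).
Proof.
move=> cK; rewrite -[K]setCK; apply: measurableC; apply: open_measurable_plane.
by apply: closed_openC; apply: compact_closed => //; exact: norm_hausdorff.
Qed.

Definition rect (a1 b1 a2 b2 : R) : set (plane R) := `[a1, b1] `*` `[a2, b2].

Lemma measurable_rect a1 b1 a2 b2 : measurable (rect a1 b1 a2 b2).
Proof. by apply: measurableX; exact: measurable_itv. Qed.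

Lemma dm2_setX (A B : set R) :
  measurable (A : set (measurableTypeR R)) ->
  measurable (B : set (measurableTypeR R)) ->
  m2 (A `*` B) = (mu A * mu B)%E.
Proof. by move=> mA mB; exact: product_measure1E. Qed.

Lemma dm2_rect a1 b1 a2 b2 : a1 <= b1 -> a2 <= b2 ->
  m2 (rect a1 b1 a2 b2) = ((b1 - a1) * (b2 - a2))%:E.
Proof.
move=> ab1 ab2; rewrite dm2_setX; [|exact: measurable_itv..].
rewrite !lebesgue_measure_itv /= !lte_fin EFinM.
by congr *%E; case: ltgtP ab1 ab2 => // -> //; rewrite ?subrr //;
  case: ltgtP => // ->; rewrite subrr.
Qed.

Lemma dm2_rect_lty a1 b1 a2 b2 : (m2 (rect a1 b1 a2 b2) < +oo)%E.
Proof.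
rewrite dm2_setX; [|exact: measurable_itv..].
rewrite !lebesgue_measure_itv /= !lte_fin.
by case: ifP; case: ifP; rewrite ?mul0e ?mule0 ?ltry.
Qed.

Lemma integrable_rect (f : plane R -> R) a1 b1 a2 b2 C :
  measurable_fun setT f ->
  (forall z, rect a1 b1 a2 b2 z -> `|f z| <= C) ->
  m2.-integrable (rect a1 b1 a2 b2) (EFin \o f).
Proof.
move=> mf fC; apply: measurable_bounded_integrable.
- exact: measurable_rect.
- exact: dm2_rect_lty.
- exact: measurable_funTS.
- exists C; split; first exact: num_real.
  by move=> D CD z /= /fC h; rewrite (le_trans h)// ltW.
Qed.

Lemma compact_rect a1 b1 a2 b2 :
  compact (rect a1 b1 a2 b2 : set (R * R)).
Proof. by apply: compact_setX; exact: segment_compact. Qed.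

Lemma continuous_bounded_rect (f : R * R -> R) a1 b1 a2 b2 : continuous f ->
  exists2 C, 0 < C & forall z, rect a1 b1 a2 b2 z -> `|f z| <= C.
Proof.
move=> cf.
have /compact_bounded[C [Creal hC]] : compact (f @` (rect a1 b1 a2 b2)).
  apply: continuous_compact; last exact: compact_rect.
  by apply: continuous_subspaceT.
exists (`|C| + 1); first by rewrite ltr_wpDl.
move=> z rz; apply: (hC (`|C| + 1)); last by exists z.
by rewrite (le_lt_trans (ler_norm C))// ltrDl.
Qed.

Lemma continuous_integrable_rect (f : R * R -> R) a1 b1 a2 b2 : continuous f ->
  m2.-integrable (rect a1 b1 a2 b2) (EFin \o (f : plane R -> R)).
Proof.
move=> cf; have [C _ fC] := continuous_bounded_rect a1 b1 a2 b2 cf.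
by apply: integrable_rect fC; exact: continuous_measurable_plane.
Qed.

Lemma fubini_rect (f : plane R -> R) a1 b1 a2 b2 :
  m2.-integrable (rect a1 b1 a2 b2) (EFin \o f) ->
  (\int[m2]_(z in rect a1 b1 a2 b2) (f z)%:E =
     \int[mu]_(y in `[a2, b2]) \int[mu]_(x in `[a1, b1]) (f (x, y))%:E)%E /\
  (\int[m2]_(z in rect a1 b1 a2 b2) (f z)%:E =
     \int[mu]_(x in `[a1, b1]) \int[mu]_(y in `[a2, b2]) (f (x, y))%:E)%E.
Proof.
move=> /integrable_mkcond fi.
have {}fi := fi (@measurable_rect _ _ _ _).
rewrite integral_mkcond; split.
  rewrite -(integral21_prod_meas1 fi) [RHS]integral_mkcond.
  apply: eq_integral => y _; rewrite patchE /fubini_G.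
  case: ifPn => yB.
    rewrite [RHS]integral_mkcond; apply: eq_integral => x _.
    by rewrite !patchE /rect in_setX/= yB andbT.
  by rewrite integral0_eq// => x _; rewrite patchE in_setX /= (negbTE yB) andbF.
rewrite -(integral12_prod_meas1 fi) [RHS]integral_mkcond.
apply: eq_integral => x _; rewrite patchE /fubini_F.
case: ifPn => xB.
  rewrite [RHS]integral_mkcond; apply: eq_integral => y _.
  by rewrite !patchE /rect in_setX/= xB.
by rewrite integral0_eq// => y _; rewrite patchE in_setX /= (negbTE xB).
Qed.

Lemma ftc_is_derive (F g : R -> R) (a b : R) : a <= b ->
  continuous F -> continuous g ->
  (forall x : R, a < x < b -> is_derive x 1 F (g x)) ->
  (\int[mu]_(x in `[a, b]) (g x)%:E = (F b - F a)%:E)%E.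
Proof.
rewrite le_eqVlt => /predU1P[->|ab] cF cg Fg.
  by rewrite set_itv1 integral_set1 subrr.
rewrite EFinB; apply: (continuous_FTC2 ab).
- by apply: continuous_subspaceT.
- split.
  + by move=> x; rewrite in_itv /= => /Fg[].
  + by apply: cvg_at_right_filter; exact: cF.
  + by apply: cvg_at_left_filter; exact: cF.
- move=> x; rewrite in_itv /= => /Fg h.
  by rewrite derive1E; case: h.
Qed.

End PlaneIntegration.

(** * One-variable derivatives and continuity rules *)

Section DerivativeRules.
Variable R : realType.
Implicit Types (f g : R -> R) (x df dg k : R).

Lemma deriv_cst k x : is_derive x 1 (fun _ : R => k) 0.
Proof. exact: is_derive_cst. Qed.

Lemma deriv_id x : is_derive x 1 (fun t : R => t) 1.
Proof. exact: is_derive_id. Qed.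

Lemma deriv_add f g x df dg : is_derive x 1 f df -> is_derive x 1 g dg ->
  is_derive x 1 (fun t => f t + g t) (df + dg).
Proof. by move=> ? ?; exact: is_deriveD. Qed.

Lemma deriv_sub f g x df dg : is_derive x 1 f df -> is_derive x 1 g dg ->
  is_derive x 1 (fun t => f t - g t) (df - dg).
Proof. by move=> ? ?; exact: is_deriveB. Qed.

Lemma deriv_mul f g x df dg : is_derive x 1 f df -> is_derive x 1 g dg ->
  is_derive x 1 (fun t => f t * g t) (f x * dg + g x * df).
Proof. by move=> ? ?; exact: is_deriveM. Qed.

Lemma deriv_chain f g x df dg : is_derive (g x) 1 f df -> is_derive x 1 g dg ->
  is_derive x 1 (fun t => f (g t)) (df * dg).
Proof. by move=> ? ?; exact: is_derive1_comp. Qed.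

Lemma deriv_inv f x df : f x != 0 -> is_derive x 1 f df ->
  is_derive x 1 (fun t => (f t)^-1) (- (f x) ^- 2 * df).
Proof. by move=> fx0 h; exact: is_deriveV. Qed.

Lemma deriv_sqr f x df : is_derive x 1 f df ->
  is_derive x 1 (fun t => f t ^+ 2) (2 * f x * df).
Proof.
move=> h; have := deriv_mul h h; rewrite -mulrDr.
by move=> h'; apply: (is_derive_eq h'); ring.
Qed.

(** Along a coordinate line the regularized squared distance to a point is [(t - a)^2 + c], where
    [c] collects the other coordinate and the regularization. *)
Lemma deriv_quad (a c x : R) :
  is_derive x 1 (fun t => (t - a) ^+ 2 + c) (2 * (x - a)).
Proof.
have h := deriv_add (deriv_sqr (deriv_sub (deriv_id x) (deriv_cst a x)))
  (deriv_cst c x).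
by apply: (is_derive_eq h); ring.
Qed.

Lemma quad_gt0 (a c x : R) : 0 < c -> 0 < (x - a) ^+ 2 + c.
Proof. by move=> c0; rewrite ltr_wpDl// sqr_ge0. Qed.

Lemma deriv_ln_quad (a c x : R) : 0 < (x - a) ^+ 2 + c ->
  is_derive x 1 (fun t => 2^-1 * ln ((t - a) ^+ 2 + c))
    ((x - a) / ((x - a) ^+ 2 + c)).
Proof.
move=> q0.
have h := deriv_mul (deriv_cst 2^-1 x) (deriv_chain (g := fun t => (t - a) ^+ 2 + c) (is_derive1_ln q0) (deriv_quad a c x)).
by apply: (is_derive_eq h); field; rewrite gt_eqF.
Qed.

Lemma deriv_quot_quad (a c x : R) : 0 < (x - a) ^+ 2 + c ->
  is_derive x 1 (fun t => (t - a) / ((t - a) ^+ 2 + c))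
    ((c - (x - a) ^+ 2) / ((x - a) ^+ 2 + c) ^+ 2).
Proof.
move=> q0.
have h := deriv_mul (deriv_sub (deriv_id x) (deriv_cst a x))
  (deriv_inv (f := fun t => (t - a) ^+ 2 + c) (lt0r_neq0 q0) (deriv_quad a c x)).
by apply: (is_derive_eq h); field; rewrite gt_eqF.
Qed.

Lemma deriv_continuous f (df : R -> R) : (forall x : R, is_derive x 1 f (df x)) ->
  continuous f.
Proof.
move=> h x; apply: differentiable_continuous.
by apply/derivable1_diffP; case: (h x).
Qed.

End DerivativeRules.

Section Continuity.
Variables (R : realType) (T : topologicalType).
Implicit Types f g : T -> R.

Lemma cont_cst (k : R) : continuous (fun _ : T => k).
Proof. by move=> z; exact: cvg_cst. Qed.

Lemma cont_add f g : continuous f -> continuous g ->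
  continuous (fun z => f z + g z).
Proof. by move=> cf cg z; apply: cvgD; [exact: cf|exact: cg]. Qed.

Lemma cont_sub f g : continuous f -> continuous g ->
  continuous (fun z => f z - g z).
Proof. by move=> cf cg z; apply: cvgB; [exact: cf|exact: cg]. Qed.

Lemma cont_mul f g : continuous f -> continuous g ->
  continuous (fun z => f z * g z).
Proof. by move=> cf cg z; apply: cvgM; [exact: cf|exact: cg]. Qed.

Lemma cont_sqr f : continuous f -> continuous (fun z => f z ^+ 2).
Proof. by move=> cf; under eq_fun do rewrite expr2; exact: cont_mul. Qed.

Lemma cont_inv f : (forall z, f z != 0) -> continuous f ->
  continuous (fun z => (f z)^-1).
Proof. by move=> f0 cf z; apply: cvgV => //; exact: cf. Qed.

Lemma cont_comp (h : R -> R) f : continuous h -> continuous f ->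
  continuous (fun z => h (f z)).
Proof. by move=> ch cf z; apply: continuous_comp; [exact: cf|exact: ch]. Qed.

Lemma cont_ln f : (forall z, 0 < f z) -> continuous f ->
  continuous (fun z => ln (f z)).
Proof.
by move=> f0 cf z; have := @continuous_comp T R R f (@ln R) z (cf z); apply; exact: continuous_ln.
Qed.

Lemma cont_max f g : continuous f -> continuous g ->
  continuous (fun z => Num.max (f z) (g z)).
Proof.
move=> cf cg.
have -> : (fun z => Num.max (f z) (g z)) =
    (fun z => 2^-1 * (f z + g z + `|f z - g z|)).
  apply/funext => z; have [h|h] := leP (f z) (g z).
    by rewrite ler0_norm ?subr_le0//; field.
  by rewrite ger0_norm ?subr_ge0 ?ltW//; field.
apply: cont_mul; first exact: cont_cst.
apply: cont_add; first exact: cont_add.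
by apply: cont_comp; [exact: norm_continuous|exact: cont_sub].
Qed.

Lemma cont_min f g : continuous f -> continuous g ->
  continuous (fun z => Num.min (f z) (g z)).
Proof.
move=> cf cg.
have -> : (fun z => Num.min (f z) (g z)) =
    (fun z => f z + g z - Num.max (f z) (g z)).
  by apply/funext => z; have [h|h] := leP (f z) (g z); ring.
by apply: cont_sub; [exact: cont_add|exact: cont_max].
Qed.

End Continuity.

(** * Green's identity *)

Section Green.
Variable R : realType.
Local Notation mu := (@lebesgue_measure R).
Local Notation m2 := (dm2 R).

Lemma cont_fst : continuous (fun z : R * R => z.1).
Proof. by move=> z; exact: cvg_fst. Qed.

Lemma cont_snd : continuous (fun z : R * R => z.2).
Proof. by move=> z; exact: cvg_snd. Qed.

Lemma cont_line1 (f : R * R -> R) y : continuous f -> continuous (fun x : R => f (x, y)).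
Proof.
move=> cf x; apply: (@continuous_comp _ _ _ (fun x : R => (x, y) : R * R) f); last exact: cf.
exact: (cvg_pair (@cvg_id _ (nbhs x)) (cvg_cst y)).
Qed.

Lemma cont_line2 (f : R * R -> R) x : continuous f -> continuous (fun y : R => f (x, y)).
Proof.
move=> cf y; apply: (@continuous_comp _ _ _ (fun y : R => (x, y) : R * R) f); last exact: cf.
exact: (cvg_pair (cvg_cst x) (@cvg_id _ (nbhs y))).
Qed.

(** The derivatives are given as explicit functions, so that products of one-variable bumps and
    abstract test functions are treated alike. Vanishing off the open rectangle makes [f] and its
    first derivatives zero on the boundary, which removes the boundary terms of Green's identity. *)
Record C2_supported (f fx fy fxx fyy : R * R -> R) (a1 b1 a2 b2 : R) : Prop := {
  C2_dx : forall x y, is_derive x (1 : R) (fun t => f (t, y)) (fx (x, y));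
  C2_dy : forall x y, is_derive y (1 : R) (fun t => f (x, t)) (fy (x, y));
  C2_dxx : forall x y, is_derive x (1 : R) (fun t => fx (t, y)) (fxx (x, y));
  C2_dyy : forall x y, is_derive y (1 : R) (fun t => fy (x, t)) (fyy (x, y));
  C2_cont : continuous f;
  C2_contxx : continuous fxx;
  C2_contyy : continuous fyy;
  C2_supp : forall z, ~~ ((a1 < z.1 < b1) && (a2 < z.2 < b2)) ->
    [/\ f z = 0, fx z = 0, fy z = 0, fxx z = 0 & fyy z = 0] }.

Lemma C2_supportedS f fx fy fxx fyy a1 b1 a2 b2 a1' b1' a2' b2' :
  a1' <= a1 -> b1 <= b1' -> a2' <= a2 -> b2 <= b2' ->
  C2_supported f fx fy fxx fyy a1 b1 a2 b2 ->
  C2_supported f fx fy fxx fyy a1' b1' a2' b2'.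
Proof.
move=> ? ? ? ? [? ? ? ? ? ? ? h]; split => // z Hz; apply: h.
apply: contra Hz => /andP[/andP[? ?] /andP[? ?]].
by apply/andP; split; apply/andP; split; lra.
Qed.

(** The integrand has the primitive [u f1 - u1 f], which vanishes at both ends. *)
Lemma green_line (u u1 u2 f f1 f2 : R -> R) a b : a <= b ->
  (forall x : R, is_derive x 1 u (u1 x)) -> (forall x : R, is_derive x 1 u1 (u2 x)) ->
  (forall x : R, is_derive x 1 f (f1 x)) -> (forall x : R, is_derive x 1 f1 (f2 x)) ->
  continuous u2 -> continuous f2 ->
  f a = 0 -> f1 a = 0 -> f b = 0 -> f1 b = 0 ->
  (\int[mu]_(x in `[a, b]) (u x * f2 x - u2 x * f x)%:E = 0)%E.
Proof.
move=> ab du du1 df df1 cu2 cf2 fa f1a fb f1b.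
have cu := deriv_continuous du; have cu1 := deriv_continuous du1.
have cf := deriv_continuous df; have cf1 := deriv_continuous df1.
have dK (x : R) : a < x < b -> is_derive x 1 (fun x => u x * f1 x - u1 x * f x)
    (u x * f2 x - u2 x * f x).
  move=> _.
  have h := deriv_sub (deriv_mul (du x) (df1 x)) (deriv_mul (du1 x) (df x)).
  by apply: (is_derive_eq h); ring.
have cK : continuous (fun x => u x * f1 x - u1 x * f x).
  by apply: cont_sub; exact: cont_mul.
have ck : continuous (fun x => u x * f2 x - u2 x * f x).
  by apply: cont_sub; exact: cont_mul.
by rewrite (ftc_is_derive ab cK ck dK) fa fb f1a f1b !mulr0 !subrr.
Qed.

(* The two one-dimensional identities are hypotheses because [u] may have a
   corner in its second derivatives, as the limit potential does on the unit
   circle. *)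
Lemma green_of_lines (u uxx uyy f fx fy fxx fyy : R * R -> R) a1 b1 a2 b2 C :
  C2_supported f fx fy fxx fyy a1 b1 a2 b2 ->
  continuous u ->
  measurable_fun setT (uxx : plane R -> R) ->
  measurable_fun setT (uyy : plane R -> R) ->
  (forall z, rect a1 b1 a2 b2 z -> `|uxx z| <= C) ->
  (forall z, rect a1 b1 a2 b2 z -> `|uyy z| <= C) ->
  (forall y, \int[mu]_(x in `[a1, b1])
     (u (x, y) * fxx (x, y) - uxx (x, y) * f (x, y))%:E = 0)%E ->
  (forall x, \int[mu]_(y in `[a2, b2])
     (u (x, y) * fyy (x, y) - uyy (x, y) * f (x, y))%:E = 0)%E ->
  \int[m2]_(z in rect a1 b1 a2 b2) (u z * (fxx z + fyy z)) =
  \int[m2]_(z in rect a1 b1 a2 b2) ((uxx z + uyy z) * f z).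
Proof.
move=> F cu mxx myy bxx byy h1 h2.
have mf : measurable_fun setT (f : plane R -> R).
  by apply: continuous_measurable_plane; exact: C2_cont F.
have [Cf Cf0 bf] := continuous_bounded_rect a1 b1 a2 b2 (C2_cont F).
have ixx g : measurable_fun setT (g : plane R -> R) ->
    (forall z, rect a1 b1 a2 b2 z -> `|g z| <= C) ->
    m2.-integrable (rect a1 b1 a2 b2) (EFin \o (fun z => g z * f z)).
  move=> mg bg; apply: (@integrable_rect _ _ _ _ _ _ (C * Cf)).
    exact: measurable_funM.
  by move=> z rz; rewrite normrM ler_pM//; [exact: bg|exact: bf].
have iu g : continuous g ->
    m2.-integrable (rect a1 b1 a2 b2) (EFin \o (fun z : plane R => u z * g z)).
  by move=> cg; apply: continuous_integrable_rect; exact: cont_mul.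
have ifxx := iu _ (C2_contxx F); have ifyy := iu _ (C2_contyy F).
have iuxx := ixx _ mxx bxx; have iuyy := ixx _ myy byy.
have mr : measurable (rect a1 b1 a2 b2) by exact: measurable_rect.
have e1 : \int[m2]_(z in rect a1 b1 a2 b2) (u z * fxx z - uxx z * f z) = 0.
  have /fubini_rect[h _] : m2.-integrable (rect a1 b1 a2 b2)
      (EFin \o (fun z : plane R => u z * fxx z - uxx z * f z)).
    by have := integrableB mr ifxx iuxx.
  rewrite /Rintegral h; under eq_integral do rewrite h1.
  by rewrite integral0.
have e2 : \int[m2]_(z in rect a1 b1 a2 b2) (u z * fyy z - uyy z * f z) = 0.
  have /fubini_rect[_ h] : m2.-integrable (rect a1 b1 a2 b2)
      (EFin \o (fun z : plane R => u z * fyy z - uyy z * f z)).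
    by have := integrableB mr ifyy iuyy.
  rewrite /Rintegral h; under eq_integral do rewrite h2.
  by rewrite integral0.
move: e1 e2; rewrite RintegralB// RintegralB// => /subr0_eq e1 /subr0_eq e2.
under eq_Rintegral do rewrite mulrDr.
under [RHS]eq_Rintegral do rewrite mulrDl.
by rewrite RintegralD// RintegralD// e1 e2.
Qed.

End Green.

(** * The logarithmic potential *)

Section LogPotential.
Variable R : realType.
Local Notation mu := (@lebesgue_measure R).
Local Notation m2 := (dm2 R).
Implicit Types (w z : R * R) (e d : R).

(** The smooth function [log sqrt (|z - w|^2 + e)]. Its Laplacian [log_kernel] is positive, has mass
    [2 pi] over the whole plane for every [e > 0], and concentrates at [w] as [e] tends to [0]. *)
Definition log_reg e w z : R := 2^-1 * ln ((z.1 - w.1) ^+ 2 + ((z.2 - w.2) ^+ 2 + e)).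

Definition log_reg_xx e w z : R :=
  ((z.2 - w.2) ^+ 2 + e - (z.1 - w.1) ^+ 2) /
  ((z.1 - w.1) ^+ 2 + ((z.2 - w.2) ^+ 2 + e)) ^+ 2.

Definition log_reg_yy e w z : R :=
  ((z.1 - w.1) ^+ 2 + e - (z.2 - w.2) ^+ 2) /
  ((z.1 - w.1) ^+ 2 + ((z.2 - w.2) ^+ 2 + e)) ^+ 2.

Definition log_kernel e w z : R :=
  2 * e / ((z.1 - w.1) ^+ 2 + ((z.2 - w.2) ^+ 2 + e)) ^+ 2.

(** This is [log |z - w|], except that the convention [ln 0 = 0] gives it the value [0] at [z = w],
    a null set. *)
Definition log_dist w z : R := 2^-1 * ln ((z.1 - w.1) ^+ 2 + (z.2 - w.2) ^+ 2).

Definition square w d : set (plane R) := rect (w.1 - d) (w.1 + d) (w.2 - d) (w.2 + d).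

Lemma log_arg_gt0 e w z : 0 < e -> 0 < (z.1 - w.1) ^+ 2 + ((z.2 - w.2) ^+ 2 + e).
Proof. by move=> e0; apply: quad_gt0; exact: quad_gt0. Qed.

Lemma log_regDE e w z : 0 < e ->
  log_reg_xx e w z + log_reg_yy e w z = log_kernel e w z.
Proof.
move=> e0; have := log_arg_gt0 w z e0; rewrite /log_reg_xx /log_reg_yy /log_kernel => q0.
by field; rewrite gt_eqF.
Qed.

Lemma log_kernel_ge0 e w z : 0 < e -> 0 <= log_kernel e w z.
Proof. by move=> e0; rewrite divr_ge0 ?sqr_ge0// mulr_ge0// ltW. Qed.

Lemma cont_sqr1 w : continuous (fun z : R * R => (z.1 - w.1) ^+ 2).
Proof. by apply: cont_sqr; apply: cont_sub; [exact: cont_fst|exact: cont_cst]. Qed.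

Lemma cont_sqr2 w : continuous (fun z : R * R => (z.2 - w.2) ^+ 2).
Proof. by apply: cont_sqr; apply: cont_sub; [exact: cont_snd|exact: cont_cst]. Qed.

Lemma cont_log_arg e w :
  continuous (fun z : R * R => (z.1 - w.1) ^+ 2 + ((z.2 - w.2) ^+ 2 + e)).
Proof.
apply: cont_add; first exact: cont_sqr1.
by apply: cont_add; [exact: cont_sqr2|exact: cont_cst].
Qed.

Lemma cont_log_reg e w : 0 < e -> continuous (log_reg e w).
Proof.
move=> e0; apply: cont_mul; first exact: cont_cst.
by apply: cont_ln; [move=> z; exact: log_arg_gt0|exact: cont_log_arg].
Qed.

Lemma cont_log_den e w : 0 < e -> continuous (fun z : R * R =>
  (((z.1 - w.1) ^+ 2 + ((z.2 - w.2) ^+ 2 + e)) ^+ 2)^-1).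
Proof.
move=> e0; apply: cont_inv; last by apply: cont_sqr; exact: cont_log_arg.
by move=> z; rewrite expf_neq0// gt_eqF// log_arg_gt0.
Qed.

Lemma cont_log_reg_xx e w : 0 < e -> continuous (log_reg_xx e w).
Proof.
move=> e0; apply: cont_mul; last exact: cont_log_den.
apply: cont_sub; last exact: cont_sqr1.
by apply: cont_add; [exact: cont_sqr2|exact: cont_cst].
Qed.

Lemma cont_log_reg_yy e w : 0 < e -> continuous (log_reg_yy e w).
Proof.
move=> e0; apply: cont_mul; last exact: cont_log_den.
apply: cont_sub; last exact: cont_sqr2.
by apply: cont_add; [exact: cont_sqr1|exact: cont_cst].
Qed.

Lemma cont_log_kernel e w : 0 < e -> continuous (log_kernel e w).
Proof.
by move=> e0; apply: cont_mul; [exact: cont_cst|exact: cont_log_den].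
Qed.

Lemma green_log_reg e w f fx fy fxx fyy a1 b1 a2 b2 : 0 < e ->
  a1 <= b1 -> a2 <= b2 ->
  C2_supported f fx fy fxx fyy a1 b1 a2 b2 ->
  \int[m2]_(z in rect a1 b1 a2 b2) (log_reg e w z * (fxx z + fyy z)) =
  \int[m2]_(z in rect a1 b1 a2 b2) (log_kernel e w z * f z).
Proof.
move=> e0 ab1 ab2 F.
have [C C0 hC] := continuous_bounded_rect a1 b1 a2 b2 (cont_log_reg_xx (w := w) e0).
have [D D0 hD] := continuous_bounded_rect a1 b1 a2 b2 (cont_log_reg_yy (w := w) e0).
have outx y x : ~~ (a1 < x < b1) -> f (x, y) = 0 /\ fx (x, y) = 0.
  by move=> h; case: (C2_supp F (z := (x, y))) => //=; rewrite (negbTE h).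
have outy x y : ~~ (a2 < y < b2) -> f (x, y) = 0 /\ fy (x, y) = 0.
  by move=> h; case: (C2_supp F (z := (x, y))) => //=; rewrite (negbTE h) andbF.
rewrite (@green_of_lines R (log_reg e w) (log_reg_xx e w) (log_reg_yy e w)
  f fx fy fxx fyy a1 b1 a2 b2 (Num.max C D))//.
- by apply: eq_Rintegral => z _; rewrite log_regDE.
- exact: cont_log_reg.
- by apply: continuous_measurable_plane; exact: cont_log_reg_xx.
- by apply: continuous_measurable_plane; exact: cont_log_reg_yy.
- by move=> z /hC h; rewrite le_max h.
- by move=> z /hD h; rewrite le_max h orbT.
- move=> y.
  have q0 (x : R) : 0 < (x - w.1) ^+ 2 + ((y - w.2) ^+ 2 + e).
    exact: (log_arg_gt0 w (x, y) e0).
  have [fa fxa] := outx y a1 ltac:(by rewrite ltxx).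
  have [fb fxb] := outx y b1 ltac:(by rewrite ltxx andbF).
  apply: (@green_line R (fun x : R => log_reg e w (x, y))
    (fun x => (x - w.1) / ((x - w.1) ^+ 2 + ((y - w.2) ^+ 2 + e)))
    (fun x : R => log_reg_xx e w (x, y)) (fun x : R => f (x, y)) (fun x => fx (x, y))
    (fun x : R => fxx (x, y)) _ _ ab1 _ _ _ _ _ _ fa fxa fb fxb).
  + by move=> x; rewrite /log_reg /=; exact: deriv_ln_quad.
  + by move=> x; rewrite /log_reg_xx /=; exact: deriv_quot_quad.
  + by move=> x; exact: C2_dx F x y.
  + by move=> x; exact: C2_dxx F x y.
  + by apply: cont_line1; exact: cont_log_reg_xx.
  + by apply: cont_line1; exact: C2_contxx F.
- move=> x.
  have q0 (y : R) : 0 < (y - w.2) ^+ 2 + ((x - w.1) ^+ 2 + e).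
    by rewrite addrCA; exact: (log_arg_gt0 w (x, y) e0).
  have [fa fya] := outy x a2 ltac:(by rewrite ltxx).
  have [fb fyb] := outy x b2 ltac:(by rewrite ltxx andbF).
  apply: (@green_line R (fun y : R => log_reg e w (x, y)) (fun y => (y - w.2) / ((y - w.2) ^+ 2 + ((x - w.1) ^+ 2 + e)))
    (fun y : R => log_reg_yy e w (x, y)) (fun y : R => f (x, y)) (fun y => fy (x, y))
    (fun y : R => fyy (x, y)) _ _ ab2 _ _ _ _ _ _ fa fya fb fyb).
  + move=> y; rewrite /log_reg /=; under eq_fun do rewrite addrCA.
    exact: deriv_ln_quad.
  + by move=> y; rewrite /log_reg_yy /= addrCA; exact: deriv_quot_quad.
  + by move=> y; exact: C2_dy F x y.
  + by move=> y; exact: C2_dyy F x y.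
  + by apply: cont_line2; exact: cont_log_reg_yy.
  + by apply: cont_line2; exact: C2_contyy F.
Qed.

(** The denominator is [(y - b)^2 + c^2], written as it arises in a flux through two opposite sides
    at distance [k] from the centre, with [c^2 - k^2] as the regularization. *)
Lemma ftc_atan (k c b d : R) : 0 < c -> 0 <= d ->
  (\int[mu]_(y in `[(b - d)%R, (b + d)%R]) (2 * k / (k ^+ 2 + (y - b) ^+ 2 + (c ^+ 2 - k ^+ 2)))%:E =
   (4 * (k / c) * atan (d / c))%:E)%E.
Proof.
move=> c0 d0.
have q0 (y : R) : 0 < (y - b) ^+ 2 + c ^+ 2 by rewrite quad_gt0// exprn_gt0.
have dF (y : R) : is_derive y 1 (fun y => 2 * (k / c) * atan ((y - b) / c))
    (2 * k / (k ^+ 2 + (y - b) ^+ 2 + (c ^+ 2 - k ^+ 2))).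
  have h := deriv_mul (deriv_cst (2 * (k / c)) y) (deriv_chain (g := fun y => (y - b) / c)
    (is_derive1_atan _) (deriv_mul (deriv_sub (deriv_id y) (deriv_cst b y)) (deriv_cst c^-1 y))).
  apply: (is_derive_eq h).
  have -> : k ^+ 2 + (y - b) ^+ 2 + (c ^+ 2 - k ^+ 2) = (y - b) ^+ 2 + c ^+ 2 by ring.
  have := q0 y => qy; by field; rewrite (gt_eqF qy) (gt_eqF c0).
have cF := deriv_continuous dF.
have ck : continuous (fun y : R => 2 * k / (k ^+ 2 + (y - b) ^+ 2 + (c ^+ 2 - k ^+ 2))).
  apply: cont_mul; first exact: cont_cst.
  apply: cont_inv.
    move=> y; have -> : k ^+ 2 + (y - b) ^+ 2 + (c ^+ 2 - k ^+ 2) = (y - b) ^+ 2 + c ^+ 2 by ring.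
    by rewrite gt_eqF.
  apply: cont_add; last exact: cont_cst.
  apply: cont_add; first exact: cont_cst.
  by apply: cont_sqr; apply: cont_sub; [move=> ?; exact: cvg_id|exact: cont_cst].
have le : b - d <= b + d by lra.
rewrite (ftc_is_derive le cF ck (fun y _ => dF y)).
congr EFin.
rewrite (_ : b + d - b = d); last by ring.
rewrite (_ : (b - d - b) / c = - (d / c)); last by field; rewrite gt_eqF.
by rewrite atanN; ring.
Qed.

(** The kernel is a Laplacian, so its mass in the square is the flux of the gradient of [log_reg]
    through the four sides, each contributing [2 (d / c) atan (d / c)] with [c = sqrt (d^2 + e)]. As
    [e] tends to [0] the total tends to [8 (pi / 4) = 2 pi]. *)
Lemma flux_log_kernel e w d : 0 < e -> 0 < d ->
  \int[m2]_(z in square w d) log_kernel e w z =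
  8 * (d / Num.sqrt (d ^+ 2 + e)) * atan (d / Num.sqrt (d ^+ 2 + e)).
Proof.
move=> e0 d0.
have d2e : 0 < d ^+ 2 + e by rewrite ltr_wpDl// sqr_ge0.
set c := Num.sqrt _.
have c0 : 0 < c by rewrite sqrtr_gt0.
have c2 : c ^+ 2 - d ^+ 2 = e by rewrite sqr_sqrtr ?ltW//; ring.
have mr : measurable (square w d) by exact: measurable_rect.
have ixx : m2.-integrable (square w d) (EFin \o (log_reg_xx e w : plane R -> R)).
  by apply: continuous_integrable_rect; exact: cont_log_reg_xx.
have iyy : m2.-integrable (square w d) (EFin \o (log_reg_yy e w : plane R -> R)).
  by apply: continuous_integrable_rect; exact: cont_log_reg_yy.
have line (b c' : R) : 0 < c' ->
   (\int[mu]_(x in `[(b - d)%R, (b + d)%R])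
      ((c' - (x - b) ^+ 2) / ((x - b) ^+ 2 + c') ^+ 2)%:E =
    (2 * d / (d ^+ 2 + c'))%:E)%E.
  move=> c'0.
  have q0 (x : R) : 0 < (x - b) ^+ 2 + c' by rewrite quad_gt0.
  have dF x := deriv_quot_quad (q0 x).
  rewrite (ftc_is_derive (F := fun x => (x - b) / ((x - b) ^+ 2 + c')))//.
  - rewrite (_ : b + d - b = d); last by ring.
    rewrite (_ : b - d - b = - d); last by ring.
    by rewrite sqrrN; congr EFin; ring.
  - by rewrite lerD2l; lra.
  - exact: deriv_continuous dF.
  - apply: cont_mul.
      apply: cont_sub; first exact: cont_cst.
      by apply: cont_sqr; apply: cont_sub; [move=> ?; exact: cvg_id|exact: cont_cst].
    apply: cont_inv; first by move=> x; rewrite expf_neq0// gt_eqF.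
    apply: cont_sqr; apply: cont_add; last exact: cont_cst.
    by apply: cont_sqr; apply: cont_sub; [move=> ?; exact: cvg_id|exact: cont_cst].
transitivity (\int[m2]_(z in square w d) (log_reg_xx e w z + log_reg_yy e w z)).
  by apply: eq_Rintegral => z _; rewrite log_regDE.
rewrite RintegralD//.
rewrite {1}/Rintegral (fubini_rect ixx).1 /log_reg_xx/=.
under eq_integral => y _ do rewrite (line _ _ (quad_gt0 _ _ e0)).
rewrite {1}/Rintegral (fubini_rect iyy).2 /log_reg_yy/=.
under [X in _ + fine X]eq_integral => x _.
  under eq_integral do rewrite addrCA.
  rewrite (line _ _ (quad_gt0 _ _ e0)).
  over.
have E (b : R) : (\int[mu]_(y in `[(b - d)%R, (b + d)%R])
    (2 * d / (d ^+ 2 + ((y - b) ^+ 2 + e)))%:E = (4 * (d / c) * atan (d / c))%:E)%E.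
  rewrite -(@ftc_atan d c b d c0 (ltW d0)); apply: eq_integral => y _.
  by rewrite c2 addrA.
by rewrite !E /=; ring.
Qed.

End LogPotential.

Section LogPotentialLimit.
Variable R : realType.
Local Notation mu := (@lebesgue_measure R).
Local Notation m2 := (dm2 R).
Implicit Types (w z : R * R) (e d : R).

Lemma integrable_log_kernelM e w d (f : R * R -> R) : 0 < e -> continuous f ->
  m2.-integrable (square w d) (EFin \o (fun z : plane R => log_kernel e w z * f z)).
Proof.
move=> e0 cf; apply: continuous_integrable_rect.
by apply: cont_mul => //; exact: cont_log_kernel.
Qed.

Lemma integrable_log_kernel e w d : 0 < e ->
  m2.-integrable (square w d) (EFin \o (log_kernel e w : plane R -> R)).
Proof. by move=> e0; apply: continuous_integrable_rect; exact: cont_log_kernel. Qed.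

Lemma integrable_cst_square w d (k : R) :
  m2.-integrable (square w d) (EFin \o (fun _ : plane R => k)).
Proof. by apply: (@integrable_rect _ (fun=> k) _ _ _ _ `|k|). Qed.

Lemma fine_dm2_square w d : 0 < d -> fine (m2 (square w d)) = (2 * d) ^+ 2.
Proof. by move=> d0; rewrite dm2_rect /=; [ring|lra|lra]. Qed.

Lemma flux_log_kernel_le e w d : 0 < e -> 0 < d ->
  \int[m2]_(z in square w d) log_kernel e w z <= 4 * pi.
Proof.
move=> e0 d0; rewrite flux_log_kernel//.
set c := Num.sqrt _.
have c0 : 0 < c by rewrite sqrtr_gt0 ltr_wpDl// sqr_ge0.
have dc : d / c <= 1.
  rewrite ler_pdivrMr// mul1r -[leLHS](gtr0_norm d0) -sqrtr_sqr.
  by apply: ler_wsqrtr; rewrite lerDl ltW.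
have dc0 : 0 <= d / c by rewrite divr_ge0 ?ltW.
have := @atan_ltpi2 R (d / c); have : 0 <= atan (d / c) by rewrite -atan0 le_atan.
move: (d / c) dc dc0 => x x1 x0 a0 a1.
have : x * atan x <= 1 * (pi / 2) by rewrite ler_pM// ltW.
lra.
Qed.

Lemma flux_log_kernel_cvg w d : 0 < d ->
  (fun n => \int[m2]_(z in square w d) log_kernel n.+1%:R^-1 w z) @ \oo --> (2 * pi : R).
Proof.
move=> d0.
under eq_fun do rewrite flux_log_kernel ?invr_gt0//.
have -> : 2 * pi = 8 * (d / Num.sqrt (d ^+ 2 + 0)) * atan (d / Num.sqrt (d ^+ 2 + 0)) :> R.
  by rewrite addr0 sqrtr_sqr gtr0_norm// divff ?gt_eqF// atan1; field.
have h : (fun n : nat => d / Num.sqrt (d ^+ 2 + n.+1%:R^-1)) @ \oo -->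
    d / Num.sqrt (d ^+ 2 + 0).
  apply: cvgM; first exact: cvg_cst.
  apply: cvgV; first by rewrite addr0 sqrtr_sqr gtr0_norm// gt_eqF.
  apply: (@cvg_comp _ _ _ (fun n : nat => d ^+ 2 + n.+1%:R^-1) Num.sqrt _ (nbhs (d ^+ 2 + 0))).
    by apply: cvgD; [exact: cvg_cst|exact: cvg_harmonic].
  exact: sqrt_continuous.
apply: cvgM; first by apply: cvgM => //; exact: cvg_cst.
by apply: (cvg_comp _ _ h); exact: continuous_atan.
Qed.

Lemma continuous_near_square (f : R * R -> R) w eps : continuous f -> 0 < eps ->
  exists2 dl, 0 < dl &
    forall z, `|z.1 - w.1| < dl -> `|z.2 - w.2| < dl -> `|f z - f w| < eps.
Proof.
move=> cf e0; have /cvgrPdist_lt/(_ _ e0) := cf w.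
move=> /nbhs_ballP[dl /= dl0 h]; exists dl => // z h1 h2.
by rewrite distrC; apply: h; split; rewrite /ball /= distrC.
Qed.

Lemma log_kernel_approx w d (f : R * R -> R) : 0 < d -> continuous f ->
  (fun n => \int[m2]_(z in square w d) (log_kernel n.+1%:R^-1 w z * (f z - f w)))
    @ \oo --> (0 : R).
Proof.
move=> d0 cf; apply/cvgr0Pnorm_lt => eps eps0.
have pi0 := @pi_gt0 R.
(* Near [w] the integrand is at most [eta] times the kernel, whose mass is at most [4 pi]: this
   costs [eps / 2]. At distance at least [dl] the kernel is at most [2 e / dl^4], so this part costs
   at most [e A], with [(2 d)^2] the area of the square. *)
pose eta := eps / 2 / (4 * pi).
have eta0 : 0 < eta by rewrite !divr_gt0// mulr_gt0.
have [dl dl0 hdl] := continuous_near_square w cf eta0.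
have cfw : continuous (fun z => f z - f w) by apply: cont_sub => //; exact: cont_cst.
have [C C0 hC] := continuous_bounded_rect (w.1 - d) (w.1 + d) (w.2 - d) (w.2 + d) cfw.
pose A := C * (2 / dl ^+ 4) * (2 * d) ^+ 2.
have A0 : 0 < A by rewrite !mulr_gt0// ?exprn_gt0// ?mulr_gt0// invr_gt0 exprn_gt0.
have eA : 0 < eps / 2 / A by rewrite !divr_gt0.
have := near_infty_natSinv_lt (PosNum eA).
apply: filterS => n /= hn.
set e := n.+1%:R^-1 in hn *.
have e0 : 0 < e by rewrite invr_gt0.
have mr : measurable (square w d) by exact: measurable_rect.
apply: (le_lt_trans (le_normr_Rintegral mr (integrable_log_kernelM _ _ e0 cfw))).
apply: (@le_lt_trans _ _ (\int[m2]_(z in square w d)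
    (eta * log_kernel e w z + C * (2 / dl ^+ 4) * e))).
  apply: le_Rintegral => //.
  - by have := integrable_norm (integrable_log_kernelM w d e0 cfw).
  - apply: (continuous_integrable_rect (f := fun z => eta * log_kernel e w z + C * (2 / dl ^+ 4) * e)).
    apply: cont_add; last exact: cont_cst.
    by apply: cont_mul; [exact: cont_cst|exact: cont_log_kernel].
  - move=> z rz; have K0 := log_kernel_ge0 w z e0; rewrite normrM (ger0_norm K0).
    have [/andP[z1 z2]|zout] := boolP ((`|z.1 - w.1| < dl) && (`|z.2 - w.2| < dl)).
      have h := hdl _ z1 z2.
      rewrite mulrC (le_trans (ler_wpM2r K0 (ltW h)))// lerDl.
      by rewrite !mulr_ge0 ?ltW// invr_gt0 exprn_gt0.
    have nz : dl ^+ 2 <= (z.1 - w.1) ^+ 2 + ((z.2 - w.2) ^+ 2 + e).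
      move: zout; rewrite negb_and -!leNgt => /orP[|] h.
        have : dl ^+ 2 <= (z.1 - w.1) ^+ 2.
          by rewrite -(real_normK (num_real (z.1 - w.1))) ler_pXn2r// nnegrE ltW.
        by have := sqr_ge0 (z.2 - w.2); lra.
      have : dl ^+ 2 <= (z.2 - w.2) ^+ 2.
        by rewrite -(real_normK (num_real (z.2 - w.2))) ler_pXn2r// nnegrE ltW.
      by have := sqr_ge0 (z.1 - w.1); lra.
    have Kle : log_kernel e w z <= 2 / dl ^+ 4 * e.
      rewrite /log_kernel [leRHS]mulrAC ler_wpM2l ?mulr_ge0 ?(ltW e0)//.
      rewrite lef_pV2 ?posrE ?exprn_gt0 ?log_arg_gt0//.
      rewrite (_ : dl ^+ 4 = (dl ^+ 2) ^+ 2); last by rewrite -exprM.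
      by rewrite ler_pXn2r// nnegrE ?exprn_ge0 ?ltW// log_arg_gt0.
    apply: ler_wpDl; first by rewrite mulr_ge0 ?(ltW eta0).
    rewrite mulrC -mulrA.
    by rewrite ler_pM// hC.
rewrite RintegralD//; last 2 first.
- apply: (continuous_integrable_rect (f := fun z => eta * log_kernel e w z)).
  by apply: cont_mul; [exact: cont_cst|exact: cont_log_kernel].
- exact: integrable_cst_square.
rewrite RintegralZl//; last exact: integrable_log_kernel.
rewrite Rintegral_cst// fine_dm2_square//.
have h1 : eta * \int[m2]_(x in square w d) log_kernel e w x <= eps / 2.
  apply: (le_trans (ler_wpM2l (ltW eta0) (flux_log_kernel_le w e0 d0))).
  by rewrite /eta divfK// gt_eqF// mulr_gt0.
have h2 : C * (2 / dl ^+ 4) * e * (2 * d) ^+ 2 < eps / 2.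
  by rewrite (_ : _ * _ = e * A) -?ltr_pdivlMr// /A; ring.
lra.
Qed.

Lemma approximate_identity w d (f : R * R -> R) : 0 < d -> continuous f ->
  (fun n => \int[m2]_(z in square w d) (log_kernel n.+1%:R^-1 w z * f z))
    @ \oo --> 2 * pi * f w.
Proof.
move=> d0 cf.
have -> : (fun n => \int[m2]_(z in square w d) (log_kernel n.+1%:R^-1 w z * f z)) =
    (fun n => \int[m2]_(z in square w d) (log_kernel n.+1%:R^-1 w z * (f z - f w)) +
      \int[m2]_(z in square w d) log_kernel n.+1%:R^-1 w z * f w).
  apply/funext => n.
  have e0 : 0 < n.+1%:R^-1 :> R by rewrite invr_gt0.
  have mr : measurable (square w d) by exact: measurable_rect.
  have ik := integrable_log_kernel w d e0.
  have cfw : continuous (fun z => f z - f w) by apply: cont_sub => //; exact: cont_cst.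
  rewrite -RintegralZr// -RintegralD//.
  - by apply: eq_Rintegral => z _; ring.
  - exact: integrable_log_kernelM.
  - by have := integrable_log_kernelM w d e0 (@cont_cst R _ (f w)).
rewrite -[2 * pi * f w]add0r; apply: cvgD; first exact: log_kernel_approx.
by apply: cvgM; [exact: flux_log_kernel_cvg|exact: cvg_cst].
Qed.

Lemma measurable_log_dist w : measurable_fun setT (log_dist w : plane R -> R).
Proof.
apply: measurable_funM => //; apply: measurableT_comp; first exact: measurable_ln.
apply: (continuous_measurable_plane (f := fun z => (z.1 - w.1) ^+ 2 + (z.2 - w.2) ^+ 2)).
by apply: cont_add; [exact: cont_sqr1|exact: cont_sqr2].
Qed.

Lemma dm2_set1 w : m2 [set w] = 0%E.
Proof.
rewrite (_ : [set w] = [set w.1] `*` [set w.2]).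
  by rewrite dm2_setX// lebesgue_measure_set1 mul0e.
by apply/seteqP; split=> [z ->//|[a b] [/= -> ->]]; case: w.
Qed.

Lemma measurable_plane_set1 w : measurable ([set w] : set (plane R)).
Proof.
rewrite (_ : [set w] = [set w.1] `*` [set w.2]).
  by apply: measurableX; exact: measurable_set1.
by apply/seteqP; split=> [z ->//|[a b] [/= -> ->]]; case: w.
Qed.

Lemma sqdist_gt0 w z : z != w -> 0 < (z.1 - w.1) ^+ 2 + (z.2 - w.2) ^+ 2.
Proof.
move=> zw; rewrite lt_neqAle addr_ge0 ?sqr_ge0// andbT eq_sym.
rewrite paddr_eq0 ?sqr_ge0// !sqrf_eq0 !subr_eq0.
by apply: contra zw; case: z w => a b [c d] /= /andP[/eqP -> /eqP ->].
Qed.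

Lemma log_reg_cvg w z : z != w ->
  (fun n => log_reg n.+1%:R^-1 w z) @ \oo --> log_dist w z.
Proof.
move=> zw; apply: cvgM; first exact: cvg_cst.
have h : (fun n : nat => (z.1 - w.1) ^+ 2 + ((z.2 - w.2) ^+ 2 + n.+1%:R^-1)) @ \oo -->
    (z.1 - w.1) ^+ 2 + (z.2 - w.2) ^+ 2.
  rewrite -[X in _ --> _ + X]addr0.
  apply: cvgD; first exact: cvg_cst.
  by apply: cvgD; [exact: cvg_cst|exact: cvg_harmonic].
by apply: (cvg_comp _ _ h); apply: continuous_ln; exact: sqdist_gt0.
Qed.

Lemma square_dist w d z : square w d z ->
  (z.1 - w.1) ^+ 2 + (z.2 - w.2) ^+ 2 <= 2 * d ^+ 2.
Proof.
move=> [/=]; rewrite !in_itv/= => /andP[a1 a2] /andP[b1 b2].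
by nra.
Qed.

Lemma log_dist_le_reg w z n : z != w -> log_dist w z <= log_reg n.+1%:R^-1 w z.
Proof.
move=> zw; rewrite ler_wpM2l// ler_ln ?posrE ?sqdist_gt0// ?log_arg_gt0 ?invr_gt0//.
by rewrite addrA lerDl invr_ge0.
Qed.

(** A common upper bound on the square for all the functions [log_reg n.+1%:R^-1 w]: there
    [|z - w|^2 <= 2 d^2], and the regularization is at most [1]. *)
Definition log_max d : R := 2^-1 * ln (2 * d ^+ 2 + 1).

Lemma log_max_ge0 d : 0 <= log_max d.
Proof. by rewrite mulr_ge0// ln_ge0// lerDr mulr_ge0// sqr_ge0. Qed.

Lemma log_reg_le w d z n : square w d z -> log_reg n.+1%:R^-1 w z <= log_max d.
Proof.
move=> /square_dist h; rewrite ler_wpM2l// ler_ln ?posrE ?log_arg_gt0 ?invr_gt0//.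
- by rewrite addrA lerD// invf_le1// ler1n.
- by rewrite ltr_wpDl// mulr_ge0// sqr_ge0.
Qed.

Lemma integral_cst_itv (b d k : R) : 0 < d ->
  (\int[mu]_(y in `[(b - d)%R, (b + d)%R]) k%:E = (k * (2 * d))%:E)%E.
Proof.
move=> d0; rewrite integral_cst//= lebesgue_measure_itv /= lte_fin.
rewrite (_ : b - d < b + d); last by lra.
by rewrite -EFinB -EFinM; congr EFin; ring.
Qed.

(* The derivative of [(x - a) ln ((x - a)^2 + e) / 2] exceeds the logarithm by
   at most [1], which bounds its integral from below uniformly in [e]. *)
Lemma integral_log_line_ge a d e : 0 < e -> 0 < d ->
  ((2 * d * ln d - 2 * d)%:E <=
   \int[mu]_(x in `[(a - d)%R, (a + d)%R]) (2^-1 * ln ((x - a) ^+ 2 + e))%:E)%E.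
Proof.
move=> e0 d0.
have q0 (x : R) : 0 < (x - a) ^+ 2 + e by exact: quad_gt0.
have le : a - d <= a + d by lra.
pose g (x : R) := 2^-1 * ln ((x - a) ^+ 2 + e) + (x - a) ^+ 2 / ((x - a) ^+ 2 + e).
have dF (x : R) : is_derive x 1 (fun x => (x - a) * (2^-1 * ln ((x - a) ^+ 2 + e))) (g x).
  have h := deriv_mul (deriv_sub (deriv_id x) (deriv_cst a x)) (deriv_ln_quad (q0 x)).
  by apply: (is_derive_eq h); rewrite /g; field; rewrite gt_eqF.
have cq : continuous (fun x : R => (x - a) ^+ 2).
  by apply: cont_sqr; apply: cont_sub; [move=> ?; exact: cvg_id|exact: cont_cst].
have cqe : continuous (fun x : R => (x - a) ^+ 2 + e).
  by apply: cont_add => //; exact: cont_cst.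
have cl : continuous (fun x : R => 2^-1 * ln ((x - a) ^+ 2 + e)).
  by apply: cont_mul; [exact: cont_cst|exact: cont_ln].
have cg : continuous g.
  apply: cont_add => //; apply: cont_mul => //.
  by apply: cont_inv => // x; rewrite gt_eqF.
have ig h : continuous h -> mu.-integrable `[(a - d)%R, (a + d)%R] (EFin \o h).
  move=> ch; apply: continuous_compact_integrable; first exact: segment_compact.
  exact: continuous_subspaceT.
have FT := ftc_is_derive le (deriv_continuous dF) cg (fun x _ => dF x).
apply: (@le_trans _ _ (\int[mu]_(x in `[(a - d)%R, (a + d)%R]) (g x - 1)%:E)%E); last first.
  apply: le_integral.
  - exact: measurable_itv.
  - by apply: (ig (fun x => g x - 1)); apply: cont_sub => //; exact: cont_cst.
  - exact: (ig (fun x => 2^-1 * ln ((x - a) ^+ 2 + e))).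
  - move=> x _; rewrite lee_fin /g lerBlDr lerD2l ler_pdivrMr// mul1r lerDl.
    exact: ltW.
under eq_integral do rewrite EFinB.
rewrite integralB_EFin//; last 2 first.
- exact: ig.
- exact: (ig _ (@cont_cst R _ 1)).
rewrite FT integral_cst_itv// -EFinB lee_fin.
rewrite (_ : a + d - a = d); last by ring.
rewrite (_ : a - d - a = - d); last by ring.
rewrite sqrrN.
have : 2 * ln d <= ln (d ^+ 2 + e).
  rewrite (_ : 2 * ln d = ln (d ^+ 2)); last by rewrite lnXn// mulr_natl.
  by rewrite ler_ln ?posrE ?exprn_gt0// ?lerDl ?ltW// ltr_wpDl// sqr_ge0.
move=> h.
have : d * (2 * ln d) <= d * ln (d ^+ 2 + e) by rewrite ler_wpM2l// ltW.
lra.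
Qed.

Lemma integral_log_reg_ge w d e : 0 < e -> 0 < d ->
  ((2 * d * (2 * d * ln d - 2 * d))%:E <=
   \int[m2]_(z in square w d) (log_reg e w z)%:E)%E.
Proof.
move=> e0 d0.
have ir : m2.-integrable (square w d) (EFin \o (log_reg e w : plane R -> R)).
  by apply: continuous_integrable_rect; exact: cont_log_reg.
rewrite (fubini_rect ir).2.
apply: (@le_trans _ _ (\int[mu]_(x in `[(w.1 - d)%R, (w.1 + d)%R])
    (2 * d * ln d - 2 * d)%:E)%E).
  by rewrite integral_cst_itv// lee_fin; lra.
apply: le_integral.
- exact: measurable_itv.
- apply: continuous_compact_integrable; first exact: segment_compact.
  by apply: continuous_subspaceT; exact: cont_cst.
- have ir' := iffLR (integrable_mkcond _ (measurable_rect _ _ _ _)) ir.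
  apply/integrable_mkcond => //.
  have := integrable_fubini_F ir'; apply: eq_integrable => // x _.
  rewrite patchE /fubini_F; case: ifPn => xB.
    rewrite [RHS]integral_mkcond; apply: eq_integral => y _.
    by rewrite !patchE /rect in_setX/= xB.
  by rewrite integral0_eq// => y _; rewrite patchE in_setX /= (negbTE xB).
- move=> x _; rewrite /log_reg /=.
  under eq_integral do rewrite addrCA.
  apply: (integral_log_line_ge w.2 (e := (x - w.1) ^+ 2 + e)) => //.
  exact: quad_gt0.
Qed.

(** Fatou's lemma for the nonnegative functions [log_max d - log_reg], whose integrals are bounded
    uniformly in the regularization by [integral_log_reg_ge]. The centre is removed because there
    [log_reg] does not converge to [log_dist]. *)
Lemma integrable_log_dist w d : 0 < d ->
  m2.-integrable (square w d) (EFin \o (log_dist w : plane R -> R)).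
Proof.
move=> d0.
have mr : measurable (square w d) by exact: measurable_rect.
have m1 := measurable_plane_set1 w.
set D := square w d `\` [set w].
have mD : measurable D by exact: measurableD.
have ml : measurable_fun (square w d) (EFin \o (log_dist w : plane R -> R)).
  by apply/measurable_EFinP; apply: measurable_funTS; exact: measurable_log_dist.
apply/(negligible_integrable m1 mr ml (dm2_set1 w)); rewrite -/D.
have e0 n : 0 < n.+1%:R^-1 :> R by rewrite invr_gt0.
pose g n z : R := log_max d - log_reg n.+1%:R^-1 w z.
have cg n : continuous (g n) by apply: cont_sub; [exact: cont_cst|exact: cont_log_reg].
have g0 n z : square w d z -> 0 <= g n z by move=> rz; rewrite subr_ge0 log_reg_le.
have mg n : measurable_fun D (EFin \o (g n : plane R -> R)).
  apply/measurable_EFinP; apply: measurable_funTS.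
  exact: continuous_measurable_plane.
have fat := @fatou _ _ _ m2 D mD (fun n => EFin \o (g n : plane R -> R)) mg
  (fun n z Dz => g0 n z Dz.1).
have lim z : D z -> limn_einf (fun n => (g n z)%:E) = (log_max d - log_dist w z)%:E.
  move=> [_ /eqP zw]; apply: (cvg_limn_einf_sup _).1.
  apply: cvg_EFin; first exact: nearW.
  by apply: cvgB; [exact: cvg_cst|exact: log_reg_cvg].
have igD : (\int[m2]_(z in D) (log_max d - log_dist w z)%:E < +oo)%E.
  under eq_integral => z /set_mem Dz do rewrite -(lim _ Dz).
  apply: (le_lt_trans fat).
  apply: (@le_lt_trans _ _
    (log_max d * (2 * d) ^+ 2 - 2 * d * (2 * d * ln d - 2 * d))%:E); last exact: ltry.
  rewrite limn_einf_lim; apply: lime_le; first exact: is_cvg_einfs.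
  apply: nearW => n; apply: (@le_trans _ _ (\int[m2]_(z in D) (g n z)%:E)%E).
    by apply: ereal_inf_lbound; exists n => /=.
    apply: (@le_trans _ _ (\int[m2]_(z in square w d) (g n z)%:E)%E).
      apply: ge0_subset_integral => //.
      - by apply/measurable_EFinP; apply: measurable_funTS; exact: continuous_measurable_plane.
      - by move=> z rz; rewrite lee_fin g0.
      - by move=> z [].
    under eq_integral do rewrite EFinB.
    rewrite integralB_EFin//; last 2 first.
    - exact: integrable_cst_square.
    - by apply: continuous_integrable_rect; exact: cont_log_reg.
    rewrite integral_cst// dm2_rect; [|lra|lra].
    rewrite EFinB (_ : _ * _ = (log_max d * (2 * d) ^+ 2)%:E)%E; last first.
      by rewrite -EFinM; congr EFin; ring.
    by apply: leeB => //; exact: integral_log_reg_ge.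
have ig : m2.-integrable D (EFin \o (fun z : plane R => log_max d - log_dist w z)).
  apply/integrableP; split.
    apply/measurable_EFinP; apply: measurable_funB => //.
    by apply: measurable_funTS; exact: measurable_log_dist.
  rewrite (eq_integral (fun z : plane R => (log_max d - log_dist w z)%:E))// => z /set_mem [rz /eqP zw].
  rewrite /= ger0_norm// subr_ge0.
  by apply: le_trans (log_reg_le 0 rz); exact: log_dist_le_reg.
have icst : m2.-integrable D (EFin \o cst (log_max d)).
  apply: (integrableS mr) => //; first by move=> z [].
  exact: integrable_cst_square.
have := integrableB mD icst ig; apply: eq_integrable => // z _ /=.
by rewrite -EFinB; congr EFin; ring.
Qed.

(** [log |z - w|] is [2 pi] times the fundamental solution of the Laplacian: in Green's identity for
    [log_reg], the kernel side converges by [approximate_identity] and the other side by dominated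
    convergence. *)
Lemma log_potential w d f fx fy fxx fyy : 0 < d ->
  C2_supported f fx fy fxx fyy (w.1 - d) (w.1 + d) (w.2 - d) (w.2 + d) ->
  \int[m2]_(z in square w d) (log_dist w z * (fxx z + fyy z)) = 2 * pi * f w.
Proof.
move=> d0 F.
have mr : measurable (square w d) by exact: measurable_rect.
have m1 := measurable_plane_set1 w.
set D := square w d `\` [set w].
have mD : measurable D by exact: measurableD.
have e0 n : 0 < n.+1%:R^-1 :> R by rewrite invr_gt0.
have cL : continuous (fun z => fxx z + fyy z).
  by apply: cont_add; [exact: C2_contxx F|exact: C2_contyy F].
have [C C0 hC] := continuous_bounded_rect (w.1 - d) (w.1 + d) (w.2 - d) (w.2 + d) cL.
have mL : measurable_fun setT (fun z : plane R => fxx z + fyy z).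
  exact: continuous_measurable_plane.
have cvR := @approximate_identity w d f d0 (C2_cont F).
have green n : \int[m2]_(z in square w d) (log_reg n.+1%:R^-1 w z * (fxx z + fyy z)) =
    \int[m2]_(z in square w d) (log_kernel n.+1%:R^-1 w z * f z).
  by apply: green_log_reg F; rewrite ?e0//; lra.
have il : m2.-integrable (square w d) (EFin \o (fun z : plane R => log_dist w z * (fxx z + fyy z))).
  have := integrableMl mr (integrable_log_dist w d0)
    (h := fun z : plane R => fxx z + fyy z).
  apply; first exact: measurable_funTS.
  exists C; split; first exact: num_real.
  by move=> B CB z /= /hC h; rewrite (le_trans h)// ltW.
have ireg n : m2.-integrable (square w d)
    (EFin \o (fun z : plane R => log_reg n.+1%:R^-1 w z * (fxx z + fyy z))).
  by apply: continuous_integrable_rect; apply: cont_mul => //; exact: cont_log_reg.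
(* The dominating function: [log_reg] lies between [log_dist] and [log_max d], and [C] bounds the
   Laplacian of [f]. *)
have ig : m2.-integrable D (EFin \o (fun z : plane R => (`|log_dist w z| + log_max d) * C)).
  apply: (integrableS mr) => //; first by move=> z [].
  have h := integrableD mr (integrable_norm (integrable_log_dist w d0))
    (integrable_cst_square w d (log_max d)).
  have := integrableZl mr C h; apply: eq_integrable => // z _ /=.
  by rewrite -EFinD -EFinM mulrC.
have [] := @dominated_convergence _ _ _ m2 D mD
  (fun n z => (log_reg n.+1%:R^-1 w z * (fxx z + fyy z))%:E)
  (fun z => (log_dist w z * (fxx z + fyy z))%:E) _ _ _ _ ig.
- move=> n; apply/measurable_EFinP; apply: measurable_funTS.
  by apply: continuous_measurable_plane; apply: cont_mul => //; exact: cont_log_reg.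
- apply/measurable_EFinP; apply: measurable_funTS.
  by apply: measurable_funM => //; exact: measurable_log_dist.
- apply: aeW => z [_ /eqP zw]; apply: cvg_EFin; first exact: nearW.
  by apply: cvgM; [exact: log_reg_cvg|exact: cvg_cst].
- apply: aeW => z n [rz /eqP zw]; rewrite /= lee_fin normrM ler_pM//; last exact: hC.
  have h1 := log_dist_le_reg n zw; have h2 := log_reg_le n rz.
  have := log_max_ge0 d; have := ler_norm (log_dist w z).
  have := lerNnormlW (lexx `|log_dist w z|).
  move: h1 h2; set x := log_reg _ _ _ => h1 h2 h3 h4 h5.
  by rewrite ler_norml; apply/andP; split; lra.
move=> _ _ cvD.
have E1 : (\int[m2]_(z in D) (log_dist w z * (fxx z + fyy z))%:E =
    (\int[m2]_(z in square w d) (log_dist w z * (fxx z + fyy z)))%:E)%E.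
  rewrite fineK; first by rewrite [RHS](negligible_integral m1)// dm2_set1.
  exact: integrable_fin_num.
rewrite E1 in cvD.
move: cvD => /fine_cvg cvD.
suff E2 : (fun n => \int[m2]_(z in square w d) (log_kernel n.+1%:R^-1 w z * f z)) =
    fine \o [sequence (\int[m2]_(z in D) (log_reg n.+1%:R^-1 w z * (fxx z + fyy z))%:E)%E]_n.
  rewrite -E2 in cvD.
  by apply: cvg_unique cvD cvR.
apply/funext => n /=; rewrite -green /Rintegral.
by rewrite (negligible_integral m1 mr (ireg n) (dm2_set1 w)).
Qed.

End LogPotentialLimit.

(** * The potential of the uniform disk *)

Section LimitPotential.
Variable R : realType.
Local Notation mu := (@lebesgue_measure R).
Local Notation m2 := (dm2 R).
Implicit Types (z : R * R).

Definition sqmod z : R := z.1 ^+ 2 + z.2 ^+ 2.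

(** It equals [|z|^2 / 2] in the disk and [1/2 + log |z|] outside, the logarithmic potential of the
    uniform measure plus [1/2]. It is also the exponential rate of the largest coefficient: with
    [j = t n] and [s = |z|^2], [(n s)^j / j!] grows like [exp (n (t log s - t log t + t))], maximal
    over [0 <= t <= 1] at [t = min(s, 1)]. *)
Definition limit_potential z : R :=
  2^-1 * (Num.min (sqmod z) 1 + ln (Num.max (sqmod z) 1)).

(** On the circle itself, where the two second derivatives disagree, the inner value is taken; a
    line meets the circle in at most two points. *)
Definition limit_potential_xx z : R :=
  if sqmod z <= 1 then 1 else (z.2 ^+ 2 - z.1 ^+ 2) / sqmod z ^+ 2.

Definition limit_potential_yy z : R :=
  if sqmod z <= 1 then 1 else (z.1 ^+ 2 - z.2 ^+ 2) / sqmod z ^+ 2.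

Lemma cont_sqmod : continuous sqmod.
Proof. by apply: cont_add; apply: cont_sqr; [exact: cont_fst|exact: cont_snd]. Qed.

Lemma max_sqmod_gt0 z : 0 < Num.max (sqmod z) 1.
Proof. by rewrite lt_max ltr01 orbT. Qed.

Lemma cont_max_sqmod : continuous (fun z => Num.max (sqmod z) 1).
Proof. by apply: cont_max; [exact: cont_sqmod|exact: cont_cst]. Qed.

Lemma cont_limit_potential : continuous limit_potential.
Proof.
apply: cont_mul; first exact: cont_cst.
apply: cont_add; first by apply: cont_min; [exact: cont_sqmod|exact: cont_cst].
by apply: cont_ln; [exact: max_sqmod_gt0|exact: cont_max_sqmod].
Qed.

Lemma limit_potential_swap x y : limit_potential (x, y) = limit_potential (y, x).
Proof. by rewrite /limit_potential /sqmod /= (addrC (x ^+ 2)). Qed.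

Lemma limit_potential_xxC x y : limit_potential_yy (x, y) = limit_potential_xx (y, x).
Proof. by rewrite /limit_potential_yy /limit_potential_xx /sqmod /= (addrC (x ^+ 2)). Qed.

Lemma limit_potentialDE z :
  limit_potential_xx z + limit_potential_yy z = if sqmod z <= 1 then 2 else 0.
Proof.
rewrite /limit_potential_xx /limit_potential_yy; case: leP => // z1.
by rewrite -mulrDl [X in X / _](_ : _ = 0) ?mul0r//; ring.
Qed.

Lemma limit_potential_xx_le z : `|limit_potential_xx z| <= 1.
Proof.
rewrite /limit_potential_xx; case: ifP => [_|/negbT]; first by rewrite normr1.
rewrite -ltNge => z1.
have s0 : 0 < sqmod z ^+ 2 by rewrite exprn_gt0// (lt_trans ltr01).
rewrite normrM normfV (gtr0_norm s0) ler_pdivrMr// mul1r.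
have h1 := sqr_ge0 z.1; have h2 := sqr_ge0 z.2.
move: z1 s0; rewrite /sqmod; move: (z.1 ^+ 2) (z.2 ^+ 2) h1 h2 => a b a0 b0 ab s0.
by rewrite ler_norml; apply/andP; split; nra.
Qed.

Lemma limit_potential_yy_le z : `|limit_potential_yy z| <= 1.
Proof.
by case: z => x y; rewrite limit_potential_xxC limit_potential_xx_le.
Qed.

Lemma measurable_limit_potential_xx :
  measurable_fun setT (limit_potential_xx : plane R -> R).
Proof.
rewrite (_ : limit_potential_xx = fun z : plane R =>
    if sqmod z <= 1 then 1 else (z.2 ^+ 2 - z.1 ^+ 2) / Num.max (sqmod z) 1 ^+ 2).
  apply: measurable_fun_ifT => //.
    apply: measurable_fun_ler => //.
    by apply: continuous_measurable_plane; exact: cont_sqmod.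
  apply: (continuous_measurable_plane
    (f := fun z => (z.2 ^+ 2 - z.1 ^+ 2) / Num.max (sqmod z) 1 ^+ 2)).
  apply: cont_mul.
    by apply: cont_sub; apply: cont_sqr; [exact: cont_snd|exact: cont_fst].
  apply: cont_inv; last by apply: cont_sqr; exact: cont_max_sqmod.
  by move=> z; rewrite expf_neq0// gt_eqF// max_sqmod_gt0.
apply/funext => z; rewrite /limit_potential_xx; case: ifP => // /negbT.
by rewrite -ltNge => z1; rewrite max_l ?ltW.
Qed.

Lemma Rintegral_itv_split (h : R -> R) (a x b : R) : a <= x -> x <= b ->
  mu.-integrable `[a, b] (EFin \o h) ->
  \int[mu]_(t in `[a, b]) h t = \int[mu]_(t in `[a, x]) h t + \int[mu]_(t in `[x, b]) h t.
Proof.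
move=> ax xb ih.
have := @Rintegral_itvB R h (BLeft a) (BRight b) x ih.
rewrite !bnd_simp => /(_ ax xb) E.
rewrite -(@Rintegral_itv_obnd_cbnd _ x (BRight b)) -?E; first by rewrite addrC subrK.
apply: integrableS ih => //=; move=> t /=; rewrite !in_itv/= => /andP[xt ->].
by rewrite (le_trans ax (ltW xt)).
Qed.

(** Only the open interval matters: at the end of a piece, where the line crosses the circle, [h]
    may follow the formula of the neighbouring piece. *)
Lemma ftc_piece (K g h : R -> R) (a b : R) : a <= b ->
  continuous K -> continuous g -> mu.-integrable `[a, b] (EFin \o h) ->
  (forall x, a < x < b -> h x = g x) ->
  (forall x : R, a < x < b -> is_derive x 1 K (g x)) ->
  \int[mu]_(x in `[a, b]) h x = K b - K a.
Proof.
move=> ab cK cg ih hg dK.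
have ig : mu.-integrable `[a, b] (EFin \o g).
  apply: continuous_compact_integrable; first exact: segment_compact.
  exact: continuous_subspaceT.
have op k : mu.-integrable `[a, b] (EFin \o k) ->
    \int[mu]_(x in `[a, b]) k x = \int[mu]_(x in `]a, b[) k x.
  move=> ik; rewrite -(@Rintegral_itv_obnd_cbnd _ a (BRight b)); last first.
    apply: integrableS ik => //; move=> t /=; rewrite !in_itv/= => /andP[at' ->].
    by rewrite ltW.
  rewrite -(@Rintegral_itv_bndo_bndc _ (BRight a) b)//.
  apply: integrableS ik => //; move=> t /=; rewrite !in_itv/= => /andP[at' tb].
  by rewrite !ltW.
rewrite op//.
have -> : \int[mu]_(x in `]a, b[) h x = \int[mu]_(x in `]a, b[) g x.
  by apply: eq_Rintegral => x; rewrite inE /= in_itv/= => /hg.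
by rewrite -op// /Rintegral (ftc_is_derive ab cK cg dK).
Qed.

Section Line.
Variable y : R.

Let s (x : R) := x ^+ 2 + y ^+ 2.

Let cs : continuous s.
Proof. by apply: (cont_line1 (f := sqmod)); exact: cont_sqmod. Qed.

Let deriv_s (x : R) : is_derive x 1 s (2 * x).
Proof.
have h := deriv_add (deriv_sqr (deriv_id x)) (deriv_cst (y ^+ 2) x).
by apply: (is_derive_eq h); ring.
Qed.

(** The single formula [t / Num.max (s t) 1] gives the first derivative of the potential on both
    sides of the circle; its continuity there is what prevents a contribution of the circle to
    Green's identity. *)
Lemma deriv_limit_potential_in (x : R) : s x < 1 ->
  is_derive x 1 (fun t => limit_potential (t, y)) (x / Num.max (s x) 1) /\
  is_derive x 1 (fun t => t / Num.max (s t) 1) 1.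
Proof.
move=> sx; have near1 : \forall t \near x, s t < 1 by have /cvgr_lt := @cs x; apply.
rewrite max_r ?ltW// divr1; split.
  apply: (near_eq_is_derive (f := fun t => 2^-1 * s t)).
    apply: filterS near1 => t st; rewrite /limit_potential /sqmod /= -/(s t).
    by rewrite min_l ?max_r ?ltW// ln1 addr0.
  have h := deriv_mul (deriv_cst 2^-1 x) (deriv_s x).
  by apply: (is_derive_eq h); field.
apply: near_eq_is_derive (deriv_id x).
by apply: filterS near1 => t st; rewrite max_r ?ltW// divr1.
Qed.

Lemma deriv_limit_potential_out (x : R) : 1 < s x ->
  is_derive x 1 (fun t => limit_potential (t, y)) (x / Num.max (s x) 1) /\
  is_derive x 1 (fun t => t / Num.max (s t) 1) ((y ^+ 2 - x ^+ 2) / s x ^+ 2).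
Proof.
move=> sx; have near1 : \forall t \near x, 1 < s t by have /cvgr_gt := @cs x; apply.
have s0 : 0 < s x by rewrite (lt_trans ltr01).
rewrite max_l ?ltW//; split.
  apply: (near_eq_is_derive (f := fun t => 2^-1 * (1 + ln (s t)))).
    apply: filterS near1 => t st; rewrite /limit_potential /sqmod /= -/(s t).
    by rewrite min_r ?max_l ?ltW.
  have h := deriv_mul (deriv_cst 2^-1 x) (deriv_add (deriv_cst 1 x)
     (deriv_chain (g := s) (is_derive1_ln s0) (deriv_s x))).
  by apply: (is_derive_eq h); field; rewrite gt_eqF.
apply: (near_eq_is_derive (f := fun t : R => t / s t)).
  by apply: filterS near1 => t st; rewrite max_l ?ltW.
have h := deriv_mul (deriv_id x) (deriv_inv (f := s) (lt0r_neq0 s0) (deriv_s x)).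
by apply: (is_derive_eq h); rewrite /s in s0 *; field; rewrite gt_eqF.
Qed.

(** The disk cuts the line into three pieces with a common continuous primitive [K], so the
    contributions telescope. The boundary terms are kept: for compactly supported [f] they vanish,
    and for constant [f] they give the flux used in [rect_disk_area]. *)
Lemma limit_potential_line (f f1 f2 : R -> R) (a b : R) : a < -1 -> 1 < b ->
  (forall x : R, is_derive x 1 f (f1 x)) -> (forall x : R, is_derive x 1 f1 (f2 x)) ->
  continuous f2 ->
  mu.-integrable `[a, b] (EFin \o
    (fun x => limit_potential (x, y) * f2 x - limit_potential_xx (x, y) * f x)) /\
  \int[mu]_(x in `[a, b])
    (limit_potential (x, y) * f2 x - limit_potential_xx (x, y) * f x) =
  (limit_potential (b, y) * f1 b - b / Num.max (s b) 1 * f b) -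
  (limit_potential (a, y) * f1 a - a / Num.max (s a) 1 * f a).
Proof.
move=> a1 b1 df df1 cf2.
have cf := deriv_continuous df; have cf1 := deriv_continuous df1.
have cp : continuous (fun x => limit_potential (x, y)).
  by apply: cont_line1; exact: cont_limit_potential.
have cm : continuous (fun x => Num.max (s x) 1).
  by apply: cont_max => //; exact: cont_cst.
have m0 x : 0 < Num.max (s x) 1 by rewrite lt_max ltr01 orbT.
have cq : continuous (fun x : R => x / Num.max (s x) 1).
  apply: cont_mul; first by move=> ?; exact: cvg_id.
  by apply: cont_inv => // x; rewrite gt_eqF.
set h := fun x => _ - _.
pose K x := limit_potential (x, y) * f1 x - x / Num.max (s x) 1 * f x.
have cK : continuous K by apply: cont_sub; exact: cont_mul.
pose gi x := limit_potential (x, y) * f2 x - 1 * f x.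
pose go x := limit_potential (x, y) * f2 x -
  (y ^+ 2 - x ^+ 2) / Num.max (s x) 1 ^+ 2 * f x.
have cgi : continuous gi.
  by apply: cont_sub; apply: cont_mul => //; exact: cont_cst.
have cgo : continuous go.
  apply: cont_sub; first exact: cont_mul.
  apply: cont_mul => //; apply: cont_mul.
    apply: cont_sub; first exact: cont_cst.
    by apply: cont_sqr => ?; exact: cvg_id.
  apply: cont_inv; last exact: cont_sqr.
  by move=> x; rewrite expf_neq0// gt_eqF.
have cint k a' b' : continuous k -> mu.-integrable `[a', b'] (EFin \o k).
  move=> ck; apply: continuous_compact_integrable; first exact: segment_compact.
  exact: continuous_subspaceT.
have ih : mu.-integrable `[a, b] (EFin \o h).
  have i1 : mu.-integrable `[a, b] (EFin \o (fun x : R => limit_potential (x, y) * f2 x)).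
    by apply: cint; exact: cont_mul.
  have i2 : mu.-integrable `[a, b] (EFin \o (fun x => limit_potential_xx (x, y) * f x)).
    apply: (le_integrable _ _ _ (cint _ a b cf)) => //.
      apply/measurable_EFinP; apply: measurable_funTS; apply: measurable_funM.
        apply: (measurableT_comp measurable_limit_potential_xx).
        exact: measurable_pair2.
      exact: continuous_measurable_fun.
    move=> x _; rewrite /= lee_fin normrM ler_piMl//.
    exact: limit_potential_xx_le.
  have mab : measurable (`[a, b]%classic : set (measurableTypeR R)) by exact: measurable_itv.
  by have := integrableB mab i1 i2.
split=> //.
(* Half the chord cut by the disk. For [|y| > 1] the square root of a negative number is [0], and
   the middle piece shrinks to a point. *)
pose c := Num.sqrt (1 - y ^+ 2).
have c0 : 0 <= c by exact: sqrtr_ge0.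
have c1 : c <= 1.
  by rewrite -[leRHS]sqrtr1 ler_wsqrtr// gerBl sqr_ge0.
have out x : (x < - c) || (c < x) -> 1 < s x.
  move=> xc; have : c ^+ 2 < x ^+ 2.
    rewrite -[x ^+ 2]real_normK ?num_real// ltr_pXn2r// ?nnegrE//.
    by case/orP: xc => xc; [rewrite ltr0_norm|rewrite gtr0_norm]; lra.
  have [y1|y1] := leP (y ^+ 2) 1.
    by rewrite sqr_sqrtr ?subr_ge0// /s => h'; lra.
  by move=> _; rewrite /s ltr_wpDl// sqr_ge0.
have inn x : - c < x < c -> s x < 1.
  move=> /andP[xc1 xc2]; have cc : 0 < c by lra.
  have : x ^+ 2 < c ^+ 2 by nra.
  have y1 : 0 <= 1 - y ^+ 2.
    by rewrite leNgt; apply/negP => /ltr0_sqrtr h'; move: cc; rewrite /c h' ltxx.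
  by rewrite sqr_sqrtr// /s => h'; lra.
have dKo x : 1 < s x -> is_derive x 1 K (go x).
  move=> sx; have [d1 d2] := deriv_limit_potential_out sx.
  have hh := deriv_sub (deriv_mul d1 (df1 x)) (deriv_mul d2 (df x)).
  by apply: (is_derive_eq hh); rewrite /go !(max_l (ltW sx)); ring.
have dKi x : s x < 1 -> is_derive x 1 K (gi x).
  move=> sx; have [d1 d2] := deriv_limit_potential_in sx.
  have hh := deriv_sub (deriv_mul d1 (df1 x)) (deriv_mul d2 (df x)).
  by apply: (is_derive_eq hh); rewrite /gi; ring.
have hgo x : 1 < s x -> h x = go x.
  by move=> sx; rewrite /h /go (max_l (ltW sx)) /limit_potential_xx leNgt sx.
have hgi x : s x < 1 -> h x = gi x.
  by move=> sx; rewrite /h /gi /limit_potential_xx (ltW sx).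
have sub a' b' : a <= a' -> b' <= b -> mu.-integrable `[a', b'] (EFin \o h).
  move=> aa bb; apply: integrableS ih => //; move=> t /=; rewrite !in_itv/= => /andP[? ?].
  by apply/andP; split; lra.
have ac : a <= - c by lra.
have cb : c <= b by lra.
have cc : - c <= c by lra.
rewrite (Rintegral_itv_split ac _ ih); last by lra.
rewrite (Rintegral_itv_split cc cb); last exact: sub.
have -> : \int[mu]_(x in `[a, - c]) h x = K (- c) - K a.
  apply: (ftc_piece ac cK cgo).
  - by apply: sub => //; lra.
  - by move=> x /andP[_ xc]; apply: hgo; apply: out; rewrite xc.
  - by move=> x /andP[_ xc]; apply: dKo; apply: out; rewrite xc.
have -> : \int[mu]_(x in `[- c, c]) h x = K c - K (- c).
  apply: (ftc_piece cc cK cgi).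
  - by apply: sub; lra.
  - by move=> x /inn; exact: hgi.
  - by move=> x /inn; exact: dKi.
have -> : \int[mu]_(x in `[c, b]) h x = K b - K c.
  apply: (ftc_piece cb cK cgo).
  - by apply: sub => //; lra.
  - by move=> x /andP[xc _]; apply: hgo; apply: out; rewrite xc orbT.
  - by move=> x /andP[xc _]; apply: dKo; apply: out; rewrite xc orbT.
by rewrite /K; ring.
Qed.

End Line.

Lemma measurable_limit_potential_yy :
  measurable_fun setT (limit_potential_yy : plane R -> R).
Proof.
rewrite (_ : limit_potential_yy = fun z : plane R => limit_potential_xx (z.2, z.1)).
  apply: (measurableT_comp measurable_limit_potential_xx).
  by apply/measurable_fun_pair; [exact: measurable_snd|exact: measurable_fst].
by apply/funext => -[x y]; rewrite limit_potential_xxC.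
Qed.

Lemma limit_potential_green M f fx fy fxx fyy : 1 < M ->
  C2_supported f fx fy fxx fyy (- M) M (- M) M ->
  \int[m2]_(z in rect (- M) M (- M) M) (limit_potential z * (fxx z + fyy z)) =
  \int[m2]_(z in rect (- M) M (- M) M) ((if sqmod z <= 1 then 2 else 0) * f z).
Proof.
move=> M1 F; have M1' : - M < -1 by lra.
have outx y x : ~~ (- M < x < M) -> f (x, y) = 0 /\ fx (x, y) = 0.
  by move=> h; case: (C2_supp F (z := (x, y))) => //=; rewrite (negbTE h).
have outy x y : ~~ (- M < y < M) -> f (x, y) = 0 /\ fy (x, y) = 0.
  by move=> h; case: (C2_supp F (z := (x, y))) => //=; rewrite (negbTE h) andbF.
rewrite (@green_of_lines R limit_potential limit_potential_xx limit_potential_yy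
  f fx fy fxx fyy _ _ _ _ 1 F).
- by apply: eq_Rintegral => z _; rewrite limit_potentialDE.
- exact: cont_limit_potential.
- exact: measurable_limit_potential_xx.
- exact: measurable_limit_potential_yy.
- by move=> z _; exact: limit_potential_xx_le.
- by move=> z _; exact: limit_potential_yy_le.
- move=> y.
  have [fa fxa] := outx y (- M) ltac:(by rewrite ltxx).
  have [fb fxb] := outx y M ltac:(by rewrite ltxx andbF).
  have [ih] := limit_potential_line y M1' M1 (fun x => C2_dx F x y) (fun x => C2_dxx F x y)
    (@cont_line1 R fxx y (C2_contxx F)).
  rewrite fa fxa fb fxb !mulr0 !subr0 /Rintegral => E.
  by rewrite -[LHS]fineK ?E//; exact: integrable_fin_num.
- move=> x.
  have [fa fya] := outy x (- M) ltac:(by rewrite ltxx).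
  have [fb fyb] := outy x M ltac:(by rewrite ltxx andbF).
  have [ih] := limit_potential_line x M1' M1 (fun y => C2_dy F x y) (fun y => C2_dyy F x y)
    (@cont_line2 R fyy x (C2_contyy F)).
  rewrite fa fya fb fyb !mulr0 !subr0 /Rintegral => E.
  under eq_integral do rewrite limit_potential_swap limit_potential_xxC.
  by rewrite -[LHS]fineK ?E//; exact: integrable_fin_num.
Qed.

(** The density [2] on the disk is the Laplacian of the potential, so its integral is the flux of
    the gradient through the sides of the square, which [ftc_atan] evaluates with [k = c = d = M].
    This yields the area of the disk, hence the normalization of the limit measure. *)
Lemma rect_disk_area M : 1 < M ->
  \int[m2]_(z in rect (- M) M (- M) M) (if sqmod z <= 1 then 2 else 0) = 2 * pi.
Proof.
move=> M1; have M1' : - M < -1 by lra.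
have M0 : 0 < M by lra.
have mr : measurable (rect (- M) M (- M) M) by exact: measurable_rect.
have ixx : m2.-integrable (rect (- M) M (- M) M) (EFin \o (limit_potential_xx : plane R -> R)).
  apply: integrable_rect; first exact: measurable_limit_potential_xx.
  by move=> z _; exact: limit_potential_xx_le.
have iyy : m2.-integrable (rect (- M) M (- M) M) (EFin \o (limit_potential_yy : plane R -> R)).
  apply: integrable_rect; first exact: measurable_limit_potential_yy.
  by move=> z _; exact: limit_potential_yy_le.
have line y : (\int[mu]_(x in `[(- M)%R, M]) (limit_potential_xx (x, y))%:E =
    (2 * M / (M ^+ 2 + (y - 0) ^+ 2 + (M ^+ 2 - M ^+ 2)))%:E)%E.
  (* With [f = -1] the integrand reduces to [limit_potential_xx]. *)
  have [] := limit_potential_line y M1' M1 (fun x => deriv_cst (-1) x)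
    (fun x => deriv_cst 0 x) (@cont_cst R _ 0).
  set h := (fun x => _ - _).
  have -> : h = fun x => limit_potential_xx (x, y).
    by apply/funext => x; rewrite /h; ring.
  move=> ih; rewrite /Rintegral => E.
  rewrite -[LHS]fineK ?E; last exact: integrable_fin_num.
  have sM : 1 < M ^+ 2 + y ^+ 2.
    by rewrite ltr_wpDr ?sqr_ge0// exprn_egt1.
  rewrite sqrrN !(max_l (ltW sM)) subr0 subrr addr0; congr EFin.
  by field; rewrite gt_eqF// (lt_trans ltr01).
transitivity (\int[m2]_(z in rect (- M) M (- M) M)
    (limit_potential_xx z + limit_potential_yy z)).
  by apply: eq_Rintegral => z _; rewrite limit_potentialDE.
rewrite RintegralD//.
rewrite {1}/Rintegral (fubini_rect ixx).1.
under eq_integral do rewrite line.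
rewrite {1}/Rintegral (fubini_rect iyy).2.
under [X in _ + fine X]eq_integral => x _.
  under eq_integral do rewrite limit_potential_xxC.
  rewrite line; over.
have := @ftc_atan R M M 0 M M0 (ltW M0).
rewrite sub0r add0r => ->.
by rewrite /= divff ?gt_eqF// atan1; field.
Qed.

End LimitPotential.

(** * Test functions as compactly supported functions with line derivatives *)

Section TestFunctions.
Variable R : realType.
Local Notation mu := (@lebesgue_measure R).
Local Notation m2 := (dm2 R).

Lemma is_derive_dx (f : R * R -> R) x y : derivable f (x, y) ((1, 0) : R * R) ->
  is_derive x (1 : R) (fun t : R => f (t, y)) (dx f (x, y)).
Proof.
have E : (fun h : R => h^-1 *: (f (h *: ((1, 0) : R * R) + (x, y)) - f (x, y))) =
    (fun h : R => h^-1 *: (f (h *: (1 : R) + x, y) - f (x, y))).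
  apply/funext => h; congr (_ *: (f _ - _)).
  by apply/pair_equal_spec; split => //=; rewrite scaler0 add0r.
by rewrite /dx /derivable /derive E => h; split.
Qed.

Lemma is_derive_dy (f : R * R -> R) x y : derivable f (x, y) ((0, 1) : R * R) ->
  is_derive y (1 : R) (fun t : R => f (x, t)) (dy f (x, y)).
Proof.
have E : (fun h : R => h^-1 *: (f (h *: ((0, 1) : R * R) + (x, y)) - f (x, y))) =
    (fun h : R => h^-1 *: (f (x, h *: (1 : R) + y) - f (x, y))).
  apply/funext => h; congr (_ *: (f _ - _)).
  by apply/pair_equal_spec; split => //=; rewrite scaler0 add0r.
by rewrite /dy /derivable /derive E => h; split.
Qed.

Lemma near_norm_gt (M x : R) : M < `|x| -> \forall t \near x, M < `|t|.
Proof.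
move=> Mx; have cn : continuous (fun t : R => `|t|) by exact: norm_continuous.
by have /cvgr_gt := @cn x; apply.
Qed.

Lemma deriv_zero_near (g : R -> R) (x dg : R) : (\forall t \near x, g t = 0) ->
  is_derive x (1 : R) g dg -> dg = 0.
Proof.
move=> g0 [_ <-].
by rewrite (near_eq_derive _ (g := cst 0))// derive_cst.
Qed.

Lemma deriv_zero (g : R -> R) (x dg : R) : (forall t, g t = 0) ->
  is_derive x (1 : R) g dg -> dg = 0.
Proof.
by move=> /funext -> [_ <-]; rewrite (derive_cst (0 : R)).
Qed.

Lemma zero_region_dx (f g : R * R -> R) (M : R) :
  (forall x y, is_derive x (1 : R) (fun t => f (t, y)) (g (x, y))) ->
  (forall z, M < `|z.1| \/ M < `|z.2| -> f z = 0) ->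
  forall z, M < `|z.1| \/ M < `|z.2| -> g z = 0.
Proof.
move=> d f0 [x y] /= [h|h].
  apply: deriv_zero_near (d x y).
  by apply: filterS (near_norm_gt h) => t Mt; apply: f0; left.
by apply: deriv_zero (d x y) => t; apply: f0; right.
Qed.

Lemma zero_region_dy (f g : R * R -> R) (M : R) :
  (forall x y, is_derive y (1 : R) (fun t => f (x, t)) (g (x, y))) ->
  (forall z, M < `|z.1| \/ M < `|z.2| -> f z = 0) ->
  forall z, M < `|z.1| \/ M < `|z.2| -> g z = 0.
Proof.
move=> d f0 [x y] /= [h|h].
  by apply: deriv_zero (d x y) => t; apply: f0; left.
apply: deriv_zero_near (d x y).
by apply: filterS (near_norm_gt h) => t Mt; apply: f0; right.
Qed.

Lemma compact_sub_rect (K : set (R * R)) : compact K ->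
  exists2 M, 0 < M & forall z, K z -> `|z.1| <= M /\ `|z.2| <= M.
Proof.
move=> cK.
have b (g : R * R -> R) : continuous g -> exists M, forall z, K z -> `|g z| <= M.
  move=> cg; have /compact_bounded[C [_ hC]] : compact (g @` K).
    by apply: continuous_compact => //; exact: continuous_subspaceT.
  exists (`|C| + 1) => z Kz; apply: (hC (`|C| + 1)); last by exists z.
  by rewrite (le_lt_trans (ler_norm C))// ltrDl.
have [M1 h1] := b _ (@cont_fst R); have [M2 h2] := b _ (@cont_snd R).
exists (`|M1| + `|M2| + 1).
  by rewrite ltr_wpDl.
move=> z Kz; have := h1 z Kz; have := h2 z Kz.
have := ler_norm M1; have := ler_norm M2.
have := normr_ge0 M1; have := normr_ge0 M2.
by split; lra.
Qed.

Lemma test_function_C2 (f : R * R -> R) : test_function f ->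
  exists2 M, 0 < M &
    C2_supported f (dx f) (dy f) (dx (dx f)) (dy (dy f)) (- M) M (- M) M.
Proof.
move=> [Cf cs]; have [M M0 hM] := compact_sub_rect cs.
have f0 z : M < `|z.1| \/ M < `|z.2| -> f z = 0.
  move=> h; apply: contrapT => /eqP fz.
  have /hM[h1 h2] : closure [set z | f z != 0] z by exact: subset_closure.
  by case: h => h; lra.
have [d1 d2 [dxx _ c1 _] [_ dyy _ c2]] := Cf 2%N.
have Dx x y := is_derive_dx (d1 (x, y)); have Dy x y := is_derive_dy (d2 (x, y)).
have Dxx x y := is_derive_dx (dxx (x, y)); have Dyy x y := is_derive_dy (dyy (x, y)).
(* The margin [1] makes [f] vanish in a neighbourhood of every point off the open square, so that
   its derivatives vanish there too. *)
exists (M + 1); first lra.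
split; [exact: Dx|exact: Dy|exact: Dxx|exact: Dyy|exact: (Cf 0%N)|exact: c1|exact: c2|].
move=> z hz.
have hz' : M < `|z.1| \/ M < `|z.2|.
  move: hz; rewrite negb_and => /orP[] h; [left|right];
    by rewrite ltNge; apply: contra h; rewrite ler_norml => /andP[? ?]; apply/andP; split; lra.
have x0 := zero_region_dx Dx f0; have y0 := zero_region_dy Dy f0.
split; [exact: f0|exact: x0|exact: y0| |].
  exact: (zero_region_dx Dxx x0).
exact: (zero_region_dy Dyy y0).
Qed.

End TestFunctions.

(** * Measurability of complex-valued functions *)

Section ComplexMeasurable.
Variables (R : realType) (d : measure_display) (T : measurableType d).

Definition cmeasurable (F : T -> R[i]) :=
  measurable_fun setT (fun t => complex.Re (F t)) /\
  measurable_fun setT (fun t => complex.Im (F t)).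

Lemma cmeasurable_cst c : cmeasurable (fun _ => c).
Proof. by split; exact: measurable_cst. Qed.

Lemma cmeasurableD F G : cmeasurable F -> cmeasurable G ->
  cmeasurable (fun t => F t + G t).
Proof.
move=> [F1 F2] [G1 G2]; split.
  rewrite (_ : (fun t => _) = fun t => complex.Re (F t) + complex.Re (G t)).
    exact: measurable_funD.
  by apply/funext => t; case: (F t) => ? ?; case: (G t).
rewrite (_ : (fun t => _) = fun t => complex.Im (F t) + complex.Im (G t)).
  exact: measurable_funD.
by apply/funext => t; case: (F t) => ? ?; case: (G t).
Qed.

Lemma cmeasurableM F G : cmeasurable F -> cmeasurable G ->
  cmeasurable (fun t => F t * G t).
Proof.
move=> [F1 F2] [G1 G2]; split.
  rewrite (_ : (fun t => _) = fun t => complex.Re (F t) * complex.Re (G t)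
     - complex.Im (F t) * complex.Im (G t)).
    by apply: measurable_funB; exact: measurable_funM.
  by apply/funext => t; case: (F t) => ? ?; case: (G t).
rewrite (_ : (fun t => _) = fun t => complex.Re (F t) * complex.Im (G t)
     + complex.Im (F t) * complex.Re (G t)).
  by apply: measurable_funD; exact: measurable_funM.
by apply/funext => t; case: (F t) => ? ?; case: (G t).
Qed.

Lemma cmeasurableX F n : cmeasurable F -> cmeasurable (fun t => F t ^+ n).
Proof.
move=> mF; elim: n => [|n IH].
  by under eq_fun do rewrite expr0; exact: cmeasurable_cst.
by under eq_fun do rewrite exprS; exact: cmeasurableM.
Qed.

Lemma cmeasurable_sum I (s : seq I) (P : pred I) (F : I -> T -> R[i]) :
  (forall i, P i -> cmeasurable (F i)) ->
  cmeasurable (fun t => \sum_(i <- s | P i) F i t).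
Proof.
move=> mF; elim: s => [|i s IH].
  by under eq_fun do rewrite big_nil; exact: cmeasurable_cst.
have [Pi|Pi] := boolP (P i); last by under eq_fun do rewrite big_cons (negbTE Pi).
by under eq_fun do rewrite big_cons Pi; apply: cmeasurableD => //; exact: mF.
Qed.

Lemma measurable_normc F : cmeasurable F ->
  measurable_fun setT (fun t => Normc.normc (F t)).
Proof.
move=> [F1 F2].
rewrite (_ : (fun t => _) = fun t =>
    Num.sqrt (complex.Re (F t) ^+ 2 + complex.Im (F t) ^+ 2)); last first.
  by apply/funext => t; case: (F t).
apply: (measurableT_comp (f := fun x : R => Num.sqrt x)).
  by apply: continuous_measurable_fun; exact: sqrt_continuous.
by apply: measurable_funD; exact: measurable_funX.
Qed.

Lemma cmeasurable_toC (X : T -> plane R) : measurable_fun setT X ->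
  cmeasurable (fun t => toC (X t)).
Proof.
move=> mX; split.
  exact: (measurableT_comp (@measurable_fst _ _ _ _) mX).
exact: (measurableT_comp (@measurable_snd _ _ _ _) mX).
Qed.

End ComplexMeasurable.

(** * Logarithms of polynomials *)

Section PolynomialPotential.
Variable R : realType.
Local Notation m2 := (dm2 R).

Lemma normc_toC_sub (z : R * R) (w : R[i]) : Normc.normc (toC z - w) =
  Num.sqrt ((z.1 - (ofC w).1) ^+ 2 + (z.2 - (ofC w).2) ^+ 2).
Proof. by case: w. Qed.

Lemma normc_gt0 (w : R[i]) : w != 0 -> 0 < Normc.normc w.
Proof.
move=> w0; rewrite lt_neqAle eq_sym; apply/andP; split.
  by apply: contra w0 => /eqP/Normc.eq0_normc ->.
by case: w {w0} => a b; exact: sqrtr_ge0.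
Qed.

Lemma ln_normc_sub (z : R * R) (w : R[i]) : toC z != w ->
  ln (Normc.normc (toC z - w)) = log_dist (ofC w) z.
Proof.
move=> zw; rewrite normc_toC_sub /log_dist.
have s0 : 0 < (z.1 - (ofC w).1) ^+ 2 + (z.2 - (ofC w).2) ^+ 2.
  apply: sqdist_gt0; apply: contra zw => /eqP ->.
  by case: (w).
rewrite -[X in _ = _ * ln X]sqr_sqrtr ?ltW// lnXn ?sqrtr_gt0//.
by field.
Qed.

Lemma normc_prod I (s : seq I) (F : I -> R[i]) :
  Normc.normc (\prod_(i <- s) F i) = \prod_(i <- s) Normc.normc (F i).
Proof.
elim: s => [|i s IH]; first by rewrite !big_nil Normc.normc1.
by rewrite !big_cons Normc.normcM IH.
Qed.

Lemma ln_prod I (s : seq I) (F : I -> R) : (forall i, List.In i s -> 0 < F i) ->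
  ln (\prod_(i <- s) F i) = \sum_(i <- s) ln (F i).
Proof.
suff h : (forall i, List.In i s -> 0 < F i) ->
    ln (\prod_(i <- s) F i) = \sum_(i <- s) ln (F i) /\ 0 < \prod_(i <- s) F i.
  by move=> /h[].
elim: s => [_|i s IH h]; first by rewrite !big_nil ln1; split.
have Fi : 0 < F i by apply: h; left.
have [E p0] := IH (fun j hj => h j (or_intror hj)).
by rewrite !big_cons lnM ?posrE// E; split => //; exact: mulr_gt0.
Qed.

Lemma zerosE (p : {poly R[i]}) :
  p = lead_coef p *: \prod_(z <- zeros p) ('X - z%:P).
Proof. by rewrite /zeros; case: closed_field_poly_normal. Qed.

Lemma size_zeros (p : {poly R[i]}) n : size p = n.+1 -> size (zeros p) = n.
Proof.
move=> sp; have p0 : p != 0 by rewrite -size_poly_gt0 sp.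
have := congr1 (fun q : {poly R[i]} => size q) (zerosE p).
rewrite size_scale ?lead_coef_eq0// size_prod_XsubC sp.
by case.
Qed.

(** At a zero the convention [ln 0 = 0] would break the additivity of the logarithm; the zeros form
    a null set, so integrals are unaffected. *)
Lemma ln_normc_poly (p : {poly R[i]}) (z : R * R) : p != 0 ->
  toC z \notin zeros p ->
  ln (Normc.normc p.[toC z]) = ln (Normc.normc (lead_coef p)) +
    \sum_(w <- zeros p) log_dist (ofC w) z.
Proof.
move=> p0 zp.
rewrite [in LHS](zerosE p) hornerZ horner_prod Normc.normcM normc_prod.
under eq_bigr do rewrite hornerXsubC.
have nz w : w \in zeros p -> toC z != w by move=> wp; apply: contra zp => /eqP ->.
have pos w : List.In w (zeros p) -> 0 < Normc.normc (toC z - w).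
  move=> wp; apply: normc_gt0; rewrite subr_eq0; apply: nz.
  by elim: (zeros p) wp => //= a s IH [->|/IH h]; rewrite inE ?eqxx// h orbT.
rewrite lnM ?posrE; last 2 first.
- by apply: normc_gt0; rewrite lead_coef_eq0.
- by elim: (zeros p) pos => [|a s IH] h; rewrite ?big_nil// big_cons mulr_gt0 ?h//=;
    [left|apply: IH => w ws; apply: h; right].
congr (_ + _); rewrite ln_prod//.
rewrite big_seq [RHS]big_seq; apply: eq_bigr => w wp.
by rewrite ln_normc_sub// nz.
Qed.

Lemma negligible_seq (s : seq R[i]) :
  measurable ([set z : plane R | toC z \in s]) /\
  m2 [set z : plane R | toC z \in s] = 0%E.
Proof.
elim: s => [|w s [mS S0]].
  by rewrite (_ : [set z | _] = set0) ?measure0//; apply/seteqP; split.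
have -> : [set z : plane R | toC z \in w :: s] =
    [set (ofC w : plane R)] `|` [set z : plane R | toC z \in s].
  apply/seteqP; split => z /=; rewrite inE.
    move=> /orP[/eqP <-|zs]; [left|by right].
    by case: z.
  move=> [->|->]; last by rewrite orbT.
  by case: (w) => a b; rewrite /toC /ofC /= eqxx.
split; first by apply: measurableU => //; exact: measurable_plane_set1.
by apply: null_set_setU => //; [exact: measurable_plane_set1|exact: dm2_set1].
Qed.

Lemma measurable_poly_log (p : {poly R[i]}) :
  measurable_fun setT (fun z : plane R => ln (Normc.normc p.[toC z])).
Proof.
apply: measurableT_comp; first exact: measurable_ln.
apply: measurable_normc; under eq_fun do rewrite horner_coef.
apply: cmeasurable_sum => i _; apply: cmeasurableM; first exact: cmeasurable_cst.
by apply: cmeasurableX; apply: cmeasurable_toC.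
Qed.

Lemma ae_eq_off_seq (s : seq R[i]) (D : set (plane R)) (f g : plane R -> \bar R) :
  (forall z, toC z \notin s -> f z = g z) -> ae_eq m2 D f g.
Proof.
move=> fg; have [mS S0] := negligible_seq s.
exists [set z : plane R | toC z \in s]; split => // z /= h.
by apply/negPn/negP => zs; apply: h => _; exact: fg.
Qed.

Lemma integrable_log_dist_rect (w : R * R) a1 b1 a2 b2 :
  m2.-integrable (rect a1 b1 a2 b2) (EFin \o (log_dist w : plane R -> R)).
Proof.
pose d := 1 + `|w.1| + `|w.2| + `|a1| + `|a2| + `|b1| + `|b2|.
have d0 : 0 < d by rewrite /d -!addrA ltr_wpDr// !addr_ge0.
apply: (integrableS _ _ _ (integrable_log_dist w d0)).
- exact: measurable_rect.
- exact: measurable_rect.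
- move=> z [/=]; rewrite !in_itv /= => /andP[h1 h2] /andP[h3 h4].
  have := ler_norm w.1; have := ler_norm w.2; have := lerNnormlW (lexx `|a1|).
  have := lerNnormlW (lexx `|a2|); have := ler_norm b1; have := ler_norm b2.
  have := lerNnormlW (lexx `|w.1|); have := lerNnormlW (lexx `|w.2|).
  have := normr_ge0 w.1; have := normr_ge0 w.2; have := normr_ge0 a1.
  have := normr_ge0 a2; have := normr_ge0 b1; have := normr_ge0 b2.
  move=> *; split => /=; rewrite in_itv /=; apply/andP; split; rewrite /d; lra.
Qed.

Lemma integrable_poly_log (p : {poly R[i]}) a1 b1 a2 b2 : p != 0 ->
  m2.-integrable (rect a1 b1 a2 b2)
    (EFin \o (fun z : plane R => ln (Normc.normc p.[toC z]))).
Proof.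
move=> p0; have mr : measurable (rect a1 b1 a2 b2) by exact: measurable_rect.
pose U (z : plane R) := ln (Normc.normc (lead_coef p)) +
  \sum_(w <- zeros p) log_dist (ofC w) z.
have mU : measurable_fun setT U.
  apply: measurable_funD => //; apply: measurable_sum => w.
  exact: measurable_log_dist.
have iU : m2.-integrable (rect a1 b1 a2 b2) (EFin \o U).
  have i1 := continuous_integrable_rect a1 b1 a2 b2
    (@cont_cst R _ (ln (Normc.normc (lead_coef p)))).
  have i2 := integrable_sum mr (zeros p) (P := xpredT) (fun w _ =>
     integrable_log_dist_rect (ofC w) a1 b1 a2 b2).
  have := integrableD mr i1 i2; apply: eq_integrable => // z _ /=.
  by rewrite /U EFinD -sumEFin.
have mu_ : measurable_fun (rect a1 b1 a2 b2)
    (EFin \o (fun z : plane R => ln (Normc.normc p.[toC z]))).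
  by apply/measurable_EFinP; apply: measurable_funTS; exact: measurable_poly_log.
apply/integrableP; split => //.
have /integrableP[mU' fin] := iU.
rewrite (ae_eq_integral (abse \o (EFin \o U)))//.
- exact: measurableT_comp.
- exact: measurableT_comp.
- apply: (ae_eq_off_seq (s := zeros p)) => z zp /=.
  by rewrite ln_normc_poly.
Qed.

Lemma Rintegral_supported (D : set (plane R)) (f : plane R -> R) :
  (forall z, ~ D z -> f z = 0) -> (\int[m2]_z (f z)%:E = \int[m2]_(z in D) (f z)%:E)%E.
Proof.
move=> f0; rewrite [RHS]integral_mkcond; apply: eq_integral => z _.
by rewrite patchE; case: ifPn => // /negP zD; rewrite f0// => /mem_set.
Qed.

(** [log_potential] is stated on squares centred at the pole; an arbitrary pole [w] is reached by
    enlarging the square around it until it contains the support. *)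
Lemma C2_square_of_rect f fx fy fxx fyy M (w : R * R) :
  C2_supported f fx fy fxx fyy (- M) M (- M) M ->
  exists2 d, 0 < d &
  C2_supported f fx fy fxx fyy (w.1 - d) (w.1 + d) (w.2 - d) (w.2 + d).
Proof.
move=> F; exists (`|M| + `|w.1| + `|w.2| + 1).
  by rewrite ltr_wpDl// !addr_ge0.
apply: C2_supportedS F;
  have := ler_norm w.1; have := ler_norm w.2; have := ler_norm M;
  have := lerNnormlW (lexx `|w.1|); have := lerNnormlW (lexx `|w.2|);
  have := normr_ge0 w.1; have := normr_ge0 w.2; lra.
Qed.

Lemma C2_laplacian0 (f fx fy fxx fyy : R * R -> R) a1 b1 a2 b2 :
  C2_supported f fx fy fxx fyy a1 b1 a2 b2 ->
  forall z, ~ rect a1 b1 a2 b2 z -> fxx z + fyy z = 0.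
Proof.
move=> F z hz; have [|_ _ _ -> ->] := C2_supp F (z := z); last by rewrite addr0.
apply/negP => /andP[/andP[h1 h2] /andP[h3 h4]]; apply: hz.
by split; rewrite /= in_itv /= !ltW.
Qed.

Lemma log_potential_plane (w : R * R) f fx fy fxx fyy M :
  C2_supported f fx fy fxx fyy (- M) M (- M) M ->
  \int[m2]_(z in rect (- M) M (- M) M) (log_dist w z * (fxx z + fyy z)) = 2 * pi * f w.
Proof.
move=> F; have [d d0 Fd] := C2_square_of_rect w F.
rewrite -(log_potential d0 Fd) /Rintegral; congr fine.
rewrite -(@Rintegral_supported _ (fun z : plane R => log_dist w z * (fxx z + fyy z))).
  rewrite (@Rintegral_supported (square w d))// => z hz.
  by rewrite (C2_laplacian0 Fd hz) mulr0.
by move=> z hz; rewrite (C2_laplacian0 F hz) mulr0.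
Qed.

Lemma laplacian_C2_bounded (f fx fy fxx fyy : R * R -> R) a1 b1 a2 b2 :
  C2_supported f fx fy fxx fyy a1 b1 a2 b2 ->
  continuous (fun z : R * R => fxx z + fyy z) /\
  exists2 C, 0 < C & forall z, rect a1 b1 a2 b2 z -> `|fxx z + fyy z| <= C.
Proof.
move=> F; have cL : continuous (fun z : R * R => fxx z + fyy z).
  by apply: cont_add; [exact: C2_contxx F|exact: C2_contyy F].
by split => //; exact: continuous_bounded_rect.
Qed.

Lemma integrable_mul_laplacian (g : plane R -> R) f fx fy fxx fyy a1 b1 a2 b2 :
  C2_supported f fx fy fxx fyy a1 b1 a2 b2 ->
  m2.-integrable (rect a1 b1 a2 b2) (EFin \o g) ->
  m2.-integrable (rect a1 b1 a2 b2) (EFin \o (fun z : plane R => g z * (fxx z + fyy z))).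
Proof.
move=> F ig; have [cL [C C0 hC]] := laplacian_C2_bounded F.
have := integrableMl (measurable_rect _ _ _ _) ig (h := fun z : plane R => fxx z + fyy z).
apply; first by apply: measurable_funTS; exact: continuous_measurable_plane.
exists C; split; first exact: num_real.
by move=> B CB z /= /hC h; rewrite (le_trans h)// ltW.
Qed.

(** Green's identity with [u = 1]. It removes the constant [ln |lead_coef p|] from the pairing of
    [ln |p|] with a Laplacian. *)
Lemma laplacian_mean0 f fx fy fxx fyy M : 0 < M ->
  C2_supported f fx fy fxx fyy (- M) M (- M) M ->
  \int[m2]_(z in rect (- M) M (- M) M) (fxx z + fyy z) = 0.
Proof.
move=> M0 F; have MM : - M <= M by lra.
have outx y x : ~~ (- M < x < M) -> f (x, y) = 0 /\ fx (x, y) = 0.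
  by move=> h; case: (C2_supp F (z := (x, y))) => //=; rewrite (negbTE h).
have outy x y : ~~ (- M < y < M) -> f (x, y) = 0 /\ fy (x, y) = 0.
  by move=> h; case: (C2_supp F (z := (x, y))) => //=; rewrite (negbTE h) andbF.
transitivity (\int[m2]_(z in rect (- M) M (- M) M) (1 * (fxx z + fyy z))).
  by apply: eq_Rintegral => z _; rewrite mul1r.
rewrite (@green_of_lines R (fun=> 1) (fun=> 0) (fun=> 0) _ _ _ _ _ _ _ _ _ 0 F)//.
- under eq_Rintegral do rewrite addr0 mul0r.
  by rewrite Rintegral_cst ?mul0r//; exact: measurable_rect.
- exact: cont_cst.
- by move=> z _; rewrite normr0.
- by move=> z _; rewrite normr0.
- move=> y.
  have [fa fxa] := outx y (- M) ltac:(by rewrite ltxx).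
  have [fb fxb] := outx y M ltac:(by rewrite ltxx andbF).
  exact: (green_line MM (fun x => deriv_cst 1 x) (fun x => deriv_cst 0 x)
    (fun x => C2_dx F x y) (fun x => C2_dxx F x y) (@cont_cst R _ 0)
    (@cont_line1 R fxx y (C2_contxx F)) fa fxa fb fxb).
- move=> x.
  have [fa fya] := outy x (- M) ltac:(by rewrite ltxx).
  have [fb fyb] := outy x M ltac:(by rewrite ltxx andbF).
  exact: (green_line MM (fun y => deriv_cst 1 y) (fun y => deriv_cst 0 y)
    (fun y => C2_dy F x y) (fun y => C2_dyy F x y) (@cont_cst R _ 0)
    (@cont_line2 R fyy x (C2_contyy F)) fa fya fb fyb).
Qed.

Lemma sum_log_potential (s : seq R[i]) f fx fy fxx fyy M :
  C2_supported f fx fy fxx fyy (- M) M (- M) M ->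
  \int[m2]_(z in rect (- M) M (- M) M)
    ((\sum_(w <- s) log_dist (ofC w) z) * (fxx z + fyy z)) =
  2 * pi * \sum_(w <- s) f (ofC w).
Proof.
move=> F; have mr : measurable (rect (- M) M (- M) M) by exact: measurable_rect.
elim: s => [|w s IH].
  under eq_Rintegral do rewrite big_nil mul0r.
  by rewrite Rintegral_cst ?big_nil ?mulr0 ?mul0r.
under eq_Rintegral do rewrite big_cons mulrDl.
rewrite RintegralD// ?IH ?(log_potential_plane _ F) ?big_cons ?mulrDr//.
  exact: (integrable_mul_laplacian F (integrable_log_dist_rect (ofC w) _ _ _ _)).
apply: (integrable_mul_laplacian F).
have := integrable_sum mr s (P := xpredT) (fun w _ =>
  integrable_log_dist_rect (ofC w) (- M) M (- M) M).
by apply: eq_integrable => // z _ /=; rewrite -sumEFin.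
Qed.

Lemma poly_log_potential (p : {poly R[i]}) f fx fy fxx fyy M : p != 0 -> 0 < M ->
  C2_supported f fx fy fxx fyy (- M) M (- M) M ->
  \int[m2]_(z in rect (- M) M (- M) M)
    (ln (Normc.normc p.[toC z]) * (fxx z + fyy z)) =
  2 * pi * \sum_(w <- zeros p) f (ofC w).
Proof.
move=> p0 M0 F.
have mr : measurable (rect (- M) M (- M) M) by exact: measurable_rect.
have [cL [C C0 hC]] := laplacian_C2_bounded F.
have mL : measurable_fun setT (fun z : plane R => fxx z + fyy z).
  exact: continuous_measurable_plane.
pose c := ln (Normc.normc (lead_coef p)).
pose V (z : plane R) := \sum_(w <- zeros p) log_dist (ofC w) z.
have mV : measurable_fun setT V by apply: measurable_sum => w; exact: measurable_log_dist.
have iV : m2.-integrable (rect (- M) M (- M) M) (EFin \o V).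
  have i2 := integrable_sum mr (zeros p) (P := xpredT) (fun w _ =>
     integrable_log_dist_rect (ofC w) (- M) M (- M) M).
  by apply: eq_integrable i2 => // z _ /=; rewrite -sumEFin.
have ic : m2.-integrable (rect (- M) M (- M) M) (EFin \o (fun _ : plane R => c)).
  exact: (continuous_integrable_rect _ _ _ _ (@cont_cst R _ c)).
transitivity (\int[m2]_(z in rect (- M) M (- M) M) ((c + V z) * (fxx z + fyy z))).
  rewrite /Rintegral; congr fine; apply: ae_eq_integral => //.
  - apply/measurable_EFinP; apply: measurable_funTS; apply: measurable_funM => //.
    exact: measurable_poly_log.
  - apply/measurable_EFinP; apply: measurable_funTS; apply: measurable_funM => //.
    exact: measurable_funD.
  - apply: (ae_eq_off_seq (s := zeros p)) => z zp /=.
    by rewrite ln_normc_poly.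
under eq_Rintegral do rewrite mulrDl.
rewrite RintegralD//; last 2 first.
- exact: (integrable_mul_laplacian F ic).
- exact: (integrable_mul_laplacian F iV).
rewrite RintegralZl//; last first.
  exact: (continuous_integrable_rect _ _ _ _ cL).
by rewrite (laplacian_mean0 M0 F) mulr0 add0r (sum_log_potential _ F).
Qed.

End PolynomialPotential.

(** * Weak convergence from convergence of potentials *)

Section ZeroMeasure.
Variable R : realType.
Local Notation m2 := (dm2 R).

(** Integrals against sums and multiples of measures are computed for nonnegative functions; this
    splitting transfers the results to signed ones. *)
Lemma integral_parts d (T : measurableType d) (m : {measure set T -> \bar R}) (f : T -> R) :
  (\int[m]_z (f z)%:E = \int[m]_z (Num.max (f z) 0)%:E - \int[m]_z (Num.max (- f z) 0)%:E)%E.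
Proof.
rewrite integralE; congr (_ - _)%E; apply: eq_integral => z _.
  by rewrite funeposE /= EFin_max.
by rewrite funenegE /= EFin_max EFinN.
Qed.

Lemma measurable_posp d (T : measurableType d) (f : T -> R) :
  measurable_fun setT f -> measurable_fun setT (fun z => Num.max (f z) 0).
Proof. by move=> mf; apply: measurable_maxr. Qed.

Lemma max_parts (a : R) : Num.max a 0 - Num.max (- a) 0 = a.
Proof. by case: (leP a 0) => h1; case: (leP (- a) 0) => h2; lra. Qed.

Definition zero_avg (n : nat) (p : {poly R[i]}) (f : R * R -> R) : R :=
  n%:R^-1 * \sum_(w <- zeros p) f (ofC w).

Lemma integral_zero_measure n (p : {poly R[i]}) (f : R * R -> R) :
  size (zeros p) = n -> measurable_fun setT (f : plane R -> R) ->
  (\int[zero_measure n p]_z (f z)%:E = (zero_avg n p f)%:E)%E.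
Proof.
move=> sz mf.
have ge0 (g : plane R -> R) : measurable_fun setT g -> (forall z, 0 <= g z) ->
    (\int[zero_measure n p]_z (g z)%:E = (zero_avg n p g)%:E)%E.
  move=> mg g0; have mg' : measurable_fun setT (EFin \o g) by exact/measurable_EFinP.
  rewrite /zero_measure ge0_integral_mscale//=; last by move=> z _; rewrite lee_fin.
  rewrite ge0_integral_measure_sum//; last by move=> z _; rewrite lee_fin.
  rewrite /zero_avg EFinM; congr (_ * _)%E.
  rewrite (big_nth 0) sz big_mkord -sumEFin; apply: eq_bigr => k _.
  by rewrite integral_dirac//= diracT mul1e.
have max0 (g : plane R -> R) z : 0 <= Num.max (g z) 0 by rewrite le_max lexx orbT.
have mN : measurable_fun setT (fun z : plane R => - f z) by exact: measurable_funN.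
rewrite integral_parts.
rewrite (ge0 _ (measurable_posp mf) (max0 f)).
rewrite (ge0 _ (measurable_posp mN) (max0 (fun z => - f z))).
rewrite -EFinB /zero_avg -mulrBr -sumrB; congr (_ * _)%:E.
by apply: eq_bigr => w _; exact: max_parts.
Qed.

Definition disk_avg (f : R * R -> R) : R := pi^-1 * \int[m2]_(z in @unit_disk R) f z.

Lemma unit_diskE : @unit_disk R = [set z : plane R | sqmod z <= 1].
Proof.
apply/seteqP; split => -[x y]; rewrite /unit_disk /modulus /toC /Normc.normc /sqmod /= => h.
  by rewrite -(sqr_sqrtr (addr_ge0 (sqr_ge0 x) (sqr_ge0 y))) expr_le1 ?sqrtr_ge0.
by rewrite -sqrtr1 ler_sqrt ?ler01.
Qed.

Lemma unit_disk_sub M : 1 <= M -> @unit_disk R `<=` rect (- M) M (- M) M.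
Proof.
move=> M1; rewrite unit_diskE => -[x y]; rewrite /sqmod /= => h.
have hx := sqr_ge0 x; have hy := sqr_ge0 y.
by split; rewrite /= in_itv /=; apply/andP; split; nra.
Qed.

Lemma integrable_disk (f : R * R -> R) : continuous f ->
  m2.-integrable (@unit_disk R) (EFin \o (f : plane R -> R)).
Proof.
move=> cf; apply: (integrableS _ _ (unit_disk_sub (lexx 1))).
- exact: measurable_rect.
- exact: measurable_unit_disk.
- exact: continuous_integrable_rect.
Qed.

Lemma integral_mrestr d (T : measurableType d) (m : {measure set T -> \bar R})
  (D : set T) (mD : measurable D) (f : T -> \bar R) : measurable_fun setT f ->
  (\int[mrestr m mD]_z f z = \int[m]_(z in D) f z)%E.
Proof.
move=> mf; rewrite -(setUv D) integral_setU//; last 3 first.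
- exact: measurableC.
- by rewrite setUv.
- exact/disj_setPCl.
rewrite [X in (_ + X)%E]null_set_integral ?adde0; last 3 first.
- exact: measurableC.
- exact: measurable_funTS.
- by change (m (~` D `&` D) = 0%E); rewrite setICl measure0.
apply: eq_measure_integral => A mA AD; change (m (A `&` D) = m A).
by rewrite setIidl.
Qed.

Lemma integral_uniform_disk (f : R * R -> R) : continuous f ->
  (\int[uniform_disk R]_z (f z)%:E = (disk_avg f)%:E)%E.
Proof.
move=> cf; have mf := continuous_measurable_plane cf.
have ge0 (g : R * R -> R) : continuous g -> (forall z, 0 <= g z) ->
    (\int[uniform_disk R]_z (g z)%:E = (disk_avg g)%:E)%E.
  move=> cg g0; have mg : measurable_fun setT (EFin \o (g : plane R -> R)).
    by apply/measurable_EFinP; exact: continuous_measurable_plane.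
  rewrite /uniform_disk ge0_integral_mscale//=; last by move=> z _; rewrite lee_fin.
  rewrite integral_mrestr// /disk_avg EFinM /Rintegral fineK//.
  exact: (integrable_fin_num (@measurable_unit_disk R) (integrable_disk cg)).
have cp : continuous (fun z => Num.max (f z) 0) by apply: cont_max => //; exact: cont_cst.
have cn : continuous (fun z => Num.max (- f z) 0).
  by apply: cont_max; [move=> z; apply: cvgN; exact: cf|exact: cont_cst].
rewrite integral_parts (ge0 _ cp) ?(ge0 _ cn); last 2 first.
- by move=> z; rewrite le_max lexx orbT.
- by move=> z; rewrite le_max lexx orbT.
rewrite -EFinB /disk_avg -mulrBr -RintegralB; last 3 first.
- exact: measurable_unit_disk.
- exact: (integrable_disk cp).
- exact: (integrable_disk cn).
by congr (_ * _)%:E; apply: eq_Rintegral => z _; exact: max_parts.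
Qed.

Lemma integral_disk_rect M (f : R * R -> R) : 1 <= M -> continuous f ->
  \int[m2]_(z in rect (- M) M (- M) M) ((if sqmod z <= 1 then 2 else 0) * f z) =
  2 * \int[m2]_(z in @unit_disk R) f z.
Proof.
move=> M1 cf; rewrite -RintegralZl; last 2 first.
- exact: measurable_unit_disk.
- exact: integrable_disk.
rewrite /Rintegral; congr fine.
rewrite [RHS]integral_mkcond [LHS]integral_mkcond; apply: eq_integral => z _.
rewrite !patchE; have [/set_mem zr|/negP zr] := boolP (z \in rect _ _ _ _).
  have -> : (z \in @unit_disk R) = (sqmod z <= 1).
    apply/idP/idP => [/set_mem|h]; first by rewrite unit_diskE.
    by apply: mem_set; rewrite unit_diskE.
  by case: ifP => h //; rewrite mul0r.
rewrite ifN//; apply/negP => /set_mem/(unit_disk_sub M1) h.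
by apply: zr; exact: mem_set.
Qed.

Lemma disk_avg_C2 M f fx fy fxx fyy : 1 < M ->
  C2_supported f fx fy fxx fyy (- M) M (- M) M ->
  2 * pi * disk_avg f = \int[m2]_(z in rect (- M) M (- M) M)
    (limit_potential z * (fxx z + fyy z)).
Proof.
move=> M1 F; rewrite (limit_potential_green M1 F) integral_disk_rect ?(ltW M1)//; last first.
  exact: C2_cont F.
by rewrite /disk_avg -mulrA mulVKf// lt0r_neq0// pi_gt0.
Qed.

Lemma disk_avg1 : disk_avg (fun=> 1) = 1.
Proof.
have h12 : 1 < 2 :> R by lra.
have := rect_disk_area h12.
have := integral_disk_rect (ltW h12) (@cont_cst R _ 1).
under eq_Rintegral do rewrite mulr1.
move=> -> h; rewrite /disk_avg.
have pi0 := @pi_gt0 R.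
have -> : \int[m2]_(x in @unit_disk R) 1 = pi :> R by lra.
by rewrite mulVf// gt_eqF.
Qed.

End ZeroMeasure.

(** * A twice differentiable step and its bump *)

Section SmoothStep.
Variable R : realType.
Implicit Types (x : R).

(** Near [x] the difference quotient of [g] is either that of [Q] or [0], and both are small. *)
Lemma deriv_glue0 (Q g : R -> R) x : is_derive x (1 : R) Q 0 ->
  (\forall t \near x, g t = Q t \/ g t = Q x) -> g x = Q x ->
  is_derive x (1 : R) g 0.
Proof.
move=> [dQ Q0] gQ gx.
have cQ : (fun h : R => h^-1 *: (Q (h *: (1 : R) + x) - Q x)) @ 0^' --> (0 : R).
  have h : (fun h : R => h^-1 *: (Q (h *: (1 : R) + x) - Q x)) @ 0^' --> 'D_1 Q x := dQ.
  by rewrite Q0 in h.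
have cg : (fun h : R => h^-1 *: (g (h *: (1 : R) + x) - g x)) @ 0^' --> (0 : R).
  apply/cvgr0Pnorm_lt => e e0; have /cvgr0Pnorm_lt/(_ e e0) hQ := cQ.
  have hg : \forall h \near 0^', g (h *: (1 : R) + x) = Q (h *: (1 : R) + x) \/
      g (h *: (1 : R) + x) = Q x.
    apply: nbhs_dnbhs.
    have : (fun h : R => h *: (1 : R) + x) @ (0 : R) --> x.
      rewrite -[X in _ --> X]add0r -[X in _ --> X + _](scale0r (1 : R)).
      by apply: cvgD; [apply: cvgZr_tmp; exact: cvg_id|exact: cvg_cst].
    by move=> /(_ _ gQ).
  near=> h.
  have [E|E] : g (h *: (1 : R) + x) = Q (h *: (1 : R) + x) \/
      g (h *: (1 : R) + x) = Q x by near: h; exact: hg.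
    by rewrite E gx; near: h.
  by rewrite E gx subrr scaler0 normr0.
split; first by apply/cvg_ex; exists 0.
exact: cvg_lim cg.
Unshelve. all: by end_near. Qed.

Definition clamp x : R := Num.max 0 (Num.min x 1).

Lemma clamp_id x : 0 <= x <= 1 -> clamp x = x.
Proof. by move=> /andP[x0 x1]; rewrite /clamp min_l// max_r. Qed.

Lemma clamp0 x : x <= 0 -> clamp x = 0.
Proof. by move=> x0; rewrite /clamp min_l ?max_l// (le_trans x0). Qed.

Lemma clamp1 x : 1 <= x -> clamp x = 1.
Proof. by move=> x1; rewrite /clamp min_r ?max_r. Qed.

Lemma cont_clamp : continuous clamp.
Proof.
apply: cont_max; first exact: cont_cst.
by apply: cont_min; [move=> ?; exact: cvg_id|exact: cont_cst].
Qed.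

Lemma deriv_clamp (Q Q1 : R -> R) : (forall x, is_derive x (1 : R) Q (Q1 x)) ->
  Q1 0 = 0 -> Q1 1 = 0 ->
  forall x, is_derive x (1 : R) (fun t => Q (clamp t)) (Q1 (clamp x)).
Proof.
move=> dQ Q10 Q11 x.
have nlt (c : R) : x < c -> \forall t \near x, t < c.
  have ci : continuous (fun t : R => t) by move=> ?; exact: cvg_id.
  by have /cvgr_lt := @ci x; apply.
have ngt (c : R) : c < x -> \forall t \near x, c < t.
  have ci : continuous (fun t : R => t) by move=> ?; exact: cvg_id.
  by have /cvgr_gt := @ci x; apply.
have [x0|x0|x0] := ltgtP x 0.
- rewrite (clamp0 (ltW x0)) Q10.
  apply: near_eq_is_derive (deriv_cst (Q 0) x).
  by apply: filterS (nlt _ x0) => t t0; rewrite clamp0 ?ltW.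
- have [x1|x1|x1] := ltgtP x 1.
  + rewrite clamp_id ?(ltW x0) ?(ltW x1)//.
    apply: near_eq_is_derive (dQ x).
    apply: filterS2 (nlt _ x1) (ngt _ x0) => t t1 t0.
    by rewrite clamp_id// (ltW t0) ltW.
  + rewrite (clamp1 (ltW x1)) Q11.
    apply: near_eq_is_derive (deriv_cst (Q 1) x).
    by apply: filterS (ngt _ x1) => t t0; rewrite clamp1 ?ltW.
  + rewrite x1 clamp1// Q11; apply: (deriv_glue0 (Q := Q)).
    * by rewrite -Q11.
    * rewrite x1 in ngt; apply: filterS (ngt 0 ltr01) => t t0.
      have [t1|t1] := leP t 1; [left|right]; first by rewrite clamp_id// (ltW t0).
      by rewrite clamp1// ltW.
    * by rewrite clamp1.
- rewrite x0 clamp0// Q10; apply: (deriv_glue0 (Q := Q)).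
  + by have := dQ 0; rewrite Q10.
  + rewrite x0 in nlt; apply: filterS (nlt 1 ltr01) => t t1.
    have [t0|t0] := leP 0 t; [left|right]; first by rewrite clamp_id// t0 ltW.
    by rewrite clamp0// ltW.
  + by rewrite clamp0.
Qed.

(* [step_poly] is flat to second order at [0] and [1], so gluing it to constants
   is [C^2] and the translates of [bump] form a [C^2] partition of unity. *)
Definition step_poly x := x * x * x * (6 * (x * x) - 15 * x + 10).
Definition step_poly1 x := 30 * (x * x) * ((x - 1) * (x - 1)).
Definition step_poly2 x := 60 * x * ((x - 1) * (2 * x - 1)).

Lemma deriv_step_poly x : is_derive x (1 : R) step_poly (step_poly1 x).
Proof.
have i := deriv_id x; have c k := deriv_cst k x.
have h := deriv_mul (deriv_mul (deriv_mul i i) i)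
  (deriv_add (deriv_sub (deriv_mul (c 6) (deriv_mul i i)) (deriv_mul (c 15) i)) (c 10)).
by apply: (is_derive_eq h); rewrite /step_poly1; ring.
Qed.

Lemma deriv_step_poly1 x : is_derive x (1 : R) step_poly1 (step_poly2 x).
Proof.
have i := deriv_id x; have c k := deriv_cst k x.
have h := deriv_mul (deriv_mul (c 30) (deriv_mul i i))
  (deriv_mul (deriv_sub i (c 1)) (deriv_sub i (c 1))).
by apply: (is_derive_eq h); rewrite /step_poly2; ring.
Qed.

Definition step x := step_poly (clamp x).
Definition step1 x := step_poly1 (clamp x).
Definition step2 x := step_poly2 (clamp x).

Lemma deriv_step x : is_derive x (1 : R) step (step1 x).
Proof. by apply: deriv_clamp deriv_step_poly _ _ x; rewrite /step_poly1; ring. Qed.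

Lemma deriv_step1 x : is_derive x (1 : R) step1 (step2 x).
Proof. by apply: deriv_clamp deriv_step_poly1 _ _ x; rewrite /step_poly2; ring. Qed.

Lemma cont_step2 : continuous step2.
Proof.
have cc := cont_clamp; have ck k := @cont_cst R _ k : continuous (fun _ : R => k).
by apply: cont_mul; [exact: cont_mul|apply: cont_mul; apply: cont_sub => //; exact: cont_mul].
Qed.

Lemma step_low x : x <= 0 -> [/\ step x = 0, step1 x = 0 & step2 x = 0].
Proof.
by move=> x0; rewrite /step /step1 /step2 clamp0// /step_poly /step_poly1 /step_poly2;
  split; ring.
Qed.

Lemma step_high x : 1 <= x -> [/\ step x = 1, step1 x = 0 & step2 x = 0].
Proof.
by move=> x0; rewrite /step /step1 /step2 clamp1// /step_poly /step_poly1 /step_poly2;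
  split; ring.
Qed.

Lemma step_itv x : 0 <= step x <= 1.
Proof.
have [x0|x0] := leP x 0; first by case: (step_low x0) => -> _ _; rewrite lexx ler01.
have [x1|x1] := leP 1 x; first by case: (step_high x1) => -> _ _; rewrite lexx ler01.
rewrite /step clamp_id ?(ltW x0) ?(ltW x1)// /step_poly.
have h1 : 0 <= x * x * x by rewrite !mulr_ge0 ?ltW.
have y0 : 0 <= 1 - x by lra.
have h2 : 0 <= (1 - x) * (1 - x) * (1 - x) by rewrite !mulr_ge0.
have h3 : 0 <= 6 * (x * x) - 15 * x + 10 by have := sqr_ge0 (x - 5 / 4); nra.
(* The upper bound rests on the factorization [1 - step_poly x = (1 - x)^3 (6 x^2 + 3 x + 1)]. *)
have h4 : 0 <= 6 * (x * x) + 3 * x + 1.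
  by rewrite !addr_ge0// ?mulr_ge0// ltW.
apply/andP; split; first exact: mulr_ge0.
have := mulr_ge0 h2 h4; rewrite -[_ <= 1]subr_ge0.
by congr (_ <= _); ring.
Qed.

(** A difference of consecutive translates, so that sums of integer translates telescope. *)
Definition bump x := step (x + 1) - step x.
Definition bump1 x := step1 (x + 1) - step1 x.
Definition bump2 x := step2 (x + 1) - step2 x.

Lemma bump_ge0 x : 0 <= bump x.
Proof.
rewrite /bump; have /andP[a0 a1] := step_itv (x + 1); have /andP[b0 b1] := step_itv x.
have [x0|x0] := leP x 0; first by case: (step_low x0) => -> _ _; rewrite subr0.
case: (@step_high (x + 1)) => [|-> _ _]; first lra.
by rewrite subr_ge0.
Qed.

Lemma bump_out x : 1 <= `|x| -> [/\ bump x = 0, bump1 x = 0 & bump2 x = 0].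
Proof.
rewrite ler_normr /bump /bump1 /bump2 => /orP[x1|x1].
  have [-> -> ->] := step_high x1.
  case: (@step_high (x + 1)) => [|-> -> ->]; first lra.
  by rewrite !subrr.
case: (@step_low x) => [|-> -> ->]; first lra.
case: (@step_low (x + 1)) => [|-> -> ->]; first lra.
by rewrite !subrr.
Qed.

Lemma deriv_affine (g g1 : R -> R) (a b : R) :
  (forall x, is_derive x (1 : R) g (g1 x)) ->
  forall x, is_derive x (1 : R) (fun t => g (t * a + b)) (a * g1 (x * a + b)).
Proof.
move=> dg x.
have h := deriv_chain (g := fun t => t * a + b) (dg (x * a + b))
  (deriv_add (deriv_mul (deriv_id x) (deriv_cst a x)) (deriv_cst b x)).
by apply: (is_derive_eq h); ring.
Qed.

Lemma deriv_bump x : is_derive x (1 : R) bump (bump1 x).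
Proof.
have h := deriv_affine 1 1 deriv_step x; have h' := deriv_step x.
have := deriv_sub h h'; rewrite mul1r mulr1.
have -> : (fun t => step (t * 1 + 1) - step t) = bump.
  by apply/funext => t; rewrite mulr1.
by [].
Qed.

Lemma deriv_bump1 x : is_derive x (1 : R) bump1 (bump2 x).
Proof.
have h := deriv_affine 1 1 deriv_step1 x; have h' := deriv_step1 x.
have := deriv_sub h h'; rewrite mul1r mulr1.
have -> : (fun t => step1 (t * 1 + 1) - step1 t) = bump1.
  by apply/funext => t; rewrite mulr1.
by [].
Qed.

Lemma cont_bump2 : continuous bump2.
Proof.
apply: cont_sub; last exact: cont_step2.
apply: (cont_comp (h := step2)); first exact: cont_step2.
by apply: cont_add; [move=> ?; exact: cvg_id|exact: cont_cst].
Qed.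

Lemma sum_bump (y : R) (m : nat) :
  \sum_(i < m) bump (y - i%:R) = step (y + 1) - step (y + 1 - m%:R).
Proof.
elim: m => [|m IH]; first by rewrite big_ord0 subr0 subrr.
rewrite big_ord_recr /= IH /bump.
have -> : y - m%:R + 1 = y + 1 - m%:R by ring.
have -> : y + 1 - m.+1%:R = y - m%:R by rewrite -natr1; ring.
ring.
Qed.

End SmoothStep.

(** * Approximation by grid bumps and weak convergence *)

Section WeakConvergence.
Variable R : realType.
Local Notation m2 := (dm2 R).

Section Bumps.
Variables (N : nat) (h : R).
Hypotheses (N2 : (2 <= N)%N) (hN : h * N%:R = 2).

Let hgt0 : 0 < h.
Proof.
have N0 : 0 < N%:R :> R by rewrite ltr0n (leq_trans _ N2).
by rewrite -(pmulr_lgt0 _ N0) hN.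
Qed.

(** The bump of half-width [h] centred at the node [(i - N) h]; for [0 <= i <= 2 N] the nodes form a
    grid of mesh [h = 2 / N] on [[-2, 2]]. As [h <= 1] the supports stay in [[-3, 3]], while the sum
    is [1] on a neighbourhood of [[-1, 1]]. *)
Definition grid_bump (i : nat) (x : R) := bump (x * h^-1 + (N%:R - i%:R)).
Definition grid_bump1 (i : nat) (x : R) := h^-1 * bump1 (x * h^-1 + (N%:R - i%:R)).
Definition grid_bump2 (i : nat) (x : R) :=
  h^-1 * (h^-1 * bump2 (x * h^-1 + (N%:R - i%:R))).

Lemma deriv_grid_bump i (x : R) : is_derive x (1 : R) (grid_bump i) (grid_bump1 i x).
Proof. exact: (deriv_affine _ _ (@deriv_bump R)). Qed.

Lemma deriv_grid_bump1 i (x : R) : is_derive x (1 : R) (grid_bump1 i) (grid_bump2 i x).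
Proof.
have h1 := deriv_affine h^-1 (N%:R - i%:R) (@deriv_bump1 R) x.
have h2 := deriv_mul (deriv_cst h^-1 x) h1.
by apply: (is_derive_eq h2); rewrite /grid_bump2; ring.
Qed.

Lemma cont_grid_bump i : continuous (grid_bump i).
Proof. exact: deriv_continuous (deriv_grid_bump i). Qed.

Lemma cont_grid_bump2 i : continuous (grid_bump2 i).
Proof.
apply: cont_mul; first exact: cont_cst.
apply: cont_mul; first exact: cont_cst.
apply: (cont_comp (h := @bump2 R)); first exact: cont_bump2.
apply: cont_add; last exact: cont_cst.
by apply: cont_mul; [move=> ?; exact: cvg_id|exact: cont_cst].
Qed.

Lemma grid_bump_ge0 i x : 0 <= grid_bump i x.
Proof. exact: bump_ge0. Qed.

Lemma grid_bump_out (i : 'I_(2 * N).+1) (x : R) : ~~ (- 3 < x < 3) ->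
  [/\ grid_bump i x = 0, grid_bump1 i x = 0 & grid_bump2 i x = 0].
Proof.
move=> hx; rewrite /grid_bump /grid_bump1 /grid_bump2.
have [|-> -> ->] := @bump_out R (x * h^-1 + (N%:R - i%:R)); last by rewrite !mulr0.
have iN : i%:R <= 2 * N%:R :> R by rewrite -natrM ler_nat -ltnS.
have i0 : 0 <= i%:R :> R by rewrite ler0n.
have N2' : 2 <= N%:R :> R by rewrite ler_nat.
have hi : h^-1 = N%:R / 2 by rewrite -hN; field; rewrite !gt_eqF// (lt_le_trans _ N2').
rewrite hi ler_normr; apply/orP.
move: hx; rewrite negb_and -!leNgt => /orP[hx|hx]; [right|left]; nra.
Qed.

Lemma grid_bump_near (i : nat) (x : R) : grid_bump i x != 0 ->
  `|x - (i%:R - N%:R) * h| <= h.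
Proof.
move=> b0; have : ~~ (1 <= `|x * h^-1 + (N%:R - i%:R)|).
  by apply/negP => /bump_out[b1 _ _]; rewrite /grid_bump b1 eqxx in b0.
rewrite -ltNge => /ltW hx.
have -> : x - (i%:R - N%:R) * h = (x * h^-1 + (N%:R - i%:R)) * h.
  by field; rewrite gt_eqF.
by rewrite normrM (gtr0_norm hgt0) ler_piMl// ltW.
Qed.

Lemma sum_grid_bump (x : R) : 0 <= \sum_(i < (2 * N).+1) grid_bump i x <= 1 /\
  (`|x| <= 1 -> \sum_(i < (2 * N).+1) grid_bump i x = 1).
Proof.
have E : \sum_(i < (2 * N).+1) grid_bump i x =
    step (x * h^-1 + N%:R + 1) - step (x * h^-1 - N%:R).
  rewrite (eq_bigr (fun i : 'I_(2 * N).+1 => bump (x * h^-1 + N%:R - i%:R))); last first.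
    by move=> i _; rewrite /grid_bump addrA.
  rewrite sum_bump; congr (_ - step _).
  by rewrite -natr1 natrM; ring.
split.
  apply/andP; split; first by apply: sumr_ge0 => i _; exact: grid_bump_ge0.
  rewrite E; have /andP[a0 a1] := step_itv (x * h^-1 + N%:R + 1).
  by have /andP[b0 b1] := step_itv (x * h^-1 - N%:R); lra.
rewrite ler_norml => /andP[x1 x2]; rewrite E.
have N2' : 2 <= N%:R :> R by rewrite ler_nat.
have hi : h^-1 = N%:R / 2 by rewrite -hN; field; rewrite !gt_eqF// (lt_le_trans _ N2').
rewrite hi.
case: (@step_high R (x * (N%:R / 2) + N%:R + 1)) => [|-> _ _]; first nra.
case: (@step_low R (x * (N%:R / 2) - N%:R)) => [|-> _ _]; first nra.
by rewrite subr0.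
Qed.

Definition grid_bump_plane (i j : nat) (z : R * R) := grid_bump i z.1 * grid_bump j z.2.

Lemma grid_bump_C2 (i j : 'I_(2 * N).+1) : C2_supported (grid_bump_plane i j)
  (fun z => grid_bump1 i z.1 * grid_bump j z.2)
  (fun z => grid_bump i z.1 * grid_bump1 j z.2)
  (fun z => grid_bump2 i z.1 * grid_bump j z.2)
  (fun z => grid_bump i z.1 * grid_bump2 j z.2) (- 3) 3 (- 3) 3.
Proof.
split.
- move=> x y; have H := deriv_mul (deriv_grid_bump i x) (deriv_cst (grid_bump j y) x).
  by apply: (is_derive_eq H); rewrite /=; ring.
- move=> x y; have H := deriv_mul (deriv_cst (grid_bump i x) y) (deriv_grid_bump j y).
  by apply: (is_derive_eq H); rewrite /=; ring.
- move=> x y; have H := deriv_mul (deriv_grid_bump1 i x) (deriv_cst (grid_bump j y) x).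
  by apply: (is_derive_eq H); rewrite /=; ring.
- move=> x y; have H := deriv_mul (deriv_cst (grid_bump i x) y) (deriv_grid_bump1 j y).
  by apply: (is_derive_eq H); rewrite /=; ring.
- apply: cont_mul.
    by apply: (cont_comp (h := grid_bump i)); [exact: cont_grid_bump|exact: cont_fst].
  by apply: (cont_comp (h := grid_bump j)); [exact: cont_grid_bump|exact: cont_snd].
- apply: cont_mul.
    by apply: (cont_comp (h := grid_bump2 i)); [exact: cont_grid_bump2|exact: cont_fst].
  by apply: (cont_comp (h := grid_bump j)); [exact: cont_grid_bump|exact: cont_snd].
- apply: cont_mul.
    by apply: (cont_comp (h := grid_bump i)); [exact: cont_grid_bump|exact: cont_fst].
  by apply: (cont_comp (h := grid_bump2 j)); [exact: cont_grid_bump2|exact: cont_snd].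
- move=> z; rewrite negb_and /grid_bump_plane => /orP[|] /grid_bump_out H.
    by have [-> -> ->] := H i; rewrite !mul0r.
  by have [-> -> ->] := H j; rewrite !mulr0.
Qed.

End Bumps.

(** Only [z] is confined to the square. Around each of its points the estimate holds on a ball for
    all small [dl]; compactness in its near-covering form makes [dl] uniform. *)
Lemma uniform_continuity_rect (f : R * R -> R) M eps : continuous f -> 0 < eps ->
  exists2 dl, 0 < dl & forall z z', rect (- M) M (- M) M z ->
    `|z.1 - z'.1| <= dl -> `|z.2 - z'.2| <= dl -> `|f z - f z'| <= eps.
Proof.
move=> cf e0.
have /compact_near_coveringP cov := @compact_rect R (- M) M (- M) M.
pose P (dl : R) (z : R * R) := forall z' : R * R,
  `|z.1 - z'.1| <= dl -> `|z.2 - z'.2| <= dl -> `|f z - f z'| <= eps.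
have : \forall dl \near 0^'+, rect (- M) M (- M) M `<=` P dl.
  apply: cov => z _.
  have e2 : 0 < eps / 2 by rewrite divr_gt0.
  have [dl dl0 hdl] := continuous_near_square z cf e2.
  have dl2 : 0 < dl / 2 by rewrite divr_gt0.
  exists (ball z (dl / 2), [set t : R | t < dl / 2]) => /=.
    split; first exact: nbhsx_ballx.
    exact: nbhs_right_lt.
  move=> [y t] [/= [y1 y2] tlt] z' h1 h2 /=.
  rewrite /ball /= in y1 y2.
  have fy : `|f y - f z| < eps / 2 by apply: hdl; rewrite distrC; lra.
  have fz' : `|f z' - f z| < eps / 2.
    apply: hdl.
      have := ler_distD y.1 z'.1 z.1; rewrite [`|z'.1 - y.1|]distrC [`|y.1 - z.1|]distrC; lra.
    have := ler_distD y.2 z'.2 z.2; rewrite [`|z'.2 - y.2|]distrC [`|y.2 - z.2|]distrC; lra.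
  have := ler_distD (f z) (f y) (f z'); rewrite [`|f z - f z'|]distrC; lra.
move=> nr; near (0 : R)^'+ => dl.
have hP : rect (- M) M (- M) M `<=` P dl by near: dl.
by exists dl => // z z' /hP; exact.
Unshelve. all: by end_near. Qed.

Variable p : nat -> {poly R[i]}.
Hypothesis p_size : forall n, (1 <= n)%N -> size (p n) = n.+1.

Let p_neq0 n : (1 <= n)%N -> p n != 0.
Proof. by move=> n1; rewrite -size_poly_gt0 p_size. Qed.

(** Both averages are pairings of a potential with the Laplacian of [f], divided by [2 pi]. Their
    difference is thus at most [C / (2 pi)] times the [L^1] distance of the potentials, [C] bounding
    the Laplacian. *)
Lemma zero_avg_C2_cvg M f fx fy fxx fyy : 1 < M ->
  (fun n => \int[m2]_(z in rect (- M) M (- M) M)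
    `|n%:R^-1 * ln (Normc.normc (p n).[toC z]) - limit_potential z|) @ \oo --> (0 : R) ->
  C2_supported f fx fy fxx fyy (- M) M (- M) M ->
  (fun n => zero_avg n (p n) f) @ \oo --> disk_avg f.
Proof.
move=> M1 p_cvg F; have M0 : 0 < M by lra.
have mr : measurable (rect (- M) M (- M) M) by exact: measurable_rect.
have [cL [C C0 hC]] := laplacian_C2_bounded F.
have pi0 : 0 < 2 * pi :> R by rewrite mulr_gt0// pi_gt0.
rewrite -(subrK (disk_avg f) (disk_avg f)) subrr.
have -> : (fun n => zero_avg n (p n) f) =
    (fun n => (zero_avg n (p n) f - disk_avg f) + disk_avg f).
  by apply/funext => n; rewrite subrK.
apply: cvgD; last exact: cvg_cst.
have bound n : (1 <= n)%N -> `|zero_avg n (p n) f - disk_avg f| <=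
    (2 * pi)^-1 * C * \int[m2]_(z in rect (- M) M (- M) M)
    `|n%:R^-1 * ln (Normc.normc (p n).[toC z]) - limit_potential z|.
  move=> n1.
  have il := integrable_poly_log (- M) M (- M) M (p_neq0 n1).
  have iu : m2.-integrable (rect (- M) M (- M) M) (EFin \o
      (fun z : plane R => n%:R^-1 * ln (Normc.normc (p n).[toC z]))).
    by have := integrableZl mr n%:R^-1 il; apply: eq_integrable => // z _ /=; rewrite EFinM.
  have iphi : m2.-integrable (rect (- M) M (- M) M) (EFin \o
      (@limit_potential R : plane R -> R)).
    by apply: continuous_integrable_rect; exact: cont_limit_potential.
  have id : m2.-integrable (rect (- M) M (- M) M) (EFin \o
      (fun z : plane R => n%:R^-1 * ln (Normc.normc (p n).[toC z]) - limit_potential z)).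
    by have := integrableB mr iu iphi; apply: eq_integrable.
  have E : 2 * pi * (zero_avg n (p n) f - disk_avg f) =
      \int[m2]_(z in rect (- M) M (- M) M)
      ((n%:R^-1 * ln (Normc.normc (p n).[toC z]) - limit_potential z) * (fxx z + fyy z)).
    rewrite mulrBr (disk_avg_C2 M1 F) /zero_avg mulrCA -(poly_log_potential (p_neq0 n1) M0 F).
    rewrite -RintegralZl//; last exact: (integrable_mul_laplacian F il).
    under [RHS]eq_Rintegral do rewrite mulrBl.
    rewrite RintegralB//; last 2 first.
    - exact: (integrable_mul_laplacian F iu).
    - exact: (integrable_mul_laplacian F iphi).
    by congr (_ - _); apply: eq_Rintegral => z _; rewrite mulrA.
  have -> : zero_avg n (p n) f - disk_avg f =
    (2 * pi)^-1 * (2 * pi * (zero_avg n (p n) f - disk_avg f)).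
    by rewrite mulKf// gt_eqF.
  rewrite E normrM (gtr0_norm (_ : 0 < (2 * pi)^-1)) ?invr_gt0// -mulrA.
  rewrite ler_wpM2l ?invr_ge0 ?(ltW pi0)//.
  apply: (le_trans (le_normr_Rintegral mr (integrable_mul_laplacian F id))).
  rewrite -RintegralZl//; last exact: integrable_norm.
  apply: le_Rintegral => //.
  - by have := integrable_norm (integrable_mul_laplacian F id).
  - have := integrableZl mr C (integrable_norm id).
    by apply: eq_integrable => // z _ /=; rewrite EFinM.
  - by move=> z rz; rewrite normrM mulrC ler_wpM2r//; exact: hC.
apply/cvgr0Pnorm_lt => e e0.
have : (fun n => (2 * pi)^-1 * C * \int[m2]_(z in rect (- M) M (- M) M)
    `|n%:R^-1 * ln (Normc.normc (p n).[toC z]) - limit_potential z|) @ \oo --> (0 : R).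
  rewrite -(mulr0 ((2 * pi)^-1 * C)); apply: cvgM; first exact: cvg_cst.
  exact: p_cvg.
move=> /cvgr0Pnorm_lt/(_ e e0) near0.
near=> n.
apply: (@le_lt_trans _ _ `|(2 * pi)^-1 * C * \int[m2]_(z in rect (- M) M (- M) M)
    `|n%:R^-1 * ln (Normc.normc (p n).[toC z]) - limit_potential z| |).
  apply: le_trans (ler_norm _); apply: bound; near: n; exact: nbhs_infty_ge.
by near: n.
Unshelve. all: by end_near. Qed.

Lemma zero_avgD n q (f g : R * R -> R) :
  zero_avg n q (fun z => f z + g z) = zero_avg n q f + zero_avg n q g.
Proof. by rewrite /zero_avg big_split /= mulrDr. Qed.

Lemma zero_avgZ n q k (f : R * R -> R) :
  zero_avg n q (fun z => k * f z) = k * zero_avg n q f.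
Proof. by rewrite /zero_avg -mulr_sumr mulrCA. Qed.

Lemma zero_avg_le n q (f g : R * R -> R) : (forall z, f z <= g z) ->
  zero_avg n q f <= zero_avg n q g.
Proof. by move=> fg; rewrite ler_wpM2l ?invr_ge0// ler_sum. Qed.

Lemma zero_avg1 n : (1 <= n)%N -> zero_avg n (p n) (fun=> 1) = 1.
Proof.
move=> n1; rewrite /zero_avg big_const_seq count_predT (size_zeros (p_size n1)).
by rewrite iter_addr_0 mulVf// pnatr_eq0 -lt0n.
Qed.

Lemma disk_avgD (f g : R * R -> R) : continuous f -> continuous g ->
  disk_avg (fun z => f z + g z) = disk_avg f + disk_avg g.
Proof.
move=> cf cg.
by rewrite /disk_avg (RintegralD (@measurable_unit_disk R) (integrable_disk cf) (integrable_disk cg)) mulrDr.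
Qed.

Lemma disk_avgZ k (f : R * R -> R) : continuous f ->
  disk_avg (fun z => k * f z) = k * disk_avg f.
Proof.
move=> cf.
by rewrite /disk_avg (RintegralZl _ (@measurable_unit_disk R) (integrable_disk cf)) mulrCA.
Qed.

Lemma disk_avg_le (f g : R * R -> R) : continuous f -> continuous g ->
  (forall z, f z <= g z) -> disk_avg f <= disk_avg g.
Proof.
move=> cf cg fg; rewrite /disk_avg ler_wpM2l ?invr_ge0 ?pi_ge0//.
by apply: (le_Rintegral (@measurable_unit_disk R) (integrable_disk cf) (integrable_disk cg)).
Qed.

Let good (f : R * R -> R) := continuous f /\
  (fun n => zero_avg n (p n) f) @ \oo --> disk_avg f.

Let goodZ k f : good f -> good (fun z => k * f z).
Proof.
move=> [cf lf]; split; first by apply: cont_mul => //; exact: cont_cst.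
rewrite disk_avgZ//; under eq_fun do rewrite zero_avgZ.
by apply: cvgM => //; exact: cvg_cst.
Qed.

Let good_sum (I : Type) (s : seq I) (F : I -> R * R -> R) :
  (forall i, good (F i)) -> good (fun z => \sum_(i <- s) F i z).
Proof.
move=> gF; elim: s => [|i s [cs ls]].
  under eq_fun do rewrite big_nil.
  have g0 : (fun _ : R * R => 0) = (fun _ => 0 * 0) :> (R * R -> R).
    by apply/funext => z; rewrite mulr0.
  split; first exact: cont_cst.
  have -> : disk_avg (fun=> 0) = 0 :> R.
    by rewrite g0 disk_avgZ ?mul0r//; exact: cont_cst.
  under eq_fun do rewrite g0 zero_avgZ mul0r.
  exact: cvg_cst.
under eq_fun do rewrite big_cons.
have [ci li] := gF i; split; first exact: cont_add.
rewrite disk_avgD//; under eq_fun do rewrite zero_avgD.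
exact: cvgD.
Qed.

(** [f] is compared with the combination [fh] of bumps weighted by its values at the nodes. With
    [chi] the sum of the bumps, the error is at most [C (1 - chi) + e / 4] on the whole plane. Since
    [chi] is itself a sum of admissible test functions and equals [1] on the disk, the zero averages
    of [1 - chi] tend to [0]. *)
Lemma weak_cvg_of_potential :
  (fun n => \int[m2]_(z in rect (- 3) 3 (- 3) 3)
    `|n%:R^-1 * ln (Normc.normc (p n).[toC z]) - limit_potential z|) @ \oo --> (0 : R) ->
  weak_cvg (fun n => zero_measure n (p n)) (uniform_disk R).
Proof.
move=> p_cvg f cf [B [_ hB]].
have [C C0 fC] : exists2 C, 0 < C & forall z, `|f z| <= C.
  exists (`|B| + 1); first by rewrite ltr_wpDl.
  move=> z; apply: (hB (`|B| + 1)) => //.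
  by rewrite (le_lt_trans (ler_norm B))// ltrDl.
rewrite integral_uniform_disk//.
suff cv : (fun n => zero_avg n (p n) f) @ \oo --> disk_avg f.
  have IE : \forall n \near \oo, (\int[zero_measure n (p n)]_z (f z)%:E)%E = (zero_avg n (p n) f)%:E.
    near=> n; apply: integral_zero_measure; last exact: continuous_measurable_plane.
    by apply: size_zeros; apply: p_size; near: n; exact: nbhs_infty_ge.
  apply: cvg_EFin; first by apply: filterS IE => n ->.
  apply: cvg_trans cv; apply: near_eq_cvg.
  by apply: filterS IE => n /= ->.
apply/cvgrPdist_lt => e e0.
(* Four errors of [e / 4]: [f] against [fh] on the disk, the convergence for [fh], and two for [f]
   against [fh] on the zeros, namely the oscillation of [f] and the mass where [chi < 1]. *)
have e4 : 0 < e / 4 by rewrite divr_gt0.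
have [dl dl0 hdl] := uniform_continuity_rect 3 cf e4.
(* The double successor gives both [N >= 2] and a mesh [2 / N] of at most [dl]. *)
pose N := (Num.truncn (2 / dl)).+2.
have N2 : (2 <= N)%N by [].
have N0 : 0 < N%:R :> R by rewrite ltr0n.
pose h : R := 2 / N%:R.
have hN : h * N%:R = 2 by rewrite divfK// gt_eqF.
have h0 : 0 < h by rewrite divr_gt0.
have hdl' : h <= dl.
  rewrite /h ler_pdivrMr// mulrC -ler_pdivrMr//.
  have := truncnS_gt (2 / dl) => /ltW /le_trans; apply.
  by rewrite ler_nat.
pose m := (2 * N).+1.
pose b (i j : 'I_m) := grid_bump_plane N h i j.
pose q (i : 'I_m) : R := (i%:R - N%:R) * h.
have gb i j : good (b i j).
  have F := grid_bump_C2 N2 hN i j; split; first exact: C2_cont F.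
  by apply: (zero_avg_C2_cvg _ p_cvg F); lra.
pose chi z := \sum_(i < m) \sum_(j < m) b i j z.
pose fh z := \sum_(i < m) \sum_(j < m) f (q i, q j) * b i j z.
have gchi : good chi by do 2 apply: good_sum => ?; exact: gb.
have gfh : good fh by do 2 apply: good_sum => ?; apply: goodZ; exact: gb.
have chiE z : chi z = (\sum_(i < m) grid_bump N h i z.1) * (\sum_(j < m) grid_bump N h j z.2).
  by rewrite /chi mulr_suml; apply: eq_bigr => i _; rewrite mulr_sumr.
have chi01 z : 0 <= chi z <= 1.
  have [/andP[a0 a1] _] := sum_grid_bump N2 hN z.1.
  have [/andP[b0 b1] _] := sum_grid_bump N2 hN z.2.
  by rewrite chiE mulr_ge0//= mulr_ile1.
have b0 i j z : 0 <= b i j z by rewrite mulr_ge0// grid_bump_ge0.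
have err z : `|f z - fh z| <= C * (1 - chi z) + e / 4.
  have -> : f z - fh z = f z * (1 - chi z) +
      \sum_(i < m) \sum_(j < m) (f z - f (q i, q j)) * b i j z.
    have -> : \sum_(i < m) \sum_(j < m) (f z - f (q i, q j)) * b i j z = f z * chi z - fh z.
      rewrite /chi mulr_sumr -sumrB; apply: eq_bigr => i _.
      by rewrite mulr_sumr -sumrB; apply: eq_bigr => j _; rewrite mulrBl.
    ring.
  have /andP[c0 c1] := chi01 z.
  apply: (le_trans (ler_normD _ _)); apply: lerD.
    by rewrite normrM (ger0_norm (_ : 0 <= 1 - chi z)) ?subr_ge0// ler_wpM2r// subr_ge0.
  apply: (@le_trans _ _ (e / 4 * chi z)); last by rewrite ler_piMr// ltW.
  rewrite /chi mulr_sumr; apply: (le_trans (ler_norm_sum _ _ _)); apply: ler_sum => i _.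
  rewrite mulr_sumr; apply: (le_trans (ler_norm_sum _ _ _)); apply: ler_sum => j _.
  rewrite normrM (ger0_norm (b0 i j z)).
  have [->|bn0] := eqVneq (b i j z) 0; first by rewrite !mulr0.
  rewrite ler_wpM2r//; apply: hdl => /=.
  - move: bn0; rewrite mulf_eq0 negb_or => /andP[bi bj].
    have in3 (k : 'I_m) x : grid_bump N h k x != 0 -> - 3 <= x <= 3.
      move=> bk; have : - 3 < x < 3.
        by apply: contraNT bk => /(grid_bump_out N2 hN k)[-> _ _].
      by move=> /andP[? ?]; apply/andP; split; exact: ltW.
    by split; rewrite /= in_itv /=; [exact: in3 bi|exact: in3 bj].
  - move: bn0; rewrite mulf_eq0 negb_or => /andP[bi _].
    by apply: le_trans hdl'; exact: (grid_bump_near N2 hN bi).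
  - move: bn0; rewrite mulf_eq0 negb_or => /andP[_ bj].
    by apply: le_trans hdl'; exact: (grid_bump_near N2 hN bj).
have chi1 : disk_avg chi = 1.
  rewrite -[RHS]disk_avg1 /disk_avg; congr (_ * _); apply: eq_Rintegral => z /set_mem.
  rewrite unit_diskE /= /sqmod => hz; have hx := sqr_ge0 z.1; have hy := sqr_ge0 z.2.
  have z1 : `|z.1| <= 1 by rewrite ler_norml; apply/andP; split; nra.
  have z2 : `|z.2| <= 1 by rewrite ler_norml; apply/andP; split; nra.
  by rewrite chiE (sum_grid_bump N2 hN z.1).2// (sum_grid_bump N2 hN z.2).2// mulr1.
have [cchi lchi] := gchi; have [cfh lfh] := gfh.
have C4 : 0 < e / 4 / C by rewrite divr_gt0.
move: lchi; rewrite chi1 => /cvgrPdist_lt/(_ _ C4) nchi.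
move: lfh => /cvgrPdist_lt/(_ _ e4) nfh.
pose E z := C * (1 - chi z) + e / 4.
have cE : continuous E.
  apply: cont_add; last exact: cont_cst.
  by apply: cont_mul; [exact: cont_cst|apply: cont_sub => //; exact: cont_cst].
have EE z : E z = - C * chi z + (C + e / 4) * 1 by rewrite /E; ring.
have JE : disk_avg E = e / 4.
  have -> : E = fun z => - C * chi z + (C + e / 4) * 1 by apply/funext.
  rewrite disk_avgD; last 2 first.
  - by apply: cont_mul => //; exact: cont_cst.
  - exact: cont_cst.
  rewrite disk_avgZ// (disk_avgZ (C + e / 4) (@cont_cst R _ 1)) disk_avg1 chi1; ring.
have Jd : `|disk_avg f - disk_avg fh| <= e / 4.
  have j1 : disk_avg fh <= disk_avg f + disk_avg E.
    rewrite -disk_avgD//; apply: disk_avg_le => //; first exact: cont_add.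
    by move=> z; have := err z; rewrite ler_norml => /andP[h1 h2]; rewrite /E; lra.
  have j2 : disk_avg f <= disk_avg fh + disk_avg E.
    rewrite -disk_avgD//; apply: disk_avg_le => //; first exact: cont_add.
    by move=> z; have := err z; rewrite ler_norml => /andP[h1 h2]; rewrite /E; lra.
  by rewrite -JE ler_norml; apply/andP; split; lra.
near=> n.
have n1 : (1 <= n)%N by near: n; exact: nbhs_infty_ge.
have In : zero_avg n (p n) E = C * (1 - zero_avg n (p n) chi) + e / 4.
  have -> : E = fun z => - C * chi z + (C + e / 4) * 1 by apply/funext.
  rewrite zero_avgD zero_avgZ (zero_avgZ n (p n) (C + e / 4) (fun=> 1)) zero_avg1//; ring.
have Id : `|zero_avg n (p n) f - zero_avg n (p n) fh| <= zero_avg n (p n) E.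
  have j1 : zero_avg n (p n) fh <= zero_avg n (p n) f + zero_avg n (p n) E.
    rewrite -zero_avgD; apply: zero_avg_le.
    by move=> z; have := err z; rewrite ler_norml => /andP[h1 h2]; rewrite /E; lra.
  have j2 : zero_avg n (p n) f <= zero_avg n (p n) fh + zero_avg n (p n) E.
    rewrite -zero_avgD; apply: zero_avg_le.
    by move=> z; have := err z; rewrite ler_norml => /andP[h1 h2]; rewrite /E; lra.
  by rewrite ler_norml; apply/andP; split; lra.
have d1 : `|1 - zero_avg n (p n) chi| < e / 4 / C by near: n; exact: nchi.
have d2 : `|disk_avg fh - zero_avg n (p n) fh| < e / 4 by near: n; exact: nfh.
have d3 : C * (1 - zero_avg n (p n) chi) < e / 4.
  by rewrite mulrC -ltr_pdivlMr//; exact: le_lt_trans (ler_norm _) d1.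
rewrite In in Id.
have := ler_distD (disk_avg fh) (disk_avg f) (zero_avg n (p n) f).
have := ler_distD (zero_avg n (p n) fh) (disk_avg fh) (zero_avg n (p n) f).
rewrite (distrC (zero_avg n (p n) fh)); lra.
Unshelve. all: by end_near. Qed.

End WeakConvergence.

(** * Anti-concentration *)

Section Law.
Variable R : realType.
Local Notation m2 := (dm2 R).
Local Notation mu := (@lebesgue_measure R).

Lemma integral_density_le d (X : measurableType d) (m : {measure set X -> \bar R})
    (phi : X -> R) (T : R) (B A : set X) :
  measurable_fun setT phi -> (forall x, 0 <= phi x) -> (forall x, `|phi x| <= T) ->
  measurable B -> measurable A -> B `<=` A ->
  (\int[m]_(x in B) (phi x)%:E <= T%:E * m A)%E.
Proof.
move=> mphi phi0 phiT mB mA BA.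
have mphi' D : measurable_fun D (EFin \o phi).
  by apply/measurable_EFinP; exact: measurable_funTS.
apply: (@le_trans _ _ (\int[m]_(x in A) (phi x)%:E)%E).
  by apply: ge0_subset_integral => // x _; rewrite lee_fin.
rewrite -integral_cst//; apply: ge0_le_integral => //.
- by move=> x _; rewrite lee_fin.
- by move=> x _; rewrite lee_fin (le_trans (ler_norm _)).
Qed.

Definition affine_ball (s c : R[i]) (r : R) : set (plane R) :=
  [set a | Normc.normc (s + toC a * c) <= r].

Lemma measurable_affine_ball (s c : R[i]) (r : R) : measurable (affine_ball s c r).
Proof.
have mf : measurable_fun setT (fun a : plane R => Normc.normc (s + toC a * c)).
  apply: measurable_normc; apply: cmeasurableD; first exact: cmeasurable_cst.
  apply: cmeasurableM; last exact: cmeasurable_cst.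
  exact: cmeasurable_toC.
have := mf measurableT (`]-oo, r]%classic) (measurable_itv _); rewrite setTI.
congr measurable; apply/seteqP; split => a /=; by rewrite in_itv.
Qed.

Lemma ge_normc_Re (z : R[i]) : `|complex.Re z| <= Normc.normc z.
Proof.
case: z => a b /=; rewrite -sqrtr_sqr ler_wsqrtr//.
by rewrite lerDl sqr_ge0.
Qed.

Lemma ge_normc_Im (z : R[i]) : `|complex.Im z| <= Normc.normc z.
Proof.
case: z => a b /=; rewrite -sqrtr_sqr ler_wsqrtr//.
by rewrite lerDr sqr_ge0.
Qed.

Lemma ball_sub (s c : R[i]) (r : R) (a : plane R) : c != 0 ->
  Normc.normc (s + toC a * c) <= r ->
  `|a.1 - complex.Re (- s / c)| <= r / Normc.normc c /\
  `|a.2 - complex.Im (- s / c)| <= r / Normc.normc c.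
Proof.
move=> c0 h.
have E : s + toC a * c = (toC a - (- s / c)) * c.
  by rewrite mulrBl divfK// opprK addrC.
rewrite E Normc.normcM -ler_pdivlMr ?normc_gt0// in h.
by split; apply: (le_trans _ h); have := ge_normc_Re (toC a - - s / c);
  have := ge_normc_Im (toC a - - s / c); case: (- s / c) => u v.
Qed.

Variables (T : R) (law : set (plane R) -> \bar R).
Hypothesis hT : 0 < T.
Hypothesis hlaw : complex_law T law \/ real_law T law.

(** The set of [a] with [|s + a c| <= r] is a disk of radius [rho = r / |c|]. A complex law is
    bounded by [T] times the area [4 rho^2] of an enclosing square, a real law by [T] times the
    length [2 rho] of an interval containing the trace on the axis; the sum serves both. *)
Lemma law_ball (s c : R[i]) (r : R) : c != 0 -> 0 <= r ->
  (law (affine_ball s c r) <=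
   (T * (2 * (r / Normc.normc c) + 4 * (r / Normc.normc c) ^+ 2))%:E)%E.
Proof.
move=> c0 r0; set rho := r / Normc.normc c.
have rho0 : 0 <= rho by rewrite divr_ge0// ltW// normc_gt0.
have mB := measurable_affine_ball s c r.
set B := affine_ball s c r in mB *.
set u := complex.Re (- s / c); set v := complex.Im (- s / c).
have sub (a : plane R) : B a -> (u - rho <= a.1 <= u + rho) /\ (v - rho <= a.2 <= v + rho).
  by move=> /(ball_sub c0)[]; rewrite -/u -/v -/rho !ler_norml => /andP[? ?] /andP[? ?];
    split; apply/andP; split; lra.
have uu : u - rho <= u + rho by lra.
have vv : v - rho <= v + rho by lra.
case: hlaw => -[phi [[mphi phi0 _] [phiT _] lawE]]; rewrite lawE//.
  apply: (le_trans (integral_density_le m2 mphi phi0 phiT mB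
    (measurable_rect (u - rho) (u + rho) (v - rho) (v + rho)) _)).
    by move=> a /sub[h1 h2]; split; rewrite /= in_itv.
  rewrite dm2_rect// -EFinM lee_fin ler_wpM2l ?(ltW hT)//.
  rewrite (_ : (_ * _ : R) = 4 * rho ^+ 2); last by ring.
  by rewrite lerDr mulr_ge0.
apply: (le_trans (integral_density_le (dm1 R) mphi phi0 phiT _
  (measurable_itv `[u - rho, u + rho]) _)).
- have := measurable_pair2 (T1 := measurableTypeR R) (T2 := measurableTypeR R) 0.
  by move=> /(_ measurableT B mB); rewrite setTI.
- by move=> x /sub[h1 _]; rewrite /= in_itv.
rewrite /dm1 /= lebesgue_measure_itv /= lte_fin.
case: ifPn => _; last by rewrite mule0 lee_fin mulr_ge0 ?(ltW hT)// addr_ge0// mulr_ge0// sqr_ge0.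
rewrite -EFinB -EFinM lee_fin ler_wpM2l ?(ltW hT)//.
rewrite (_ : (_ - _ : R) = 2 * rho); last by ring.
by rewrite lerDl mulr_ge0// sqr_ge0.
Qed.

Lemma law_tail : \forall r \near +oo,
  (law [set a : plane R | (r <= modulus a)%R] <= (T / r ^+ 2)%:E)%E.
Proof.
have mB (r : R) : measurable [set a : plane R | r <= modulus a].
  have mf : measurable_fun setT (fun a : plane R => modulus a).
    by apply: measurable_normc; exact: cmeasurable_toC.
  have := mf measurableT (`[r, +oo[%classic) (measurable_itv _); rewrite setTI.
  by congr measurable; apply/seteqP; split => a /=; rewrite in_itv /= andbT.
case: hlaw => -[phi [[mphi phi0 _] [_ tail] lawE]];
  apply: filterS tail => r; rewrite lawE//.
  exact: le_trans (lee_abs _).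
have E : [set x : R | (r <= modulus ((x, 0) : plane R))%R] = [set x : R | (r <= `|x|)%R].
  apply/seteqP; split => x /=; by rewrite /modulus /toC /= expr0n /= addr0 sqrtr_sqr.
rewrite /= in E; rewrite E; exact: le_trans (lee_abs _).
Qed.

End Law.

(** * Independence of one coefficient from the sum of the others *)

Section Independence.
Variables (R : realType) (d : measure_display) (Omega : measurableType d)
  (P : probability Omega R).

Lemma independent_dynkin (E : set Omega) : measurable E ->
  dynkin [set A | measurable A /\ (P (A `&` E) = P A * P E)%E].
Proof.
move=> mE; split.
- by split=> //; rewrite setTI probability_setT mul1e.
- move=> A [mA AE]; split; first exact: measurableC.
  transitivity (P E - P A * P E)%E.
    rewrite -AE (setIC A) (setIC (~` A)) -setDE; apply: measureD => //.
    by rewrite (le_lt_trans (probability_le1 _ _))// ltry.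
  rewrite probability_setC//.
  have fA := fin_num_measure P A mA; have fE := fin_num_measure P E mE.
  move: (fineK fA) (fineK fE); move: (fine (P A)) (fine (P E)) => u v <- <-.
  by rewrite -EFinM -!EFinB -EFinM; congr EFin; ring.
- move=> F tF hF; split; first by apply: bigcupT_measurable => n; case: (hF n).
  rewrite setI_bigcupl measure_bigcup//=; last 2 first.
  + by move=> i _; apply: measurableI => //; case: (hF i).
  + by apply: trivIset_setIr.
  rewrite measure_bigcup//=; last by move=> i _; case: (hF i).
  rewrite [LHS](eq_eseriesr (g := fun i => (P E * P (F i))%E)); last first.
    by move=> i _; rewrite muleC; case: (hF i).
  have fE := fin_num_measure P E mE; rewrite -(fineK fE).
  rewrite nneseriesZl; first by rewrite muleC.
  by move=> i _; exact: measure_ge0.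
Qed.

(** Dynkin's pi-lambda argument: it extends independence from finite cylinders, which are all that
    [mutually_independent] speaks of, to every event they generate. *)
Lemma independent_generated (G : set (set Omega)) (E : set Omega) : measurable E ->
  setI_closed G -> (forall A, G A -> measurable A) ->
  (forall A, G A -> (P (A `&` E) = P A * P E)%E) ->
  forall A, <<s G >> A -> measurable A /\ (P (A `&` E) = P A * P E)%E.
Proof.
move=> mE GI Gm GE A; rewrite -(setI_closed_g_dynkin_g_sigma_algebra GI).
move=> /(_ [set A | measurable A /\ (P (A `&` E) = P A * P E)%E]); apply; split.
  exact: independent_dynkin.
by move=> B GB; split; [exact: Gm|exact: GE].
Qed.

Variable a : nat -> nat -> {RV P >-> plane R}.
Hypothesis hindep : mutually_independent
  [set i : nat * nat | (1 <= i.1)%N && (i.2 <= i.1)%N]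
  (fun i : nat * nat => a i.1 i.2).

Variables (n j : nat).
Hypotheses (n1 : (1 <= n)%N) (jn : (j <= n)%N).

Let others := [seq i <- iota 0 n.+1 | i != j].

Let cylinders : set (set Omega) :=
  [set A | exists2 B : nat -> set (plane R), (forall i, measurable (B i)) &
    A = \bigcap_(i in [set` others]) (a n i @^-1` B i)].

Let measurable_cyl (B : nat -> set (plane R)) : (forall i, measurable (B i)) ->
  measurable (\bigcap_(i in [set` others]) (a n i @^-1` B i)).
Proof.
move=> mB; apply: fin_bigcap_measurable; first exact: finite_seq.
by move=> i _; rewrite -[X in measurable X]setTI; exact: measurable_funP.
Qed.

Let cylI : setI_closed cylinders.
Proof.
move=> _ _ [B mB ->] [B' mB' ->]; exists (fun i => B i `&` B' i).
  by move=> i; exact: measurableI.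
by rewrite -bigcapI; apply: eq_bigcapr => i _; rewrite preimage_setI.
Qed.

Let cyl_indep (C : set (plane R)) : measurable C -> forall A, cylinders A ->
  (P (A `&` (a n j @^-1` C)) = P A * P (a n j @^-1` C))%E.
Proof.
move=> mC _ [B mB ->].
(* One family of sets serves two applications of independence, without and with the index [(n, j)];
   comparing the two products isolates the factor of [a n j]. *)
pose B' (i : nat * nat) := if i.2 == j then C else B i.2.
have mB' i : measurable (B' i) by rewrite /B'; case: ifP.
have uo : uniq others by rewrite filter_uniq// iota_uniq.
have jo : j \notin others by rewrite mem_filter eqxx.
pose s := [seq (n, i) | i <- others].
have us : uniq s by rewrite map_inj_uniq// => i i' [].
have hs i : i \in s -> [set i : nat * nat | (1 <= i.1)%N && (i.2 <= i.1)%N] i.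
  move=> /mapP[k + ->]; rewrite mem_filter mem_iota => /andP[_ /andP[_ kn]] /=.
  by rewrite n1 -ltnS.
have ujs : uniq ((n, j) :: s).
  by rewrite /= us andbT; apply/negP => /mapP[k ko [jk]]; rewrite jk ko in jo.
have hjs i : i \in (n, j) :: s -> [set i : nat * nat | (1 <= i.1)%N && (i.2 <= i.1)%N] i.
  by rewrite inE => /predU1P[->|/hs//] /=; rewrite n1 jn.
have E1 := hindep us hs mB'; have E2 := hindep ujs hjs mB'.
have cap : \bigcap_(i in [set` s]) (a i.1 i.2 @^-1` B' i) =
    \bigcap_(i in [set` others]) (a n i @^-1` B i).
  apply/seteqP; split => w /= h i.
    move=> io; have := h (n, i) (map_f _ io); rewrite /B' /=.
    by case: eqP => // ij; rewrite -ij io in jo.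
  move=> /mapP[k ko ->]; rewrite /B' /=; case: eqP => kj; last exact: h.
  by rewrite -kj ko in jo.
have capj : \bigcap_(i in [set` (n, j) :: s]) (a i.1 i.2 @^-1` B' i) =
    \bigcap_(i in [set` others]) (a n i @^-1` B i) `&` (a n j @^-1` C).
  rewrite -cap; apply/seteqP; split => w /=.
    move=> h; split; first by move=> i is_; apply: h; rewrite /= inE is_ orbT.
    by have := h (n, j); rewrite /B' /= eqxx; apply; rewrite inE eqxx.
  move=> [h hj] i /=; rewrite inE => /predU1P[->|/h//].
  by rewrite /B' /= eqxx.
rewrite -capj E2 big_cons -E1 cap muleC; congr (_ * _)%E.
by rewrite /B' /= eqxx.
Qed.

Let sgen_indep (C : set (plane R)) : measurable C -> forall A, <<s cylinders >> A ->
  measurable A /\ (P (A `&` (a n j @^-1` C)) = P A * P (a n j @^-1` C))%E.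
Proof.
move=> mC; apply: independent_generated => //.
- by rewrite -[X in measurable X]setTI; exact: measurable_funP.
- by move=> A [B mB ->]; exact: measurable_cyl.
- exact: cyl_indep.
Qed.

Let cmeas_others i : i \in others ->
  cmeasurable (T := g_sigma_algebraType cylinders) (fun w => toC (a n i w)).
Proof.
move=> io; apply: cmeasurable_toC => _ B mB; rewrite setTI.
apply: sub_sigma_algebra; exists (fun k => if k == i then B else setT).
  by move=> k; case: ifP.
apply/seteqP; split => w /=.
  by move=> h k _; case: eqP => [->|].
by move=> /(_ i io); rewrite eqxx.
Qed.

(** The sum is measurable for the sigma-algebra generated by the cylinders in the other
    coefficients, all of whose events are independent of [a n j]. *)
Lemma independent_partial_sum (c : nat -> R[i]) (A B : set (plane R)) : measurable A -> measurable B ->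
  let S w := ofC (\sum_(i <- others) toC (a n i w) * c i) in
  measurable (S @^-1` A) /\
  (P (S @^-1` A `&` (a n j @^-1` B)) = P (S @^-1` A) * P (a n j @^-1` B))%E.
Proof.
move=> mA mB S; apply: sgen_indep => //.
have [m1 m2] : cmeasurable (T := g_sigma_algebraType cylinders)
    (fun w => \sum_(i <- others) toC (a n i w) * c i).
  rewrite (_ : (fun w => _) = fun w => \sum_(i <- others | i \in others)
      toC (a n i w) * c i); last by apply/funext => w; rewrite -big_seq.
  apply: cmeasurable_sum => i io.
  by apply: cmeasurableM; [exact: cmeas_others|exact: cmeasurable_cst].
have := measurable_fun_pair m1 m2.
by move=> /(_ measurableT A mA); rewrite setTI.
Qed.

Lemma others_sum (c : nat -> R[i]) w :
  \sum_(i < n.+1) toC (a n i w) * c i =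
  (\sum_(i <- others) toC (a n i w) * c i) + toC (a n j w) * c j.
Proof.
rewrite -(big_mkord xpredT (fun i => toC (a n i w) * c i)).
rewrite (bigD1_seq j) ?iota_uniq//=; last first.
  by rewrite mem_index_iota ltnS jn.
by rewrite addrC big_filter /index_iota subn0.
Qed.

End Independence.

Section AntiConcentration.
Variables (R : realType) (d : measure_display) (Omega : measurableType d)
  (P : probability Omega R) (a : nat -> nat -> {RV P >-> plane R}).
Variables (T : R) (law : set (plane R) -> \bar R).
Hypothesis hT : 0 < T.
Hypothesis hlaw : complex_law T law \/ real_law T law.
Hypothesis hdistr : forall n j : nat, (1 <= n)%N -> (j <= n)%N ->
  forall B : set (plane R), measurable B -> distribution P (a n j) B = law B.
Hypothesis hindep : mutually_independent
  [set i : nat * nat | (1 <= i.1)%N && (i.2 <= i.1)%N]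
  (fun i : nat * nat => a i.1 i.2).

Lemma measurable_affine_ball2 (c : R[i]) (r : R) :
  measurable [set x : plane R * plane R | Normc.normc (toC x.1 + toC x.2 * c) <= r].
Proof.
have mf : measurable_fun setT (fun x : plane R * plane R => Normc.normc (toC x.1 + toC x.2 * c)).
  apply: measurable_normc; apply: cmeasurableD.
    by apply: cmeasurable_toC; exact: measurable_fst.
  apply: cmeasurableM; last exact: cmeasurable_cst.
  by apply: cmeasurable_toC; exact: measurable_snd.
have := mf measurableT (`]-oo, r]%classic) (measurable_itv _); rewrite setTI.
by congr measurable; apply/seteqP; split => x /=; rewrite in_itv.
Qed.

(** By independence the joint law of the remaining sum and [a n j] is a product measure. The
    probability is then the average over values [s] of that sum of the law of an affine ball, and
    [law_ball] is uniform in [s]. *)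
Lemma anti_concentration (n j : nat) (c : nat -> R[i]) (r : R) :
  (1 <= n)%N -> (j <= n)%N -> c j != 0 -> 0 <= r ->
  (P [set w | (Normc.normc (\sum_(i < n.+1) toC (a n i w) * c i) <= r)%R] <=
   (T * (2 * (r / Normc.normc (c j)) + 4 * (r / Normc.normc (c j)) ^+ 2))%:E)%E.
Proof.
move=> n1 jn cj0 r0; set bd := (T * _).
pose S w : plane R := ofC (\sum_(i <- [seq i <- iota 0 n.+1 | i != j]) toC (a n i w) * c i).
have jl A B mA mB := @independent_partial_sum R d Omega P a hindep n j n1 jn c A B mA mB.
have mS : measurable_fun setT S.
  by move=> _ A mA; rewrite setTI; exact: (jl A setT mA measurableT).1.
pose SV : {RV P >-> plane R} := mfun_Sub (mem_set mS : S \in mfun).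
have mSa : measurable_fun setT (fun w => (S w, a n j w)).
  by apply: measurable_fun_pair => //; exact: measurable_funP.
pose SaV : {mfun Omega >-> (plane R * plane R)%type} :=
  mfun_Sub (mem_set mSa : (fun w => (S w, a n j w)) \in mfun).
pose D := [set x : plane R * plane R | Normc.normc (toC x.1 + toC x.2 * c j) <= r].
have mD : measurable D by exact: measurable_affine_ball2.
have -> : [set w | Normc.normc (\sum_(i < n.+1) toC (a n i w) * c i) <= r] =
    SaV @^-1` D.
  apply/seteqP; split => w /=; rewrite (others_sum a jn) /S /=;
    by rewrite /toC /ofC /=; case: (\sum_(i <- _) _).
change (distribution P SaV D <= bd%:E)%E.
have H A B : measurable A -> measurable B ->
    distribution P SaV (A `*` B) = (distribution P SV A * distribution P (a n j) B)%E.
  by move=> mA mB; rewrite /distribution /pushforward /=; have [_ <-] := jl A B mA mB.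
have := @product_measure_unique _ _ _ _ _ (distribution P SV) (distribution P (a n j))
  (distribution P SaV) H D mD => <-.
rewrite /product_measure1.
apply: (@le_trans _ _ (\int[distribution P SV]_x bd%:E)%E); last first.
  rewrite integral_cst//= /distribution /pushforward preimage_setT.
  by rewrite probability_setT mule1.
apply: ge0_le_integral => //.
- exact: measurable_fun_xsection.
- move=> s _ /=; rewrite hdistr//; last exact: measurable_xsection.
  have -> : xsection D s = affine_ball (toC s) (c j) r.
    by rewrite xsectionE.
  exact: law_ball.
Qed.

End AntiConcentration.

(** * Size of the Weyl polynomials *)

Section Growth.
Variable R : realType.
Implicit Types (z : R * R) (n j : nat).

Lemma expR1_pow n : expR (n%:R : R) = expR 1 ^+ n.
Proof. by rewrite -expRM_natl mulr1. Qed.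

(** The bounds [(1 + 1/j)^j <= e <= (1 + 1/j)^(j+1)] give, by induction, the elementary Stirling
    estimate [j^j <= e^j j! <= e j j^j]. This first half also holds at [j = 0], where [0^0 = 1]. *)
Lemma succ_pow_le j : j.+1%:R ^+ j <= expR 1 * j%:R ^+ j :> R.
Proof.
case: j => [|j]; first by rewrite !expr0 mulr1 -expR0 ler_expR.
have j0 : 0 < j.+1%:R :> R by rewrite ltr0n.
have -> : j.+2%:R = (1 + j.+1%:R^-1) * j.+1%:R :> R.
  by rewrite mulrDl mul1r mulVf ?gt_eqF// -natr1.
rewrite exprMn ler_wpM2r ?exprn_ge0 ?(ltW j0)//.
have -> : expR 1 = expR (j.+1%:R^-1) ^+ j.+1 :> R.
  by rewrite -expRM_natl divff// gt_eqF.
by rewrite lerXn2r ?nnegrE ?expR_ge0 ?addr_ge0 ?invr_ge0 ?(ltW j0)// expR_ge1Dx.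
Qed.

Lemma pow_le_fact j : j%:R ^+ j <= expR 1 ^+ j * j`!%:R :> R.
Proof.
elim: j => [|j IH]; first by rewrite !expr0 mul1r fact0.
rewrite exprS factS natrM.
apply: (@le_trans _ _ (j.+1%:R * (expR 1 * j%:R ^+ j))).
  by rewrite ler_wpM2l// succ_pow_le.
rewrite exprS (_ : _ * _ * _ = j.+1%:R * (expR 1 * (expR 1 ^+ j * j`!%:R))); last by ring.
by rewrite ler_wpM2l// ler_wpM2l ?expR_ge0.
Qed.

Lemma pow_succ_ge j : (1 <= j)%N -> expR 1 * j%:R ^+ j.+1 <= j.+1%:R ^+ j.+1 :> R.
Proof.
move=> j1; have j0 : 0 < j.+1%:R :> R by rewrite ltr0n.
have h : j%:R ^+ j.+1 <= (expR (- j.+1%:R^-1) * j.+1%:R) ^+ j.+1 :> R.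
  rewrite lerXn2r ?nnegrE// ?mulr_ge0 ?expR_ge0//.
  rewrite -ler_pdivrMr//.
  rewrite (_ : j%:R / j.+1%:R = 1 - j.+1%:R^-1); first exact: expR_ge1Dx.
  by rewrite -natr1; field; rewrite natr1 gt_eqF.
apply: (le_trans (ler_wpM2l (expR_ge0 1) h)).
rewrite exprMn -expRM_natl mulrN divff ?gt_eqF// mulrA -expRD subrr expR0.
by rewrite mul1r.
Qed.

Lemma fact_le_pow j : (1 <= j)%N ->
  expR 1 ^+ j * j`!%:R <= expR 1 * j%:R * j%:R ^+ j :> R.
Proof.
elim: j => // -[_ _|j /(_ isT) IH _].
  by rewrite !expr1 (_ : 1`! = 1%N)// !mulr1.
rewrite exprS factS natrM.
have := pow_succ_ge (j := j.+1) isT.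
set E := expR 1 in IH *; set x := j.+2%:R; set y := j.+1%:R in IH *.
move=> h.
have E0 : 0 <= E by exact: expR_ge0.
have x0 : 0 <= x by rewrite ler0n.
apply: (@le_trans _ _ (E * x * (E * y * y ^+ j.+1))).
  by rewrite mulrACA ler_wpM2l// mulr_ge0.
by rewrite ler_wpM2l ?mulr_ge0// -mulrA -exprS.
Qed.

Lemma pow_fact_le_exp (t : R) j : 0 <= t -> t ^+ j / j`!%:R <= expR t.
Proof.
move=> t0; case: j => [|j].
  by rewrite expr0 fact0 divr1 -expR0 ler_expR.
have j0 : 0 < j.+1%:R :> R by rewrite ltr0n.
have f0 : 0 < j.+1`!%:R :> R by rewrite ltr0n fact_gt0.
rewrite ler_pdivrMr//.
(* From [x <= exp (x - 1)] at [x = t / (j + 1)]; the remaining factor [((j + 1) / e)^(j + 1)] is at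
   most the factorial. *)
have h : t ^+ j.+1 <= (expR (t / j.+1%:R - 1) * j.+1%:R) ^+ j.+1.
  rewrite lerXn2r ?nnegrE ?mulr_ge0 ?expR_ge0//.
  rewrite -ler_pdivrMr//; apply: le_trans (expR_ge1Dx _).
  by rewrite addrC subrK.
apply: (le_trans h); rewrite exprMn -expRM_natl mulrBr mulrCA divff ?gt_eqF// !mulr1.
rewrite expRD expRN expR1_pow -mulrA ler_wpM2l ?expR_ge0//.
by rewrite ler_pdivrMl ?exprn_gt0 ?expR_gt0// pow_le_fact.
Qed.

Definition growth n z : R := expR (n%:R * limit_potential z).

Lemma limit_potential_ge0 z : 0 <= limit_potential z.
Proof.
rewrite /limit_potential mulr_ge0// addr_ge0//.
  by rewrite le_min ler01 andbT addr_ge0 ?sqr_ge0.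
by apply: ln_ge0; rewrite le_max lexx orbT.
Qed.

Lemma sqmod_ge0 z : 0 <= sqmod z.
Proof. by rewrite addr_ge0 ?sqr_ge0. Qed.

Lemma growth_sqr n z : growth n z ^+ 2 =
  if sqmod z <= 1 then expR (n%:R * sqmod z) else expR 1 ^+ n * sqmod z ^+ n.
Proof.
rewrite /growth -expRM_natl /limit_potential.
have -> : 2%:R * (n%:R * (2^-1 * (Num.min (sqmod z) 1 + ln (Num.max (sqmod z) 1)))) =
    n%:R * (Num.min (sqmod z) 1 + ln (Num.max (sqmod z) 1)) :> R by field.
case: leP => [s1|/ltW s1]; first by rewrite ln1 addr0.
have s0 : 0 < sqmod z by exact: lt_le_trans s1.
by rewrite mulrDr expRD mulr1 expR1_pow expRM_natl lnK// posrE.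
Qed.

Lemma coef_le_growth n j z : (j <= n)%N ->
  (n%:R * sqmod z) ^+ j / j`!%:R <= growth n z ^+ 2.
Proof.
move=> jn; rewrite growth_sqr; have s0 := sqmod_ge0 z.
case: ifPn => [_|]; first by apply: pow_fact_le_exp; rewrite mulr_ge0.
rewrite -ltNge => /ltW s1; rewrite exprMn mulrAC.
rewrite -expR1_pow ler_pM//.
- by rewrite exprn_ge0.
- exact: pow_fact_le_exp.
- by rewrite ler_weXn2l.
Qed.

(** The terms [t^j / j!], with [t = n |z|^2], increase as long as [j <= t]. In the disk the peak
    index [floor t] is at most [n]; outside it the last index [j = n] is used. The factor [e^2 n]
    comes from Stirling's estimate and from rounding [t]. *)
Lemma coef_ge_growth n z : (1 <= n)%N -> exists2 j, (j <= n)%N &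
  growth n z ^+ 2 <= expR 1 ^+ 2 * n%:R * ((n%:R * sqmod z) ^+ j / j`!%:R).
Proof.
move=> n1; have s0 := sqmod_ge0 z.
have n0 : 0 < n%:R :> R by rewrite ltr0n.
have n1' : 1 <= n%:R :> R by rewrite ler1n.
have E0 : 0 < expR 1 :> R by exact: expR_gt0.
have E1 : 1 <= expR 1 :> R by rewrite -expR0 ler_expR.
have f0 k : 0 < k`!%:R :> R by rewrite ltr0n fact_gt0.
rewrite growth_sqr; case: ifPn => [s1|].
  set t := n%:R * sqmod z.
  have t0 : 0 <= t by rewrite mulr_ge0.
  have tn : t <= n%:R by rewrite ler_piMr.
  pose j := Num.truncn t; have /andP[jt tj] := truncn_itv t0.
  have jn : (j <= n)%N by rewrite -(ler_nat R) (le_trans jt).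
  exists j => //; case: (posnP j) => [j0|j1].
    (* Here [t < 1]: the constant term [1] is used, and [exp t <= e]. *)
    rewrite /j in j0 *; rewrite j0 in tj *; rewrite expr0 fact0 divr1 mulr1.
    apply: (@le_trans _ _ (expR 1)); first by rewrite ler_expR ltW.
    rewrite expr2 -mulrA ler_peMr ?(ltW E0)//.
    by apply: (le_trans E1); rewrite ler_peMr ?(ltW E0).
  have := fact_le_pow j1 => F.
  have jR0 : 0 < j%:R :> R by rewrite ltr0n.
  apply: (@le_trans _ _ (expR 1 * expR 1 ^+ j)).
    by rewrite -exprS -expR1_pow ler_expR ltW.
  rewrite mulrA ler_pdivlMr// -mulrA (expr2 (expR 1)) -!mulrA ler_wpM2l ?(ltW E0)//.
  apply: (le_trans F); rewrite -mulrA ler_wpM2l ?(ltW E0)//.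
  apply: ler_pM => //; first by rewrite ler_nat.
  by rewrite lerXn2r ?nnegrE ?(ltW jR0).
rewrite -ltNge => /ltW s1; exists n => //.
have F := fact_le_pow n1.
rewrite mulrA ler_pdivlMr// exprMn.
have sn : 0 <= sqmod z ^+ n by rewrite exprn_ge0.
rewrite mulrAC [leRHS]mulrA ler_wpM2r//.
apply: (le_trans F); rewrite ler_wpM2r ?exprn_ge0 ?ler_wpM2r ?(ltW n0)//.
by rewrite expr2 ler_peMr ?(ltW E0).
Qed.

Definition weyl_coef n j z : R[i] :=
  (Num.sqrt (n%:R ^+ j : R) / Num.sqrt (j`!%:R : R))%:C%C * toC z ^+ j.

Lemma horner_scaled_weyl n (c : nat -> R[i]) z :
  (scaled_weyl n c).[toC z] = \sum_(j < n.+1) c j * weyl_coef n j z.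
Proof.
by rewrite /scaled_weyl horner_poly; apply: eq_bigr => j _; rewrite /weyl_coef mulrA.
Qed.

Lemma normcX (c : R[i]) j : Normc.normc (c ^+ j) = Normc.normc c ^+ j.
Proof.
elim: j => [|j IH]; first by rewrite !expr0 Normc.normc1.
by rewrite !exprS Normc.normcM IH.
Qed.

Lemma normc_real (x : R) : 0 <= x -> Normc.normc (x%:C%C) = x.
Proof. by move=> x0 /=; rewrite expr0n /= addr0 sqrtr_sqr ger0_norm. Qed.

Lemma sqr_normc_toC z : Normc.normc (toC z) ^+ 2 = sqmod z.
Proof. by rewrite /= sqr_sqrtr// addr_ge0 ?sqr_ge0. Qed.

Lemma sqr_normc_weyl_coef n j z :
  Normc.normc (weyl_coef n j z) ^+ 2 = (n%:R * sqmod z) ^+ j / j`!%:R.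
Proof.
have f0 : 0 < j`!%:R :> R by rewrite ltr0n fact_gt0.
rewrite /weyl_coef Normc.normcM normcX normc_real ?divr_ge0 ?sqrtr_ge0//.
rewrite exprMn exprAC sqr_normc_toC expr_div_n !sqr_sqrtr ?exprn_ge0 ?(ltW f0)//.
by rewrite exprMn; field; rewrite gt_eqF.
Qed.

Lemma normc_ge0 (c : R[i]) : 0 <= Normc.normc c.
Proof. by case: c => x y; exact: sqrtr_ge0. Qed.

Lemma normc_weyl_coef_le n j z : (j <= n)%N -> Normc.normc (weyl_coef n j z) <= growth n z.
Proof.
move=> jn; rewrite -(@ler_pXn2r _ 2)// ?nnegrE ?expR_ge0 ?normc_ge0//.
by rewrite sqr_normc_weyl_coef coef_le_growth.
Qed.

Lemma normc_weyl_coef_ge n z : (1 <= n)%N -> exists2 j, (j <= n)%N &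
  growth n z ^+ 2 <= expR 1 ^+ 2 * n%:R * Normc.normc (weyl_coef n j z) ^+ 2.
Proof.
by move=> n1; have [j jn h] := coef_ge_growth z n1; exists j; rewrite ?sqr_normc_weyl_coef.
Qed.

Lemma normc_triangle (x y : R[i]) : Normc.normc (x + y) <= Normc.normc x + Normc.normc y.
Proof. by rewrite -lecR rmorphD; exact: (ler_normD x y). Qed.

Lemma normc_weyl_le n (c : nat -> R[i]) z A :
  (forall j, (j <= n)%N -> Normc.normc (c j) <= A) ->
  Normc.normc (scaled_weyl n c).[toC z] <= n.+1%:R * A * growth n z.
Proof.
move=> cA; rewrite horner_scaled_weyl.
apply: (@le_trans _ _ (\sum_(j < n.+1) Normc.normc (c j * weyl_coef n j z))).
  elim/big_rec2: _ => [|j x y _ h]; first by rewrite Normc.normc0.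
  by apply: le_trans (normc_triangle _ _) _; rewrite lerD2l.
apply: (@le_trans _ _ (\sum_(j < n.+1) A * growth n z)).
  apply: ler_sum => j _; rewrite Normc.normcM ler_pM ?normc_ge0 ?cA//.
    by rewrite -ltnS.
  by rewrite normc_weyl_coef_le// -ltnS.
by rewrite sumr_const card_ord -[leLHS]mulr_natl mulrA.
Qed.

(* With [rho = exp (n (phi - tau)) / |c_j|] for the largest coefficient [c_j],
   both [rho] and [rho ^ 2] are at most a multiple of [n exp (- n tau)]. *)
Lemma small_ratio n j z (tau : R) : (1 <= n)%N -> 0 <= tau ->
  growth n z ^+ 2 <= expR 1 ^+ 2 * n%:R * Normc.normc (weyl_coef n j z) ^+ 2 ->
  let rho := expR (n%:R * (limit_potential z - tau)) / Normc.normc (weyl_coef n j z) in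
  weyl_coef n j z != 0 /\
  2 * rho + 4 * rho ^+ 2 <= (2 * expR 1 + 4 * expR 1 ^+ 2) * (n%:R * expR (- (n%:R * tau))).
Proof.
move=> n1 tau0; set c := weyl_coef n j z => h rho.
have n0 : 0 < n%:R :> R by rewrite ltr0n.
have n1' : 1 <= n%:R :> R by rewrite ler1n.
have g0 : 0 < growth n z by exact: expR_gt0.
have c0 : c != 0.
  apply/eqP => c0; move: h; rewrite c0 Normc.normc0 expr0n /= mulr0.
  by rewrite leNgt exprn_gt0.
split=> //.
have nc0 := normc_gt0 c0.
set x := expR (- (n%:R * tau)).
have x0 : 0 < x by exact: expR_gt0.
have x1 : x <= 1 by rewrite -expR0 ler_expR oppr_le0 mulr_ge0// ltW.
have rhoE : rho = growth n z * x / Normc.normc c.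
  by rewrite /rho mulrBr expRD.
have E0 : 0 < expR 1 :> R by exact: expR_gt0.
have r0 : 0 <= rho by rewrite rhoE divr_ge0 ?normc_ge0// mulr_ge0// ltW.
have r2 : rho ^+ 2 <= expR 1 ^+ 2 * n%:R * x ^+ 2.
  rewrite rhoE expr_div_n exprMn ler_pdivrMr ?exprn_gt0// [leRHS]mulrAC.
  by rewrite ler_wpM2r// sqr_ge0.
have r1 : rho <= expR 1 * (n%:R * x).
  rewrite -(@ler_pXn2r _ 2)// ?nnegrE ?mulr_ge0 ?(ltW E0) ?(ltW n0) ?(ltW x0)//.
  apply: (le_trans r2); rewrite !exprMn mulrA ler_wpM2r ?sqr_ge0// ler_wpM2l ?sqr_ge0//.
  by rewrite expr2 ler_peMr// ltW.
have r2' : rho ^+ 2 <= expR 1 ^+ 2 * (n%:R * x).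
  apply: (le_trans r2); rewrite mulrA ler_wpM2l ?mulr_ge0 ?sqr_ge0 ?(ltW n0)//.
  by rewrite expr2 ler_piMr// ltW.
by rewrite [leRHS]mulrDl; apply: lerD; rewrite -[leRHS]mulrA ler_wpM2l.
Qed.

Lemma log_poly_le n (c : nat -> R[i]) z (e : R) : (1 <= n)%N -> 0 < e ->
  n.+1%:R <= expR (n%:R * e) ->
  (forall j, (j <= n)%N -> Normc.normc (c j) <= expR (n%:R * e)) ->
  n%:R^-1 * ln (Normc.normc (scaled_weyl n c).[toC z]) - limit_potential z <= 2 * e.
Proof.
move=> n1 e0 ne cA; have n0 : 0 < n%:R :> R by rewrite ltr0n.
have h := normc_weyl_le z cA; set u := Normc.normc _ in h *.
have p0 := limit_potential_ge0 z.
(* At a zero the convention [ln 0 = 0] leaves [- limit_potential z], which is nonpositive. *)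
have [u0|u0] := eqVneq u 0.
  by rewrite u0 ln0// mulr0 sub0r; lra.
have up : 0 < u by rewrite lt_neqAle eq_sym u0 normc_ge0.
have : ln u <= n%:R * (2 * e + limit_potential z).
  rewrite -[leRHS]expRK ler_ln ?posrE ?expR_gt0//.
  apply: (le_trans h); rewrite mulrDr expRD ler_wpM2r ?expR_ge0//.
  rewrite (_ : n%:R * (2 * e) = n%:R * e + n%:R * e); last by ring.
  by rewrite expRD ler_wpM2r ?expR_ge0.
by rewrite -ler_pdivrMl// lerBlDr.
Qed.

(** A layer-cake count: every [k] with [(k + 1) e <= - X] belongs to the set, so [- X] exceeds [e]
    times the count by at most [e]. At a zero of the polynomial every [k] is counted and the
    right-hand side is infinite. *)
Lemma log_poly_ge n (c : nat -> R[i]) z (e : R) : (1 <= n)%N -> 0 < e ->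
  let X := n%:R^-1 * ln (Normc.normc (scaled_weyl n c).[toC z]) - limit_potential z in
  X <= 2 * e ->
  (`|X|%:E <= (3 * e)%:E + e%:E * \sum_(0 <= k <oo)
    (\1_[set k : nat | (Normc.normc (scaled_weyl n c).[toC z] <=
      expR (n%:R * (limit_potential z - k.+1%:R * e)))%R] k)%:E)%E.
Proof.
move=> n1 e0 X X2; have n0 : 0 < n%:R :> R by rewrite ltr0n.
set A := [set k | _]; set S := (\sum_(0 <= k <oo) _)%E.
have S0 : (0 <= S)%E by apply: nneseries_ge0 => k _ _; rewrite lee_fin.
have [X0|X0] := leP (- X) e.
  apply: (@le_trans _ _ (3 * e)%:E).
    by rewrite lee_fin ler_norml; apply/andP; split; lra.
  by rewrite leeDl// mule_ge0// lee_fin ltW.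
have Xe0 : 0 <= - X / e by rewrite divr_ge0 ?(ltW e0)//; lra.
pose N := Num.truncn (- X / e); have /andP[h1 h2] := truncn_itv Xe0.
have SN : (N%:R%:E <= S)%E.
  apply: (@le_trans _ _ (\sum_(0 <= k < N) (\1_A k)%:E)%E); last first.
    by apply: nneseries_lim_ge => k _ _; rewrite lee_fin.
  rewrite sumEFin lee_fin (@eq_big_nat _ _ _ _ _ _ (fun=> 1)).
    by rewrite sumr_const_nat subn0.
  move=> k /andP[_ kN]; rewrite indicE mem_set//= /A /=.
  have kX : k.+1%:R * e <= - X.
    by rewrite -ler_pdivlMr// (le_trans _ h1)// ler_nat.
  pose u := Normc.normc (scaled_weyl n c).[toC z]; rewrite -/u.
  have [->|u0] := eqVneq u 0; first exact: expR_ge0.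
  have up : 0 < u by rewrite lt_neqAle eq_sym u0 normc_ge0.
  rewrite -(lnK (x := u)) ?posrE// ler_expR -ler_pdivrMl//.
  rewrite /X -/u in kX; lra.
have NX : - X <= e * N%:R + e.
  by move: h2; rewrite -natr1 ltr_pdivrMr// => h2; rewrite mulrC; lra.
apply: (@le_trans _ _ ((3 * e)%:E + e%:E * N%:R%:E)%E).
  rewrite -EFinM -EFinD lee_fin ltr0_norm; last by lra.
  by lra.
by rewrite leeD2l// lee_pmul2l// lte_fin.
Qed.

End Growth.

(** * Almost sure convergence of the potentials *)

Section PlaneMeasure.
Variable R : realType.
(* [dm2 R] again, as a function for which the sigma-finite structure can be
   inferred: on [\x] the library only infers it for subprobabilities. *)
Definition plane_measure : set (plane R) -> \bar R := (@lebesgue_measure R \x @lebesgue_measure R)%E.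
HB.instance Definition _ := Measure.on plane_measure.
Lemma plane_measure_sigma_finite : sigma_finite setT plane_measure.
Proof.
exists (fun n : nat => rect (- n%:R) n%:R (- n%:R) n%:R).
  rewrite predeqE => -[x y]; split => // _.
  exists (Num.truncn (Num.max `|x| `|y|)).+1 => //.
  have /ltW := truncnS_gt (Num.max `|x| `|y|); rewrite ge_max => /andP[hx hy].
  by split; rewrite /= in_itv /= -ler_norml.
by move=> n; split; [exact: measurable_rect|exact: dm2_rect_lty].
Qed.
HB.instance Definition _ := Measure_isSigmaFinite.Build _ _ _ plane_measure plane_measure_sigma_finite.
End PlaneMeasure.

(** * Almost sure convergence from geometrically decaying expectations *)

Section GeometricDecay.
Variables (R : realType) (d : measure_display) (Omega : measurableType d)
  (P : probability Omega R).

Lemma geometric_sum_le (q : R) N : 0 <= q < 1 ->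
  \sum_(0 <= n < N) q ^+ n <= (1 - q)^-1.
Proof.
move=> /andP[q0 q1]; have p0 : 0 < 1 - q by rewrite subr_gt0.
rewrite -[leRHS]mul1r ler_pdivlMr//.
have -> : (\sum_(0 <= n < N) q ^+ n) * (1 - q) = 1 - q ^+ N.
  elim: N => [|N IH]; first by rewrite big_geq// mul0r expr0 subrr.
  by rewrite big_nat_recr//= mulrDl IH exprSr; ring.
by rewrite lerBlDr lerDl exprn_ge0.
Qed.

Lemma nneseries_geometric_le (f : nat -> \bar R) (K q : R) : 0 <= K -> 0 <= q < 1 ->
  (forall n, 0 <= f n)%E -> (forall n, f n <= (K * q ^+ n)%:E)%E ->
  (\sum_(0 <= n <oo) f n <= (K / (1 - q))%:E)%E.
Proof.
move=> K0 q01 f0 fle; apply: lime_le.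
  by apply: is_cvg_nneseries => n _ _.
near=> N; apply: (@le_trans _ _ (\sum_(0 <= n < N) (K * q ^+ n)%:E)%E).
  by apply: lee_sum => n _.
by rewrite sumEFin lee_fin -mulr_sumr ler_wpM2l// geometric_sum_le.
Unshelve. all: end_near. Qed.

(** The sum of the [Y n] has finite expectation, so it is almost surely finite and its terms tend to
    [0]. *)
Lemma ae_cvg0_geometric (Y : nat -> Omega -> \bar R) (K q : R) :
  0 <= K -> 0 <= q < 1 ->
  (forall n, measurable_fun setT (Y n)) -> (forall n w, 0 <= Y n w)%E ->
  (forall n, \int[P]_w Y n w <= (K * q ^+ n)%:E)%E ->
  {ae P, forall w, Y n w @[n --> \oo] --> 0%E}.
Proof.
move=> K0 q01 mY Y0 IY.
pose S w := (\sum_(0 <= n <oo) Y n w)%E.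
have S0 w : (0 <= S w)%E by apply: nneseries_ge0 => n _ _.
have mS : measurable_fun setT S by apply: ge0_emeasurable_sum.
have IS : (\int[P]_w S w <= (K / (1 - q))%:E)%E.
  rewrite integral_nneseries//; apply: nneseries_geometric_le => // n.
  exact: integral_ge0.
have iS : P.-integrable setT S.
  apply/integrableP; split => //.
  under eq_integral do rewrite gee0_abs//.
  by rewrite (le_lt_trans IS)// ltry.
have := integrable_ae measurableT iS; apply: filterS => w /(_ I) fS.
have Soo : (\sum_(0 <= n <oo) Y n w < +oo)%E by rewrite ltey_eq fS.
have tail := nneseries_tail_cvg Soo (fun n _ => Y0 n w).
apply: (@squeeze_cvge _ _ _ _ (fun=> 0%E) _ (fun N => (\sum_(N <= k <oo) Y k w)%E)) => //.
- near=> N; rewrite Y0 /=.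
  have := @nneseries_lim_ge R (fun k => Y k w) xpredT N N.+1 (fun n _ _ => Y0 n w).
  by rewrite big_nat1.
- exact: cvg_cst.
Unshelve. all: end_near. Qed.

(** Applied to indicators: a sequence of zeros and ones that tends to [0] is eventually [0]. *)
Lemma borel_cantelli_geometric (A : nat -> set Omega) (K q : R) :
  0 <= K -> 0 <= q < 1 -> (forall n, measurable (A n)) ->
  (forall n, P (A n) <= (K * q ^+ n)%:E)%E ->
  {ae P, forall w, \forall n \near \oo, ~ A n w}.
Proof.
move=> K0 q01 mA PA.
have := @ae_cvg0_geometric (fun n w => (\1_(A n) w : R)%:E) K q K0 q01.
have h1 n : measurable_fun setT (fun w => (\1_(A n) w : R)%:E).
  by apply/measurable_EFinP; exact: measurable_indic.
have h2 n w : (0 <= (\1_(A n) w : R)%:E)%E by rewrite lee_fin.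
have h3 n : (\int[P]_w (\1_(A n) w : R)%:E <= (K * q ^+ n)%:E)%E.
  by rewrite integral_indic// setIT; exact: PA.
move=> /(_ h1 h2 h3); apply: filterS => w /fine_cvgP[_ /cvgrPdist_lt /(_ 1 ltr01)].
apply: filterS => n /=; rewrite indicE sub0r normrN.
by case: (boolP (w \in A n)) => [_|/negP h _ /mem_set//]; rewrite normr1 ltxx.
Qed.

End GeometricDecay.

Section AlmostSure.
Variables (R : realType) (d : measure_display) (Omega : measurableType d)
  (P : probability Omega R) (a : nat -> nat -> {RV P >-> plane R})
  (T : R) (law : set (plane R) -> \bar R).
Local Notation m2 := (dm2 R).
Local Notation mu := (@lebesgue_measure R).
Hypothesis hT : 0 < T.
Hypothesis hlaw : complex_law T law \/ real_law T law.
Hypothesis hdistr : forall n j : nat, (1 <= n)%N -> (j <= n)%N ->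
  forall B : set (plane R), measurable B -> distribution P (a n j) B = law B.
Hypothesis hindep : mutually_independent
  [set i : nat * nat | (1 <= i.1)%N && (i.2 <= i.1)%N]
  (fun i : nat * nat => a i.1 i.2).

Lemma mul_le_expR (t : R) n : 0 < t -> n%:R <= t^-1 * expR (n%:R * t).
Proof.
move=> t0; rewrite ler_pdivlMl// mulrC.
by apply: le_trans (expR_ge1Dx _); rewrite lerDr.
Qed.

Lemma expR_decay (e : R) : 0 < e -> 0 <= expR (- e) < 1.
Proof. by move=> e0; rewrite expR_ge0 /= expR_lt1 oppr_lt0. Qed.

Lemma measurable_modulus_ge (r : R) : measurable [set x : plane R | r <= modulus x].
Proof.
have mf : measurable_fun setT (fun a : plane R => modulus a).
  by apply: measurable_normc; exact: cmeasurable_toC.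
have := mf measurableT (`[r, +oo[%classic) (measurable_itv _); rewrite setTI.
by congr measurable; apply/seteqP; split => x /=; rewrite in_itv /= andbT.
Qed.

Lemma ae_modulus_le (e : R) : 0 < e ->
  {ae P, forall w, \forall n \near \oo,
     forall j, (j <= n)%N -> modulus (a n j w) <= expR (n%:R * e)}.
Proof.
move=> e0.
pose A n := \big[setU/set0]_(j < n.+1) [set w | expR (n%:R * e) <= modulus (a n j w)].
have mA1 n j : measurable [set w | expR (n%:R * e) <= modulus (a n j w)].
  have ma : measurable_fun setT (a n j) by [].
  by have := ma measurableT _ (measurable_modulus_ge (expR (n%:R * e))); rewrite setTI.
have mA n : measurable (A n) by apply: bigsetU_measurable => j _.
have [r0 [_ Hr0]] := law_tail hlaw.
pose N := (Num.truncn (`|r0| / e)).+1.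
have big n : (N <= n)%N -> r0 < expR (n%:R * e).
  move=> Nn; apply: (le_lt_trans (ler_norm _)).
  apply: lt_le_trans (expR_ge1Dx _).
  rewrite (@lt_trans _ _ (n%:R * e)) ?ltrDr//.
  rewrite -ltr_pdivrMr//; apply: (lt_le_trans (truncnS_gt _)).
  by rewrite ler_nat.
(* The union bound gives [(n + 1) T exp (- 2 n e)], and [n + 1 <= (1 + e^-1) exp (n e)] absorbs the
   first factor. The second summand makes the bound at least [1] for [n < N], before the tail
   estimate applies. *)
pose K := T * (1 + e^-1) + expR (N%:R * e).
have K1 : 0 <= T * (1 + e^-1).
  by rewrite mulr_ge0 ?(ltW hT)// addr_ge0// invr_ge0 ltW.
have K0 : 0 <= K by rewrite addr_ge0 ?expR_ge0.
have PA n : (P (A n) <= (K * expR (- e) ^+ n)%:E)%E.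
  rewrite -expRM_natl mulrN /K mulrDl.
  have t1 : 0 <= expR (N%:R * e) * expR (- (n%:R * e)) by rewrite mulr_ge0 ?expR_ge0.
  have t2 : 0 <= T * (1 + e^-1) * expR (- (n%:R * e)) by rewrite mulr_ge0 ?expR_ge0.
  case: (ltnP n N) => nN.
    apply: (le_trans (probability_le1 _ (mA n))).
    rewrite lee_fin (@le_trans _ _ (expR (N%:R * e) * expR (- (n%:R * e))))//; last by rewrite lerDr.
    rewrite -expRD -mulrBl -[leLHS]expR0 ler_expR mulr_ge0 ?(ltW e0)//.
    by rewrite subr_ge0 ler_nat ltnW.
  apply: (@le_trans _ _ (T * (1 + e^-1) * expR (- (n%:R * e)))%:E); last first.
    by rewrite lee_fin lerDl.
  apply: (le_trans (le_mu_bigsetU _ (fun j _ => mA1 n j))).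
  apply: (@le_trans _ _ (\sum_(j < n.+1) (T / expR (n%:R * e) ^+ 2)%:E)%E).
    apply: lee_sum => j _.
    have := hdistr (leq_trans (ltn0Sn _) nN) (ltn_ord j : (j <= n)%N)
      (measurable_modulus_ge (expR (n%:R * e))).
    rewrite /distribution /pushforward /preimage /= => ->.
    by apply: Hr0; exact: big.
  rewrite sumEFin lee_fin sumr_const card_ord -[leLHS]mulr_natl.
  set E := expR (n%:R * e); have E0 : 0 < E by exact: expR_gt0.
  have nE : n.+1%:R <= (1 + e^-1) * E.
    rewrite -natr1 addrC mulrDl lerD ?mul_le_expR//.
    by rewrite mul1r -expR0 ler_expR mulr_ge0// ltW.
  rewrite expRN -/E expr2 invfM mulrCA -mulrA ler_wpM2l ?(ltW hT)//.
  by rewrite mulrA ler_wpM2r ?invr_ge0 ?(ltW E0)// ler_pdivrMr.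
have := borel_cantelli_geometric K0 (expR_decay e0) mA PA.
apply: filterS => w; apply: filterS => n nA j jn.
rewrite leNgt; apply/negP => lt; apply: nA.
rewrite /A -(bigcup_mkord n.+1 (fun j => [set w | expR (n%:R * e) <= modulus (a n j w)])).
by exists j => //=; exact: ltW.
Qed.

(* By [log_poly_ge] the error at [z] is at most [3 e] plus [e] times the number
   of [k] with [z] in this set. *)
Definition log_deficit (c : nat -> R[i]) (n k : nat) (e : R) : set (plane R) :=
  [set z | rect (-3) 3 (-3) 3 z /\ Normc.normc (scaled_weyl n c).[toC z] <=
     expR (n%:R * (limit_potential z - k.+1%:R * e))].

Lemma measurable_joint_deficit n k (e : R) : measurable
  [set wz : Omega * plane R | log_deficit (fun j => toC (a n j wz.1)) n k e wz.2].
Proof.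
have mr : measurable [set wz : Omega * plane R | rect (-3) 3 (-3) 3 wz.2].
  have ms : measurable_fun setT (snd : Omega * plane R -> plane R) by exact: measurable_snd.
  by have := ms measurableT _ (measurable_rect (-3) 3 (-3) 3); rewrite setTI.
have mphi : measurable_fun setT (fun wz : Omega * plane R => limit_potential wz.2).
  apply: measurableT_comp; last exact: measurable_snd.
  by apply: continuous_measurable_plane; exact: cont_limit_potential.
have mp : measurable_fun setT (fun wz : Omega * plane R =>
    Normc.normc (scaled_weyl n (fun j => toC (a n j wz.1))).[toC wz.2]).
  under eq_fun do rewrite horner_scaled_weyl.
  apply: measurable_normc; apply: cmeasurable_sum => j _; apply: cmeasurableM.
    by apply: cmeasurable_toC; apply: measurableT_comp => //; exact: measurable_fst.
  apply: cmeasurableM; first exact: cmeasurable_cst.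
  by apply: cmeasurableX; apply: cmeasurable_toC; exact: measurable_snd.
have me : measurable_fun setT (fun wz : Omega * plane R =>
    expR (n%:R * (limit_potential wz.2 - k.+1%:R * e))).
  apply: measurableT_comp => //; apply: measurable_funM => //.
  by apply: measurable_funB.
apply: measurableI => //.
have := measurable_funB mp me measurableT (measurable_itv `]-oo, 0]); rewrite setTI.
by congr measurable; apply/seteqP; split => wz /=; rewrite in_itv /= subr_le0.
Qed.

Lemma pointwise_deficit_le n k (e : R) (z : plane R) : (1 <= n)%N -> 0 < e ->
  (P [set w | (Normc.normc (scaled_weyl n (fun j => toC (a n j w))).[toC z] <=
      expR (n%:R * (limit_potential z - k.+1%:R * e)))%R] <=
   (T * (2 * expR 1 + 4 * expR 1 ^+ 2) * (n%:R * expR (- (n%:R * (k.+1%:R * e)))))%:E)%E.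
Proof.
move=> n1 e0; have [j jn hj] := normc_weyl_coef_ge z n1.
have ke0 : 0 <= k.+1%:R * e by rewrite mulr_ge0// ltW.
have [c0 hr] := small_ratio n1 ke0 hj.
under eq_set do rewrite horner_scaled_weyl.
apply: le_trans.
  exact: (anti_concentration hT hlaw hdistr hindep (c := fun j => weyl_coef n j z)
    n1 jn c0 (expR_ge0 _)).
by rewrite lee_fin -mulrA ler_wpM2l// ltW.
Qed.

Lemma measurable_log_deficit n k (e : R) w :
  measurable (log_deficit (fun j => toC (a n j w)) n k e).
Proof.
have := measurable_xsection w (measurable_joint_deficit n k e).
by congr measurable; apply/seteqP; split => z; rewrite xsectionP.
Qed.

Lemma measurable_fun_log_deficit n k (e : R) :
  measurable_fun setT (fun w => m2 (log_deficit (fun j => toC (a n j w)) n k e)).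
Proof.
have := @measurable_fun_xsection _ _ _ _ R (@plane_measure R) _ (measurable_joint_deficit n k e).
congr measurable_fun; apply/funext => w /=; congr (_ _).
by apply/seteqP; split => z; rewrite xsectionP.
Qed.

(** After exchanging the integrals, the bound at a fixed point is uniform over the square, whose
    area is [36]. *)
Lemma expected_deficit_le n k (e : R) : (1 <= n)%N -> 0 < e ->
  (\int[P]_w m2 (log_deficit (fun j => toC (a n j w)) n k e) <=
   (T * (2 * expR 1 + 4 * expR 1 ^+ 2) * (n%:R * expR (- (n%:R * (k.+1%:R * e)))) * 36)%:E)%E.
Proof.
move=> n1 e0; set C := (X in (X * 36)%:E).
have C0 : 0 <= C.
  by rewrite /C !mulr_ge0 ?addr_ge0 ?mulr_ge0 ?sqr_ge0 ?expR_ge0 ?(ltW hT).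
have mB := measurable_joint_deficit n k e; set B := [set _ | _] in mB.
have := indic_fubini_tonelli P (@plane_measure R) mB.
rewrite indic_fubini_tonelli_FE// indic_fubini_tonelli_GE//= => E.
have -> : (\int[P]_w m2 (log_deficit (fun j => toC (a n j w)) n k e) =
    \int[m2]_z (P (ysection B z)))%E.
  rewrite -[RHS]E; apply: eq_integral => w _; congr (_ _).
  by apply/seteqP; split => z; rewrite xsectionP.
apply: (@le_trans _ _ (\int[m2]_z (C%:E * (\1_(rect (-3) 3 (-3) 3) z)%:E))%E).
  apply: ge0_le_integral => //.
  - have := @measurable_fun_ysection _ _ _ _ R P _ mB.
    by [].
  - apply: emeasurable_funM => //; apply/measurable_EFinP.
    by apply: measurable_indic; exact: measurable_rect.
  - move=> z _; rewrite -EFinM indicE; case: (boolP (z \in rect _ _ _ _)) => zr.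
      rewrite mulr1; apply: le_trans (pointwise_deficit_le k z n1 e0).
      apply: le_measure; rewrite ?inE.
      + exact: measurable_ysection.
      + have mp : measurable_fun setT (fun w =>
            Normc.normc (scaled_weyl n (fun j => toC (a n j w))).[toC z]).
          under eq_fun do rewrite horner_scaled_weyl.
          apply: measurable_normc; apply: cmeasurable_sum => j _; apply: cmeasurableM.
            exact: cmeasurable_toC.
          exact: cmeasurable_cst.
        have := mp measurableT (`]-oo, expR (n%:R * (limit_potential z - k.+1%:R * e))]%classic)
          (measurable_itv _); rewrite setTI.
        by congr measurable; apply/seteqP; split => w /=; rewrite in_itv.
      + by move=> w; rewrite ysectionP => -[].
    rewrite mulr0 (_ : ysection B z = set0) ?measure0//.
    rewrite -subset0 => w; rewrite ysectionP => -[zr' _].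
    by move: zr; rewrite mem_set.
rewrite ge0_integralZl_EFin//; last first.
  by apply/measurable_EFinP; apply: measurable_indic; exact: measurable_rect.
rewrite integral_indic//; last exact: measurable_rect.
rewrite setIT dm2_rect; [|by lra|by lra].
by rewrite -EFinM lee_fin; lra.
Qed.

Definition total_deficit (e : R) n w : \bar R :=
  (\sum_(0 <= k <oo) m2 (log_deficit (fun j => toC (a n j w)) n k e))%E.

Lemma ae_deficit_cvg0 (e : R) : 0 < e ->
  {ae P, forall w, total_deficit e n.+1 w @[n --> \oo] --> 0%E}.
Proof.
move=> e0.
(* The factor [n + 1] is absorbed into [(e / 2)^-1 exp ((n + 1) e / 2)]. The exponent left,
   [- (n + 1) (k + 1/2) e], is at most [- n e / 2 - k e]: geometric decay in [n] with ratio [q] and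
   in [k] with ratio [r]. *)
pose q := expR (- (e / 2)); pose r := expR (- e).
have e20 : 0 < e / 2 by rewrite divr_gt0.
have q01 : 0 <= q < 1 by exact: expR_decay.
have r01 : 0 <= r < 1 by exact: expR_decay.
pose C := T * (2 * expR 1 + 4 * expR 1 ^+ 2) * (e / 2)^-1 * 36.
have C1 : 0 <= T * (2 * expR 1 + 4 * expR 1 ^+ 2).
  by rewrite mulr_ge0 ?(ltW hT)// addr_ge0// mulr_ge0 ?expR_ge0// sqr_ge0.
have C0 : 0 <= C.
  by rewrite /C mulr_ge0// mulr_ge0// invr_ge0 ltW.
have r1 : 0 < 1 - r by case/andP: r01 => _; rewrite subr_gt0.
apply: (@ae_cvg0_geometric _ _ _ P _ (C / (1 - r)) q) => //.
- by rewrite divr_ge0// ltW.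
- move=> n; apply: ge0_emeasurable_sum => k *; first exact: measure_ge0.
  exact: measurable_fun_log_deficit.
- by move=> n w; apply: nneseries_ge0 => k _ _; exact: measure_ge0.
move=> n; rewrite integral_nneseries//; last first.
  by move=> k; exact: measurable_fun_log_deficit.
have q0 : 0 <= q by exact: expR_ge0.
apply: (@le_trans _ _ (C * q ^+ n / (1 - r))%:E); last by rewrite mulrAC.
apply: nneseries_geometric_le => //; first by rewrite mulr_ge0 ?exprn_ge0.
  by move=> k; apply: integral_ge0 => w _; exact: measure_ge0.
move=> k; apply: (le_trans (expected_deficit_le k (ltn0Sn n) e0)).
rewrite lee_fin /C -!mulrA ler_wpM2l ?(ltW hT)// ler_wpM2l//.
rewrite [leLHS]mulrA [leRHS]mulrCA [leRHS]mulrC ler_wpM2r//.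
apply: (le_trans (ler_wpM2r (expR_ge0 _) (mul_le_expR n.+1 e20))).
rewrite -mulrA ler_wpM2l ?invr_ge0 ?(ltW e20)// -expRD -!expRM_natl -expRD ler_expR.
rewrite -(natr1 n) -(natr1 k).
have n0 : 0 <= n%:R :> R by []. have k0 : 0 <= k%:R :> R by [].
have nk : 0 <= n%:R * k%:R * e :> R by rewrite !mulr_ge0// ltW.
lra.
Qed.

End AlmostSure.

(** * From the exceptional areas to the [L^1] error *)

Section IntegratedBound.
Variable R : realType.
Local Notation m2 := (dm2 R).

Lemma succ_le_expR (e : R) : 0 < e -> \forall n \near \oo, n.+1%:R <= expR (n%:R * e).
Proof.
move=> e0; pose N := (Num.truncn (8 / e ^+ 2)).+1.
exists N => // n /= Nn.
have n1 : 1 <= n%:R :> R by rewrite ler1n (leq_trans _ Nn).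
have h : 8 <= n%:R * e ^+ 2.
  rewrite -ler_pdivrMr ?exprn_gt0//; apply: (le_trans (ltW (truncnS_gt _))).
  by rewrite ler_nat.
have E : expR (n%:R * e) = expR (n%:R * e / 2) ^+ 2.
  by rewrite -expRM_natl; congr expR; field.
have g : 1 + n%:R * e / 2 <= expR (n%:R * e / 2) by exact: expR_ge1Dx.
have p0 : 0 <= n%:R * e / 2 by rewrite !mulr_ge0 ?(ltW e0).
rewrite E; apply: (@le_trans _ _ ((1 + n%:R * e / 2) ^+ 2)).
  rewrite -natr1.
  have : 2 * n%:R <= (n%:R * e / 2) ^+ 2.
    rewrite (_ : (_ / 2) ^+ 2 = (n%:R * e ^+ 2) * n%:R / 4); last by field.
    by rewrite ler_pdivlMr// mulrAC ler_wpM2r//; lra.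
  rewrite sqrrD; nra.
by rewrite lerXn2r ?nnegrE ?expR_ge0 ?addr_ge0.
Qed.

(** The constant is [109 = 3 * 36 + 1]: the error [3 e] over a square of area [36], plus [e] times a
    total exceptional area of at most [1]. *)
Lemma integral_log_poly_le (c : nat -> R[i]) n (e : R) : (1 <= n)%N -> 0 < e ->
  n.+1%:R <= expR (n%:R * e) ->
  (forall j, (j <= n)%N -> Normc.normc (c j) <= expR (n%:R * e)) ->
  (forall k, measurable (log_deficit c n k e)) ->
  (\sum_(0 <= k <oo) m2 (log_deficit c n k e) <= 1)%E ->
  `|\int[m2]_(z in rect (-3) 3 (-3) 3)
     `|n%:R^-1 * ln (Normc.normc (scaled_weyl n c).[toC z]) - limit_potential z| |
  <= 109 * e.
Proof.
move=> n1 e0 ne cA mD D1.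
pose X (z : plane R) := n%:R^-1 * ln (Normc.normc (scaled_weyl n c).[toC z]) - limit_potential z.
set D := rect (-3) 3 (-3) 3.
have mR : measurable D by exact: measurable_rect.
have mX : measurable_fun setT X.
  apply: measurable_funB.
    by apply: measurable_funM => //; exact: measurable_poly_log.
  by apply: continuous_measurable_plane; exact: cont_limit_potential.
pose S (z : plane R) := (\sum_(0 <= k <oo) (\1_(log_deficit c n k e) z : R)%:E)%E.
have S0 z : (0 <= S z)%E by apply: nneseries_ge0 => k _ _; rewrite lee_fin.
have mS : measurable_fun D S.
  apply: ge0_emeasurable_sum => k *; first by rewrite lee_fin.
  by apply/measurable_EFinP; exact: measurable_indic.
have IS : (\int[m2]_(z in D) S z <= 1)%E.
  rewrite integral_nneseries//.
  - apply: le_trans D1; apply: lee_nneseries => k *; first by apply: integral_ge0 => z _; rewrite lee_fin.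
    rewrite integral_indic//.
    by apply: le_measure; rewrite ?inE//; exact: measurableI.
  - by move=> k; apply/measurable_EFinP; exact: measurable_indic.
have I0 : (0 <= \int[m2]_(z in D) `|X z|%:E)%E by apply: integral_ge0 => z _; rewrite lee_fin.
have bound : (\int[m2]_(z in D) `|X z|%:E <= (109 * e)%:E)%E.
  apply: (@le_trans _ _ (\int[m2]_(z in D) ((3 * e)%:E + e%:E * S z))%E).
    apply: ge0_le_integral => //.
    - by apply/measurable_EFinP; apply: measurableT_comp => //; exact: measurable_funTS.
    - apply: emeasurable_funD => //; exact: emeasurable_funM.
    - move=> z Dz.
      apply: (le_trans (log_poly_ge n1 e0 (log_poly_le z n1 e0 ne cA))).
      rewrite leeD2l// lee_pmul2l ?lte_fin//.
      apply: lee_nneseries => k *; first by rewrite lee_fin.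
      rewrite lee_fin !indicE; case: (boolP (k \in _)) => // /set_mem /= kz.
      by rewrite mem_set.
  have e0' : 0 <= e by exact: ltW.
  rewrite ge0_integralD//; first last.
  - exact: emeasurable_funM.
  - by move=> z _; rewrite mule_ge0.
  - by move=> z _; rewrite lee_fin mulr_ge0.
  rewrite ge0_integralZl_EFin// integral_cst// dm2_rect; [|by lra|by lra].
  apply: (@le_trans _ _ ((3 * e)%:E * ((3 - -3) * (3 - -3))%:E + e%:E * 1)%E).
    by rewrite leeD2l// lee_wpmul2l// lee_fin.
  by rewrite mule1 -EFinM -EFinD lee_fin; lra.
rewrite /Rintegral ger0_norm; last by apply: fine_ge0.
by rewrite -lee_fin fineK// ge0_fin_numE// (le_lt_trans bound)// ltry.
Qed.

End IntegratedBound.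

Section AlmostSurePotential.
Variables (R : realType) (d : measure_display) (Omega : measurableType d)
  (P : probability Omega R) (a : nat -> nat -> {RV P >-> plane R})
  (T : R) (law : set (plane R) -> \bar R).
Hypothesis hT : 0 < T.
Hypothesis hlaw : complex_law T law \/ real_law T law.
Hypothesis hdistr : forall n j : nat, (1 <= n)%N -> (j <= n)%N ->
  forall B : set (plane R), measurable B -> distribution P (a n j) B = law B.

Lemma ae_potential_cvg0 : mutually_independent
    [set i : nat * nat | (1 <= i.1)%N && (i.2 <= i.1)%N]
    (fun i : nat * nat => a i.1 i.2) ->
  {ae P, forall w, (fun n => \int[dm2 R]_(z in rect (-3) 3 (-3) 3)
    `|n%:R^-1 * ln (Normc.normc (scaled_weyl n (fun j => toC (a n j w))).[toC z])
      - limit_potential z|) @ \oo --> 0}.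
Proof.
move=> hindep.
have e0 m : 0 < m.+1%:R^-1 :> R by rewrite invr_gt0 ltr0n.
have h1 := @ae_foralln _ _ _ P _ (fun m => ae_modulus_le hT hlaw hdistr (e0 m)).
have h2 := @ae_foralln _ _ _ P _ (fun m => ae_deficit_cvg0 hT hlaw hdistr hindep (e0 m)).
apply: filterS2 h1 h2 => w h1 h2.
apply/cvgrPdist_le => eps eps0.
pose m := Num.truncn (109 / eps).
have em : 109 * m.+1%:R^-1 <= eps.
  rewrite ler_pdivrMr ?ltr0n// mulrC -ler_pdivrMr//.
  exact: ltW (truncnS_gt _).
(* A total deficit of at most [1] is enough here; the smallness of the integral comes from the
   factor [1 / (m + 1)]. *)
have /fine_cvgP[fin /cvgrPdist_le /(_ 1 ltr01) small] := h2 m.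
have [N1 _ H1] := h1 m.
have [N2 _ H2] := succ_le_expR (e0 m).
have [N3 _ H3] := fin; have [N4 _ H4] := small.
exists (N1 + N2 + N3 + N4).+1 => // -[//|n] /= Nn.
rewrite sub0r normrN; apply: le_trans em; apply: integral_log_poly_le => //.
- by apply: H2 => /=; lia.
- by move=> j jn; apply: (H1 n.+1) => //=; lia.
- by move=> k; exact: measurable_log_deficit.
have f3 := H3 n ltac:(rewrite /=; lia); have f4 := H4 n ltac:(rewrite /=; lia).
rewrite -[leLHS]fineK// lee_fin (le_trans _ f4)// sub0r normrN.
exact: ler_norm.
Qed.

(** A bounded density leaves no atom at the origin: [law_ball] is applied to disks around [0] of
    arbitrarily small radius. *)
Lemma ae_coef_neq0 : {ae P, forall w, forall n, (1 <= n)%N -> toC (a n n w) != 0}.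
Proof.
apply: ae_foralln => -[|n]; first by apply: filterE.
have mB : measurable [set w | toC (a n.+1 n.+1 w) = 0].
  have mc : measurable_fun setT (fun w => Normc.normc (toC (a n.+1 n.+1 w))).
    by apply: measurable_normc; exact: cmeasurable_toC.
  have := mc measurableT _ (measurable_set1 0); rewrite setTI.
  congr measurable; apply/seteqP; split => w; rewrite /preimage /mkset.
    exact: Normc.eq0_normc.
  by move=> h; rewrite h Normc.normc0.
exists [set w | toC (a n.+1 n.+1 w) = 0]; split => //; last first.
  by move=> w /= h; apply: contrapT => /eqP h'; apply: h => _.
apply/eqP; rewrite eq_le measure_ge0 andbT; apply/lee_addgt0Pr => e eps0.
rewrite add0e.
(* For [r <= 1] the bound [T (2 r + 4 r^2)] is at most [6 T r]. *)
pose r := Num.min 1 (e / (6 * T)).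
have r0 : 0 < r by rewrite lt_min ltr01 divr_gt0// mulr_gt0.
have r1 : r <= 1 by rewrite ge_min lexx.
have re : T * (6 * r) <= e.
  have : r <= e / (6 * T) by rewrite ge_min lexx orbT.
  by rewrite ler_pdivlMr ?mulr_gt0//; lra.
have := law_ball hT hlaw 0 (oner_neq0 _) (ltW r0).
rewrite -(hdistr (n := n.+1) (j := n.+1))//; last exact: measurable_affine_ball.
move=> h; apply: (@le_trans _ _ (distribution P (a n.+1 n.+1) (affine_ball 0 1 r))).
  rewrite /distribution /pushforward; apply: le_measure; rewrite ?inE//.
    have ma : measurable_fun setT (a n.+1 n.+1) by [].
    have := ma measurableT _ (measurable_affine_ball 0 1 r); rewrite setTI.
    by [].
  move=> w; rewrite /affine_ball /preimage /mkset => w0.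
  by rewrite w0 mul0r addr0 Normc.normc0 ltW.
apply: (le_trans h); rewrite Normc.normc1 divr1 lee_fin; apply: le_trans re.
rewrite ler_wpM2l ?(ltW hT)//.
have : r ^+ 2 <= r by rewrite expr2 ler_piMr// ltW.
lra.
Qed.

End AlmostSurePotential.

(** * Degree and distributional Laplacian of the random polynomials *)

Section Assembly.
Variable R : realType.

Lemma size_scaled_weyl n (c : nat -> R[i]) : (1 <= n)%N -> c n != 0 ->
  size (scaled_weyl n c) = n.+1.
Proof.
move=> n1 cn; rewrite /scaled_weyl size_poly_eq//= mulf_neq0//.
rewrite fmorph_eq0 gt_eqF// divr_gt0// sqrtr_gt0.
by rewrite exprn_gt0// ltr0n.
Qed.

Lemma normalized_laplacian_poly n (p : {poly R[i]}) : (1 <= n)%N -> size p = n.+1 ->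
  normalized_laplacian_is (fun z : R * R => n%:R^-1 * ln (Normc.normc p.[toC z]))
    (zero_measure n p).
Proof.
move=> n1 sp.
have p0 : p != 0 by rewrite -size_poly_gt0 sp.
split=> [K cK|f ft].
  have [M M0 KM] := compact_sub_rect cK.
  apply: (@integrableS _ _ _ _ (rect (- M) M (- M) M)).
  - exact: measurable_rect.
  - exact: compact_measurable_plane.
  - by move=> z /KM[z1 z2]; split; rewrite /= in_itv /= -ler_norml.
  - under eq_fun do rewrite EFinM.
    apply: integrableZl; first exact: measurable_rect.
    exact: integrable_poly_log.
have [M M0 fM] := test_function_C2 ft.
have cf : continuous f by case: ft => /(_ 0).
rewrite (integral_zero_measure (size_zeros sp) (continuous_measurable_plane cf)).
pose D := rect (- M) M (- M) M.
rewrite (Rintegral_supported (D := D)); last first.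
  by move=> z zD; rewrite /laplacian (C2_laplacian0 fM zD) mulr0.
have il : (dm2 R).-integrable D (fun z : plane R =>
    (ln (Normc.normc p.[toC z]) * laplacian f z)%:E).
  exact: (integrable_mul_laplacian fM (integrable_poly_log (- M) M (- M) M p0)).
have -> : (\int[dm2 R]_(z in D) (n%:R^-1 * ln (Normc.normc p.[toC z]) * laplacian f z)%:E =
    (n%:R^-1 * (2 * pi * \sum_(w <- zeros p) f (ofC w)))%:E)%E.
  rewrite -(poly_log_potential p0 M0 fM) EFinM.
  under eq_integral do rewrite -mulrA EFinM.
  rewrite integralZl//; last exact: measurable_rect.
  by congr (_ * _)%E; rewrite /Rintegral fineK// integrable_fin_num//; exact: measurable_rect.
rewrite -EFinM; congr EFin; rewrite /zero_avg mulrCA; congr (_ * _).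
by rewrite mulrA mulVf ?mul1r// gt_eqF// mulr_gt0// pi_gt0.
Qed.

End Assembly.

Theorem mainTheorem6 (R : realType) (d : measure_display)
    (Omega : measurableType d) (P : probability Omega R)
    (a : nat -> nat -> {RV P >-> plane R})
    (T : R) (law : set (plane R) -> \bar R)
    (hT : 0 < T)
    (hlaw : complex_law T law \/ real_law T law)
    (hdistr : forall n j : nat, (1 <= n)%N -> (j <= n)%N ->
       forall B : set (plane R), measurable B ->
         distribution P (a n j) B = law B)
    (hindep : mutually_independent
       [set i : nat * nat | (1 <= i.1)%N && (i.2 <= i.1)%N]
       (fun i : nat * nat => a i.1 i.2)) :
  let H (n : nat) (w : Omega) : {poly R[i]} :=
    scaled_weyl n (fun j => toC (a n j w)) in
  {ae P, forall w : Omega,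
     [/\ forall n : nat, (1 <= n)%N -> size (zeros (H n w)) = n,
         forall n : nat, (1 <= n)%N ->
           normalized_laplacian_is
             (fun z : R * R => n%:R^-1 * ln (Normc.normc (H n w).[toC z]))
             (zero_measure n (H n w)) &
         weak_cvg (fun n => zero_measure n (H n w)) (uniform_disk R)]}.
Proof.
move=> H.
have h1 := ae_coef_neq0 hT hlaw hdistr.
have h2 := ae_potential_cvg0 hT hlaw hdistr hindep.
apply: filterS2 h1 h2 => w h1 h2.
have sH n : (1 <= n)%N -> size (H n w) = n.+1.
  by move=> n1; apply: size_scaled_weyl => //; exact: h1.
split.
- by move=> n n1; apply: size_zeros; exact: sH.
- by move=> n n1; apply: normalized_laplacian_poly => //; exact: sH.
- exact: weak_cvg_of_potential.
Qed.
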